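(* Let $\Omega\subset\mathbb{R}^2$ be a bounded, connected, open set with Lipschitz boundary, let $T:L^2(\Omega)\to L^2(\Omega)$ be a bounded linear operator and let $\alpha,\beta\ge0$. Let $f:\mathbb{R}^2\to\mathbb{R}^+$ and $g:\mathbb{R}^4\to\mathbb{R}^+$ be convex functions, both minimised at $0$, for which there are constants $K_1,K_2,K_3,K_4>0$ with $K_3|x|\le f(x)\le K_1(1+|x|)$ for all $x\in\mathbb{R}^2$ and $K_4|x|\le g(x)\le K_2(1+|x|)$ for all $x\in\mathbb{R}^4$, and suppose that $f$ is differentiable. Write $J_f(u)=\int_\Omega f(\nabla u)\,dx$, $J_g(u)=g(D^2u)(\Omega)$ (which equals $\int_\Omega g(\nabla^2u)\,dx$ for $u\in W^{2,1}(\Omega)$) and $R=\alpha J_f+\beta J_g$. For a datum $u_0\in L^2(\Omega)$ consider the minimisation over $u\in BH(\Omega)$ of $$H_{u_0}(u)=\frac12\|u_0-Tu\|_{L^2}^2+\alpha J_f(u)+\beta J_g(u).$$ (1) Let $\tilde u$ be the original image, satisfying $T\tilde u=\tilde u_0$ and the source condition: there exists $\xi\in\partial R(\tilde u)$ such that $\xi=T^*q$ for a source element $q\in D(T^* )$. Let $u_0\in L^2(\Omega)$ be the noisy datum with $\|\tilde u_0-u_0\|_{L^2}\le\delta$, where $\delta>0$ is small. Then a minimiser $u$ of $H_{u_0}$ fulfils $$\alpha D^{symm}_{J_f}(u,\tilde u)+\beta D^{symm}_{J_g}(u,\tilde u)+\frac12\|Tu-\tilde u_0\|_{L^2}^2\le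 2\alpha^2\|q_\nabla\|_{L^2}^2+2\beta^2\|q_{\nabla^2}\|_{L^2}^2+\delta^2,$$ where the source element $q$ is decomposed as $q=\alpha q_\nabla+\beta q_{\nabla^2}$. (2) Moreover, let $u_1$ and $u_2$ be minimisers of $H_{u_{0,1}}$ and $H_{u_{0,2}}$ with data $u_{0,1}$ and $u_{0,2}$ respectively. Then $$\alpha D^{symm}_{J_f}(u_1,u_2)+\beta D^{symm}_{J_g}(u_1,u_2)+\frac12\|T(u_1-u_2)\|_{L^2}^2\le\frac12\|u_{0,1}-u_{0,2}\|_{L^2}^2 .$$
   Context: $BH(\Omega)=\{u\in W^{1,1}(\Omega):\nabla u\in[BV(\Omega)]^2\}$ is the space of functions of bounded Hessian. For $u\in BH(\Omega)$, $D^2u:=D(\nabla u)$ is an $\mathbb{R}^4$-valued finite Radon measure with density $\nabla^2u$ with respect to Lebesgue measure and singular part $D^s\nabla u$. With $g_\infty(x)=\lim_{t\to\infty}g(tx)/t$, $$g(D^2u)(\Omega)=\int_\Omega g(\nabla^2u)\,dx+\int_\Omega g_\infty\!\left(\frac{D^s\nabla u}{|D^s\nabla u|}\right)d|D^s\nabla u|.$$ $\partial$ denotes the subdifferential of a convex functional, $\langle\cdot,\cdot\rangle$ the duality product, $T^*$ the adjoint of $T$ and $D(T^* )$ its domain. For a convex functional $J$ the symmetric Bregman distance is $$D_J^{symm}(u_1,u_2)=\langle p_1-p_2,u_1-u_2\rangle,\qquad p_1\in\partial J(u_1),\ p_2\in\partial J(u_2).$$ Since $f$ is differentiable and $f,g$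 are convex, the subdifferential of $R$ is written as $\partial R(u)=-\alpha\,\mathrm{div}(f'(\nabla u))+\beta\,\partial J_g(u)$. *)

(* Defs.v *)
From HB Require Import structures.
From mathcomp Require Import all_boot all_order all_algebra.
From mathcomp Require Import all_classical all_reals all_analysis.

Set Implicit Arguments.
Unset Strict Implicit.
Unset Printing Implicit Defensive.

Import Order.TTheory GRing.Theory Num.Theory numFieldNormedType.Exports.

Local Open Scope classical_set_scope.
Local Open Scope ring_scope.

(* R * R with its Borel sigma-algebra. Its topology and norm are those of
   R * R, hence the casts to R * R below. *)
Notation plane R := (measurableTypeR R * measurableTypeR R)%type.

Definition leb2 {R : realType} : {measure set (plane R) -> \bar R} :=
  (@lebesgue_measure R \x @lebesgue_measure R)%E.

(* On 'rV_n this is |x|; on 'M_2 it is the Euclidean norm of R^4. *)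
Definition enorm {R : realType} m n (A : 'M[R]_(m, n)) : R :=
  Num.sqrt (\sum_i \sum_j A i j ^+ 2).

Definition lipschitz_boundary {R : realType} (Omega : set (R * R)) : Prop :=
  forall z : R * R, closure Omega z -> ~ Omega z ->
  exists (r c s k : R) (gam : R -> R),
    [/\ 0 < r, c ^+ 2 + s ^+ 2 = 1, k.-lipschitz gam &
      forall y : R * R, ball z r y ->
        (Omega y <-> gam (c * y.1 + s * y.2) < - s * y.1 + c * y.2)].

Section test_functions.
Context {R : realType}.

Definition basis_vec (i : 'I_2) : R * R :=
  ((i == 0 :> nat)%:R, (i == 1 :> nat)%:R).

Definition partial (i : 'I_2) (phi : R * R -> R) : R * R -> R :=
  'D_(basis_vec i) phi.

Definition smooth (phi : R * R -> R) : Prop :=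
  forall (s : seq 'I_2) (x : R * R), differentiable (foldr partial phi s) x.

Definition test_function (Omega : set (R * R)) (phi : R * R -> R) : Prop :=
  [/\ smooth phi, compact (closure [set x | phi x != 0]) &
      closure [set x | phi x != 0] `<=` Omega].

End test_functions.

Section function_spaces.
Context {R : realType} (Omega : set (plane R)).
Implicit Types (u v : plane R -> R) (w : plane R -> 'rV[R]_2).

Definition L2 u : Prop := (u \_ Omega) \in Lfun leb2 2%:E.

Definition L2_norm u : R := fine (Lnorm leb2 2%:E (EFin \o (u \_ Omega))).

Definition L2_inner u v : R := \int[leb2]_(x in Omega) (u x * v x).

Definition weak_gradient u w : Prop :=
  forall i, leb2.-integrable Omega (EFin \o (fun x => w x 0 i)) /\
  forall phi, test_function Omega phi ->
    \int[leb2]_(x in Omega) (u x * partial i phi x) =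
    - \int[leb2]_(x in Omega) (w x 0 i * phi x).

Definition W11 u : Prop :=
  leb2.-integrable Omega (EFin \o u) /\ exists w, weak_gradient u w.

(* The weak gradient, up to a null set; 0 if there is none. *)
Definition grad u : plane R -> 'rV[R]_2 :=
  match pselect (exists w, weak_gradient u w) with
  | left h => sval (cid h)
  | right _ => fun=> 0
  end.

(* Integral of a function against a finite signed measure. *)
Definition charge_integral (nu : {charge set (plane R) -> \bar R})
    (phi : plane R -> R) : R :=
  let hP := cid (Hahn_decomposition nu) in
  let hN := cid (svalP hP) in
  \int[jordan_pos (svalP hN)]_x phi x - \int[jordan_neg (svalP hN)]_x phi x.

(* Finite signed Radon measures on Omega are represented as charges on the
   plane carried by Omega. *)
Definition distr_gradient v (nu : 'I_2 -> {charge set (plane R) -> \bar R})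
    : Prop :=
  forall j, (forall A, measurable A -> nu j A = nu j (A `&` Omega)) /\
  forall phi, test_function Omega phi ->
    \int[leb2]_(x in Omega) (v x * partial j phi x) =
    - charge_integral (nu j) phi.

Definition BV v : Prop :=
  leb2.-integrable Omega (EFin \o v) /\ exists nu, distr_gradient v nu.

Definition BH u : Prop := W11 u /\ forall i, BV (fun x => grad u x 0 i).

(* R^4-valued measures, indexed by pairs (i, j). *)
Definition vmeasure := 'I_2 -> 'I_2 -> {charge set (plane R) -> \bar R}.

(* D^2 u: the (i, j) component is D_j (partial_i u). *)
Definition hessian u : vmeasure :=
  match pselect (exists D : vmeasure,
                   forall i, distr_gradient (fun x => grad u x 0 i) (D i)) with
  | left h => sval (cid h)
  | right _ => fun _ _ => czero
  end.

Definition total_variation (S : vmeasure) (A : set (plane R)) : \bar R :=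
  ereal_sup [set x | exists F : (set (plane R))^nat,
    [/\ forall k, measurable (F k), trivIset setT F, \bigcup_k F k = A &
        x = (\sum_(0 <= k <oo)
               (enorm (\matrix_(i, j) fine (S i j (F k))))%:E)%E]].

Definition singular_vmeasure (S : vmeasure) : Prop :=
  exists2 N : set (plane R), measurable N /\ leb2 N = 0%E &
    forall A i j, measurable A -> S i j (A `\` N) = 0%E.

Definition lebesgue_decomposition (D : vmeasure) (h : plane R -> 'M[R]_2)
    (S : vmeasure) : Prop :=
  [/\ forall i j, leb2.-integrable Omega (EFin \o (fun x => h x i j)),
      singular_vmeasure S &
      forall A i j, measurable A ->
        D i j A = (\int[leb2]_(x in A `&` Omega) (h x i j)%:E + S i j A)%E].

(* tau is |S| and th is the density S / |S|. *)
Definition polar_decomposition (S : vmeasure)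
    (tau : {finite_measure set (plane R) -> \bar R})
    (th : plane R -> 'M[R]_2) : Prop :=
  (forall A, measurable A -> tau A = total_variation S A) /\
  forall i j, tau.-integrable setT (EFin \o (fun x => th x i j)) /\
    forall A, measurable A -> S i j A = (\int[tau]_(x in A) (th x i j)%:E)%E.

Definition BH_norm u : R :=
  \int[leb2]_(x in Omega) `|u x| + \int[leb2]_(x in Omega) enorm (grad u x) +
  fine (total_variation (hessian u) Omega).

(* For a bounded Lipschitz domain of the plane BH embeds into L^2, so that BH_L2
   is BH; membership in L2 is recorded because operators on L^2 are applied to
   elements of BH. *)
Definition BH_L2 u : Prop := BH u /\ L2 u.

Definition BH_dual (p : (plane R -> R) -> R) : Prop :=
  (forall (a : R) u v, BH_L2 u -> BH_L2 v ->
     p (fun x => a * u x + v x) = a * p u + p v) /\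
  exists C : R, forall u, BH_L2 u -> `|p u| <= C * BH_norm u.

Definition subdifferential (J : (plane R -> R) -> \bar R) u
    (p : (plane R -> R) -> R) : Prop :=
  [/\ BH_L2 u, BH_dual p &
      forall v, BH_L2 v -> (J u + (p (v \- u))%:E <= J v)%E].

Definition minimiser (H : (plane R -> R) -> \bar R) u : Prop :=
  BH_L2 u /\ forall v, BH_L2 v -> (H u <= H v)%E.

Definition bounded_linear_L2 (T : (plane R -> R) -> (plane R -> R)) : Prop :=
  [/\ forall u, L2 u -> L2 (T u),
      forall (a : R) u v, L2 u -> L2 v ->
        ae_eq leb2 Omega (T (fun x => a * u x + v x))
                         (fun x => a * T u x + T v x) &
      exists C : R, forall u, L2 u -> L2_norm (T u) <= C * L2_norm u].

(* T^* q, as the functional v |-> <q, T v>. *)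
Definition adjoint (T : (plane R -> R) -> (plane R -> R)) q
    : (plane R -> R) -> R :=
  fun v => L2_inner q (T v).

Definition adjoint_dom (T : (plane R -> R) -> (plane R -> R)) q : Prop :=
  L2 q /\ exists C : R, forall v, L2 v -> `|adjoint T q v| <= C * L2_norm v.

End function_spaces.

Section functionals.
Context {R : realType} (Omega : set (plane R)).
Implicit Types (u : plane R -> R) (f : 'rV[R]_2 -> R) (g : 'rV[R]_4 -> R).

Definition recession g (x : 'rV[R]_4) : R := lim (g (t *: x) / t @[t --> +oo]).

Definition J_f f u : \bar R := (\int[leb2]_(x in Omega) (f (grad Omega u x))%:E)%E.

(* g (D^2 u)(Omega); the value does not depend on the decomposition that is
   picked, and it is +oo if u has no Hessian measure. *)
Definition J_g g u : \bar R :=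
  xget +oo%E [set c | BH Omega u /\
    exists (h : plane R -> 'M[R]_2) (S : vmeasure)
      (tau : {finite_measure set (plane R) -> \bar R}) (th : plane R -> 'M[R]_2),
    [/\ lebesgue_decomposition Omega (hessian Omega u) h S,
        polar_decomposition S tau th &
        c = (\int[leb2]_(x in Omega) (g (mxvec (h x)))%:E +
             \int[tau]_(x in Omega) (recession g (mxvec (th x)))%:E)%E]].

Definition regulariser (alpha beta : R) f g u : \bar R :=
  (alpha%:E * J_f f u + beta%:E * J_g g u)%E.

Definition objective (T : (plane R -> R) -> (plane R -> R)) (alpha beta : R) f g
    (u0 : plane R -> R) u : \bar R :=
  ((2^-1 * L2_norm Omega (u0 \- T u) ^+ 2)%:E + alpha%:E * J_f f u
   + beta%:E * J_g g u)%E.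

(* <p1 - p2, u1 - u2>, for p1 and p2 subgradients at u1 and u2. *)
Definition bregman_symm (p1 p2 : (plane R -> R) -> R) (u1 u2 : plane R -> R) : R :=
  p1 (u1 \- u2) - p2 (u1 \- u2).

(* p and s are subgradients of J_f and J_g at u with xi = alpha p + beta s. *)
Definition splits (alpha beta : R) f g u (xi p s : (plane R -> R) -> R) : Prop :=
  [/\ subdifferential Omega (J_f f) u p, subdifferential Omega (J_g g) u s &
      forall v, BH_L2 Omega v -> xi v = alpha * p v + beta * s v].

End functionals.

(* Main.v *)
(* Under linear growth, convexity makes J_f and J_g finite and Lipschitz for
   the BH norm on BH (Omega). For J_g this rests on the uniqueness and the
   additivity of the Hessian measure, obtained by testing against tensor
   products of smooth bumps that increase to indicators of rectangles, and on
   the 1-homogeneity of the recession function, which lets the singular parts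
   of two Hessian measures be compared against a common dominating measure.
   Comparing a minimiser u with u + t (v - u) as t -> 0 gives
   (u0 - T u, T (v - u)) <= R v - R u, and Hahn-Banach splits the left-hand
   side as alpha p + beta s with p and s subgradients of J_f and J_g at u;
   these are automatically bounded for the BH norm. Subtracting the optimality
   conditions turns the weighted Bregman distances into an L2 inner product,
   and both estimates follow by completing squares. *)
Require Import Defs.
From HB Require Import structures.
From mathcomp Require Import all_boot all_order all_algebra.
From mathcomp Require Import all_classical all_reals all_analysis.
From mathcomp Require Import measurable_realfun.
From mathcomp Require Import ring lra.
Set Implicit Arguments.
Unset Strict Implicit.
Unset Printing Implicit Defensive.
Import Order.TTheory GRing.Theory Num.Theory numFieldNormedType.Exports.
Local Open Scope classical_set_scope.
Local Open Scope ring_scope.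

(** * Splitting subgradients *)

Section convex_Hahn_Banach.
Context {R : realType} {V : lmodType R}.
Implicit Types (W : set V) (L phi : V -> R) (G : set (V * R)).

(** Since [J_f] and [J_g] are finite on all of BH, the sum rule for subgradients needs no topology:
    a purely linear Hahn-Banach theorem suffices, and continuity of the pieces is recovered
    afterwards. The main obstacle is that [grad], [hessian] and the decomposition inside [J_g] are
    choices made separately for each function, and that [T] is linear only up to null sets. Each
    algebraic identity is therefore recovered from a uniqueness statement, almost everywhere or on
    measurable sets. The constants in (1) arise as follows. Put e = T u - ut0 and n = ut0 - u0. The
    residual is - n - e, so the left-hand side becomes - <n + q, e> - |e|^2 / 2, which is at most |n
    + q|^2 / 2 <= |n|^2 + |q|^2; and |q|^2 is at most twice the sum of the squared norms of its two
    parts. In (2), with e and n the differences of the images and of the data, only <n, e> - |e|^2 /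
    2 <= |n|^2 / 2 is left. *)

Definition subspace W : Prop :=
  W 0 /\ forall a u v, W u -> W v -> W (a *: u + v).

Definition linear_on W L : Prop :=
  forall a u v, W u -> W v -> L (a *: u + v) = a * L u + L v.

Definition convex_on W phi : Prop :=
  forall t u v, 0 <= t <= 1 -> W u -> W v ->
    phi (t *: u + (1 - t) *: v) <= t * phi u + (1 - t) * phi v.

Lemma subspaceZ W a u : subspace W -> W u -> W (a *: u).
Proof. by move=> [W0 WL] Wu; rewrite -[_ *: _]addr0; exact: WL. Qed.

Lemma subspaceD W u v : subspace W -> W u -> W v -> W (u + v).
Proof. by move=> [W0 WL] Wu Wv; rewrite -[u]scale1r; exact: WL. Qed.

Lemma subspaceB W u v : subspace W -> W u -> W v -> W (u - v).
Proof. by move=> [W0 WL] Wu Wv; rewrite addrC -scaleN1r; exact: WL. Qed.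

Lemma linear_on0 W L : subspace W -> linear_on W L -> L 0 = 0.
Proof.
move=> [W0 _] LL; have := LL 1 0 0 W0 W0.
by rewrite scaler0 addr0 mul1r => /eqP; rewrite -subr_eq subrr => /eqP.
Qed.

Lemma linear_onZ W L a u : subspace W -> linear_on W L -> W u ->
  L (a *: u) = a * L u.
Proof.
move=> sW LL Wu; rewrite -[a *: u]addr0 LL//; last by case: sW.
by rewrite (linear_on0 sW LL) addr0.
Qed.

Lemma linear_onD W L u v : linear_on W L -> W u -> W v -> L (u + v) = L u + L v.
Proof. by move=> LL Wu Wv; rewrite -{1}[u]scale1r LL// mul1r. Qed.

(* Partial functionals are handled through their graphs, which are ordered by
   inclusion. *)
Definition dominated_graph W phi G : Prop :=
  (forall r u a v b, G (u, a) -> G (v, b) -> G (r *: u + v, r * a + b)) /\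
  forall u a, G (u, a) -> W u /\ a <= phi u.

(** Over 0 the graph is closed under scaling, so a nonzero value there could be scaled up to
    [phi 0 + 1]. This is what makes a dominated graph single-valued. *)
Lemma dominated_graph0 W phi G c : dominated_graph W phi G -> G (0, c) -> c = 0.
Proof.
move=> [Gl Gd] G0.
have G00 : G (0, 0) by have := Gl (-1) _ _ _ _ G0 G0; rewrite scaler0 addr0 mulN1r addNr.
apply: contrapT => /eqP c0.
have := Gl ((phi 0 + 1) / c) _ _ _ _ G0 G00.
rewrite scaler0 addr0 addr0 mulfVK// => /Gd[_].
by rewrite gerDl ler10.
Qed.

Lemma dominated_graph_fun W phi G u a b :
  dominated_graph W phi G -> G (u, a) -> G (u, b) -> a = b.
Proof.
move=> dG Ga Gb; apply/eqP; rewrite eq_sym -subr_eq0; apply/eqP.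
apply: (dominated_graph0 dG); have := dG.1 (-1) _ _ _ _ Ga Gb.
by rewrite scaleN1r addNr mulN1r addrC.
Qed.

(** One-dimensional extension. An admissible slope lies above all quotients
    [(a - phi (x - s *: z)) / s] and below all [(phi (y + t *: z) - b) / t]; convexity orders the
    two families, and [c] is the supremum of the lower one. *)
Lemma dominated_graph_step W phi G z :
  subspace W -> convex_on W phi -> dominated_graph W phi G -> G (0, 0) -> W z ->
  exists c, forall x a t, G (x, a) -> a + t * c <= phi (x + t *: z).
Proof.
move=> sW cphi [Gl Gd] G0 Wz.
have key x a (s : R) y b (t : R) : G (x, a) -> 0 < s -> G (y, b) -> 0 < t ->
    (a - phi (x - s *: z)) / s <= (phi (y + t *: z) - b) / t.
  move=> Ga s0 Gb t0.
  have st0 : 0 < s + t by rewrite addr_gt0.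
  have [Wx _] := Gd _ _ Ga; have [Wy _] := Gd _ _ Gb.
  have W1 : W (y + t *: z) by apply: subspaceD => //; exact: subspaceZ.
  have W2 : W (x - s *: z) by apply: subspaceB => //; exact: subspaceZ.
  (* With these weights the [z]-components of [y + t *: z] and [x - s *: z] cancel, leaving a point
     over which [G] already has a value. *)
  have l01 : 0 <= s / (s + t) <= 1.
    by rewrite divr_ge0 ?(ltW s0) ?(ltW st0)//= ler_pdivrMr// mul1r lerDl ltW.
  have := cphi _ _ _ l01 W1 W2.
  have -> : 1 - s / (s + t) = t / (s + t) by field; rewrite gt_eqF//.
  have -> : (s / (s + t)) *: (y + t *: z) + (t / (s + t)) *: (x - s *: z) =
     (s / (s + t)) *: y + (t / (s + t)) *: x.
    rewrite !scalerDr scalerN !scalerA addrACA.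
    by rewrite (_ : s / (s + t) * t = t / (s + t) * s) ?subrr ?addr0//; ring.
  have Gx : G ((t / (s + t)) *: x, t / (s + t) * a).
    by have := Gl (t / (s + t)) _ _ _ _ Ga G0; rewrite !addr0.
  have := Gd _ _ (Gl (s / (s + t)) _ _ _ _ Gb Gx) => -[_ h1] h2.
  have := le_trans h1 h2.
  set p := phi _; set q := phi _ => h.
  rewrite ler_pdivrMr// mulrAC ler_pdivlMr//.
  have : (s * b + t * a) / (s + t) <= (s * p + t * q) / (s + t).
    have E x1 x2 : (s * x1 + t * x2) / (s + t) = s / (s + t) * x1 + t / (s + t) * x2.
      by ring.
    by rewrite !E.
  by rewrite ler_pM2r ?invr_gt0//; lra.
pose S := [set r | exists x a s, [/\ G (x, a), 0 < s & r = (a - phi (x - s *: z)) / s]].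
have S0 : S !=set0 by exists ((0 - phi (0 - 1 *: z)) / 1), 0, 0, 1.
have ubS y b t : G (y, b) -> 0 < t -> ubound S ((phi (y + t *: z) - b) / t).
  by move=> Gy t0 _ [x [a [s [Ga s0 ->]]]]; exact: key.
have hS : has_sup S by split => //; exists ((phi (0 + 1 *: z) - 0) / 1); exact: ubS.
exists (sup S) => x a t Ga; have [t0|t0|->] := ltgtP t 0.
- have /ub_le_sup : has_ubound S by case: hS.
  have : S ((a - phi (x - (- t) *: z)) / (- t)) by exists x, a, (- t); rewrite oppr_gt0.
  move=> /[swap] /[apply]; rewrite ler_pdivrMr ?oppr_gt0// scaleNr opprK; lra.
- have := ge_sup S0 (ubS _ _ _ Ga t0).
  by rewrite ler_pdivlMr// mulrC; lra.
- by rewrite mul0r scale0r !addr0; have [] := Gd _ _ Ga.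
Qed.

Theorem convex_Hahn_Banach W phi (F : set V) (l : V -> R) :
  subspace W -> convex_on W phi -> subspace F -> F `<=` W -> linear_on F l ->
  (forall u, F u -> l u <= phi u) ->
  exists L, [/\ linear_on W L, forall u, W u -> L u <= phi u &
    forall u, F u -> L u = l u].
Proof.
move=> sW cphi sF FW lF lphi.
pose G0 := [set p : V * R | F p.1 /\ p.2 = l p.1].
have dG0 : dominated_graph W phi G0.
  split=> [r u a v b [/= Fu ->] [/= Fv ->]|u a [/= Fu ->]].
    by split => /=; [exact: sF.2|rewrite lF].
  by split; [exact: FW|exact: lphi].
have G00 : G0 (0, 0) by split => /=; [by case: sF|rewrite (linear_on0 sF lF)].
(* The inclusion is asked only of nonempty graphs because Zorn's lemma also tests the empty chain,
   whose union is empty. Maximality then excludes the empty graph, [G0] being strictly larger. *)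
pose P := [set G | dominated_graph W phi G /\ (G !=set0 -> G0 `<=` G)].
have [|A [[dA A0] Amax]] := @Zorn_bigcup _ P.
  move=> Fam FP tot; split; last first.
    by move=> [x [X FX Xx]] y /((FP _ FX).2 (ex_intro _ _ Xx)) Xy; exists X.
  split=> [r u a v b [X FX Xu] [Y FY Yv]|u a [X FX Xu]]; last first.
    exact: (FP _ FX).1.2.
  have [XY|YX] := tot _ _ FX FY.
    by exists Y => //; apply: (FP _ FY).1.1 => //; exact: XY.
  by exists X => //; apply: (FP _ FX).1.1 => //; exact: YX.
have {}A0 : G0 `<=` A.
  have [/A0//|/nonemptyPn A0'] := pselect (A !=set0).
  exfalso; apply: (Amax G0); last by split => // _; exact: subset_refl.
  by rewrite A0'; split => // /(_ _ G00).
have dom z : W z -> exists a, A (z, a).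
  move=> Wz; apply: contrapT => nz.
  have [c hc] := dominated_graph_step sW cphi dA (A0 _ G00) Wz.
  pose B := [set p : V * R | exists x a t, A (x, a) /\ p = (x + t *: z, a + t * c)].
  have AB : A `<=` B.
    by move=> [x a] Ax; exists x, a, 0; rewrite scale0r mul0r !addr0.
  apply: (Amax B).
    split => // BA; apply: nz; exists c; apply: BA; exists 0, 0, 1.
    by rewrite scale1r mul1r !add0r; split => //; exact: A0.
  split; last by move=> _; exact: subset_trans AB.
  split=> [r u a v b [x [a' [t [Ax [-> ->]]]]] [y [b' [s [Ay [-> ->]]]]]|u a].
    exists (r *: x + y), (r * a' + b'), (r * t + s); split; first exact: dA.1.
    by congr pair; [rewrite scalerDr scalerDl scalerA addrACA|ring].
  move=> [x [a' [t [Ax [-> ->]]]]]; split; last exact: hc.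
  by apply: subspaceD => //; [case: (dA.2 _ _ Ax)|exact: subspaceZ].
have /choice [L hL] : forall z, exists a, W z -> A (z, a).
  by move=> z; have [/dom[a]|] := pselect (W z); [exists a|exists 0].
exists L; split=> [a u v Wu Wv|u Wu|u Fu].
- apply: (dominated_graph_fun dA (hL _ (sW.2 a _ _ Wu Wv))).
  by apply: dA.1; exact: hL.
- by have [] := dA.2 _ _ (hL _ Wu).
- by apply: (dominated_graph_fun dA (hL _ (FW _ Fu))); apply: A0.
Qed.

End convex_Hahn_Banach.

Section subgradient_split.
Context {R : realType} {V : lmodType R}.
Implicit Types (W : set V) (L J : V -> R).

(** The zero functional on {0} is extended below [h |-> J (u + h) - J u]. This serves the case of a
    vanishing weight, where the split says nothing about a component that must still be a
    subgradient. *)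
Lemma subgradient_exists W J u : subspace W -> convex_on W J -> W u ->
  exists2 p, linear_on W p & forall v, W v -> J u + p (v - u) <= J v.
Proof.
move=> sW cJ Wu.
have := @convex_Hahn_Banach R V W (fun h => J (u + h) - J u) [set 0] (fun=> 0) sW.
case.
- move=> t v w t01 Wv Ww.
  have -> : u + (t *: v + (1 - t) *: w) = t *: (u + v) + (1 - t) *: (u + w).
    by rewrite !scalerDr addrACA -scalerDl subrKC scale1r.
  have := cJ _ _ _ t01 (subspaceD sW Wu Wv) (subspaceD sW Wu Ww); lra.
- by split => // a x y -> ->; rewrite scaler0 addr0.
- by move=> _ ->; case: sW.
- by move=> a x y _ _; rewrite mulr0 addr0.
- by move=> _ ->; rewrite addr0 subrr.
- move=> p [Lp pJ _]; exists p => // v Wv.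
  have := pJ _ (subspaceB sW Wv Wu); rewrite subrKC; lra.
Qed.

(* Hahn-Banach on V * V, extending xi from the diagonal below
   a (J1 (u + h1) - J1 u) + b (J2 (u + h2) - J2 u). *)
Lemma subgradient_split W J1 J2 (a b : R) (xi : V -> R) u :
  subspace W -> convex_on W J1 -> convex_on W J2 -> 0 <= a -> 0 <= b -> W u ->
  linear_on W xi ->
  (forall v, W v -> xi (v - u) <= a * (J1 v - J1 u) + b * (J2 v - J2 u)) ->
  exists p s, [/\ linear_on W p, linear_on W s,
    forall v, W v -> J1 u + p (v - u) <= J1 v,
    forall v, W v -> J2 u + s (v - u) <= J2 v &
    forall v, W v -> xi v = a * p v + b * s v].
Proof.
move=> sW cJ1 cJ2 a0 b0 Wu Lxi xiJ.
pose W2 := [set p : V * V | W p.1 /\ W p.2].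
have sW2 : subspace W2.
  split; first by split; case: sW.
  by move=> r [x1 x2] [y1 y2] [/= ? ?] [/= ? ?]; split => /=; apply: sW.2.
have [||||| L [LL Lphi Ldiag]] := @convex_Hahn_Banach R (V * V)%type W2
  (fun h => a * (J1 (u + h.1) - J1 u) + b * (J2 (u + h.2) - J2 u))
  [set p | W p.1 /\ p.1 = p.2] (fun p => xi p.1) sW2.
- move=> t [v1 v2] [w1 w2] t01 [/= Wv1 Wv2] [/= Ww1 Ww2].
  have E v w : u + (t *: v + (1 - t) *: w) = t *: (u + v) + (1 - t) *: (u + w).
    by rewrite !scalerDr addrACA -scalerDl subrKC scale1r.
  rewrite !E.
  have /(ler_wpM2l a0) := cJ1 _ _ _ t01 (subspaceD sW Wu Wv1) (subspaceD sW Wu Ww1).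
  have /(ler_wpM2l b0) := cJ2 _ _ _ t01 (subspaceD sW Wu Wv2) (subspaceD sW Wu Ww2).
  lra.
- split; first by split => //; case: sW.
  move=> r [x1 x2] [y1 y2] [/= ? <-] [/= ? <-]; split => //=; exact: sW.2.
- by move=> [x1 x2] [/= ? <-].
- by move=> r [x1 x2] [y1 y2] [/= ? _] [/= ? _]; exact: Lxi.
- move=> [h1 h2] [/= Wh <-].
  by have := xiJ _ (subspaceD sW Wu Wh); rewrite addrAC subrr add0r.
have W0 : W 0 by case: sW.
pose L1 h := L (h, 0); pose L2 h := L (0, h).
have LL1 : linear_on W L1.
  by move=> r x y Wx Wy; rewrite /L1 -LL//; congr L; congr pair => /=; rewrite scaler0 addr0.
have LL2 : linear_on W L2.
  by move=> r x y Wx Wy; rewrite /L2 -LL//; congr L; congr pair => /=; rewrite scaler0 addr0.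
have xiE v : W v -> xi v = L1 v + L2 v.
  move=> Wv; rewrite -(Ldiag (v, v))// /L1 /L2 -(linear_onD LL)//.
  by congr L; congr pair => /=; rewrite ?addr0 ?add0r.
have L1J v : W v -> L1 (v - u) <= a * (J1 v - J1 u).
  move=> Wv; have := Lphi (v - u, 0) (conj (subspaceB sW Wv Wu) W0).
  by rewrite /= subrKC addr0 subrr mulr0 addr0.
have L2J v : W v -> L2 (v - u) <= b * (J2 v - J2 u).
  move=> Wv; have := Lphi (0, v - u) (conj W0 (subspaceB sW Wv Wu)).
  by rewrite /= subrKC addr0 subrr mulr0 add0r.
have aux J c (K : V -> R) : convex_on W J -> 0 <= c -> linear_on W K ->
    (forall v, W v -> K (v - u) <= c * (J v - J u)) ->
    exists p, [/\ linear_on W p, forall v, W v -> J u + p (v - u) <= J v &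
      forall v, W v -> K v = c * p v].
  (* For [c = 0] the bound reads [K (v - u) <= 0] on a subspace, which forces [K = 0] there, so any
     subgradient of [J] will do. For [c > 0] one divides by [c]. *)
  move=> cJ; rewrite le_eqVlt => /predU1P[<-|c0] LK KJ.
    have [p Lp pJ] := subgradient_exists sW cJ Wu; exists p; split => // v Wv.
    have := KJ _ (subspaceD sW Wv Wu); have := KJ _ (subspaceB sW Wu Wv).
    rewrite addrK !mul0r addrAC subrr add0r -scaleN1r (linear_onZ _ sW)//; lra.
  exists (fun v => K v / c); split => [r x y Wx Wy|v Wv|v Wv].
  - by rewrite LK// mulrDl mulrA.
  - have := KJ _ Wv; rewrite mulrC -ler_pdivrMr//; lra.
  - by rewrite mulrCA mulfV ?mulr1// gt_eqF.
have [p [Lp pJ L1E]] := aux _ _ _ cJ1 a0 LL1 L1J.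
have [s [Ls sJ L2E]] := aux _ _ _ cJ2 b0 LL2 L2J.
by exists p, s; split => // v Wv; rewrite xiE// L1E// L2E.
Qed.

End subgradient_split.

(** * Bump functions *)

Section smooth_line.
Context {R : realType}.
Implicit Types (a b : R -> R) (P : {poly R}) (x : R).

Fixpoint derivable_n (n : nat) a : Prop :=
  if n is n'.+1 then
    (forall x, derivable a x 1) /\ derivable_n n' (fun x => 'D_1 a x)
  else True.

Definition smooth_line a : Prop := forall n, derivable_n n a.

Lemma derivable_nW n a : derivable_n n.+1 a -> derivable_n n a.
Proof.
elim: n a => // n IH a [da dna]; split => //; exact: IH.
Qed.

Lemma derivable_nD n a b : derivable_n n a -> derivable_n n b ->
  derivable_n n (fun x => a x + b x).
Proof.
elim: n a b => // n IH a b [da dna] [db dnb]; split.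
  by move=> x; exact: derivableD.
rewrite (_ : (fun x => 'D_1 _ x) = fun x => 'D_1 a x + 'D_1 b x); first exact: IH.
by apply/funext => x; rewrite deriveD.
Qed.

Lemma derivable_nM n a b : derivable_n n a -> derivable_n n b ->
  derivable_n n (fun x => a x * b x).
Proof.
elim: n a b => // n IH a b [da dna] [db dnb]; split.
  by move=> x; exact: derivableM.
rewrite (_ : (fun x => 'D_1 _ x) = fun x => a x * 'D_1 b x + b x * 'D_1 a x).
  by apply: derivable_nD; apply: IH => //; apply: derivable_nW.
by apply/funext => x; rewrite deriveM.
Qed.

Lemma derivable_n_cst n c : derivable_n n (fun=> c).
Proof.
elim: n c => // n IH c; split; first by move=> x; exact: derivable_cst.
rewrite (_ : (fun x => 'D_1 _ x) = fun=> 0); first exact: IH.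
by apply/funext => x; rewrite derive_cst.
Qed.

Lemma derivable_n_affine n a c d : derivable_n n a ->
  derivable_n n (fun x => a (c * x + d)).
Proof.
elim: n a => // n IH a [da dna].
have dE (x : R) : is_derive x 1 (fun x : R => a (c * x + d)) ('D_1 a (c * x + d) * c).
  have h1 : is_derive (c * x + d) 1 a ('D_1 a (c * x + d)) by exact: derivableP.
  have h2 : is_derive x 1 (fun y : R => c * y + d) c.
    apply: is_derive_eq; rewrite addr0.
    by rewrite /GRing.scale /= mulr1.
  exact: (@is_derive1_comp R a (fun y => c * y + d) x _ _ h1 h2).
split; first by move=> x; exact: (ex_derive (is_derive := dE x)).
rewrite (_ : (fun x => 'D_1 _ x) = fun x => 'D_1 a (c * x + d) * c).
  apply: (@derivable_nM n (fun x => 'D_1 a (c * x + d)) (fun=> c)).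
    exact: (IH (fun x => 'D_1 a x) dna).
  exact: derivable_n_cst.
by apply/funext => x; rewrite (derive_val (is_derive := dE x)).
Qed.

(* Closed under differentiation, and contains exp(-1/x) for x > 0. *)
Definition exp_inv P x : R := if 0 < x then P.[x^-1] * expR (- x^-1) else 0.

(** The derivative of P(1/x) exp(-1/x) is x^-2 (P - P')(1/x) exp(-1/x), of the same shape with this
    polynomial. *)
Definition exp_inv_deriv P : {poly R} := 'X^2 * (P - P^`()).

Lemma poly_le_expR P : exists2 C, 0 <= C &
  forall y, 0 <= y -> `|P.[y]| <= C * expR y.
Proof.
have pow n : exists2 C : R, 0 <= C & forall y : R, 0 <= y -> y ^+ n <= C * expR y.
  case: n => [|n].
    exists 1 => // y y0; rewrite expr0 mul1r (le_trans _ (expR_ge1Dx _))//; lra.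
  exists (n.+1`!%:R) => // y y0; rewrite -ler_pdivrMl ?ltr0n ?fact_gt0//.
  by have := expR_ge1Dxn n y0; rewrite mulrC; lra.
elim/poly_ind: P => [|P c _].
  by exists 0 => // y _; rewrite horner0 normr0 mul0r.
have [C C0 HC] : exists2 C, 0 <= C & forall y : R, 0 <= y ->
    `|(P * 'X + c%:P).[y]| <= C * expR y.
  set Q := P * 'X + c%:P.
  have /choice [D hD] : forall i : nat, exists D : R, 0 <= D /\
      forall y : R, 0 <= y -> y ^+ i <= D * expR y.
    by move=> i; have [D D0 hD] := pow i; exists D.
  exists (\sum_(i < size Q) `|Q`_i| * D i).
    by apply: sumr_ge0 => i _; apply: mulr_ge0 => //; have [] := hD i.
  move=> y y0; rewrite horner_coef mulr_suml (le_trans (ler_norm_sum _ _ _))//.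
  apply: ler_sum => i _; rewrite normrM normrX (ger0_norm y0) -mulrA.
  by apply: ler_wpM2l => //; have [_] := hD i; exact.
by exists C.
Qed.

(** The exponential bound is applied to [P * 'X^2] at 1/x, and the factor ['X^2] becomes x^2 on the
    other side. A quadratic bound makes the difference quotients at 0 tend to 0. *)
Lemma exp_inv_quadratic P : exists2 C, 0 <= C & forall x, `|exp_inv P x| <= C * x ^+ 2.
Proof.
have [C C0 hC] := poly_le_expR (P * 'X^2); exists C => // x.
rewrite /exp_inv; case: ifPn => x0; last by rewrite normr0 mulr_ge0// sqr_ge0.
have := hC x^-1; rewrite invr_ge0 (ltW x0) => /(_ erefl).
rewrite hornerM hornerXn [X in X <= _]normrM normrX normrM (ger0_norm (expR_ge0 _)) expRN => h.
rewrite ler_pdivrMr ?expR_gt0// mulrAC -ler_pdivrMr ?exprn_gt0//.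
by rewrite -exprVn; move: h; rewrite (@gtr0_norm _ x^-1) ?invr_gt0.
Qed.

Lemma is_derive_exp_inv P x :
  is_derive x 1 (exp_inv P) (exp_inv (exp_inv_deriv P) x).
Proof.
have [x0|x0|->] := ltgtP x 0.
- rewrite {2}/exp_inv (lt_gtF x0).
  have h : is_derive x (1 : R) (fun=> 0 : R) 0 by exact: is_derive_cst.
  apply: near_eq_is_derive h; near=> y.
  rewrite /exp_inv ifF//; apply/negbTE; rewrite -leNgt ltW//.
  by near: y; exact: lt_nbhsl.
- have xn0 : x != 0 by rewrite gt_eqF.
  have dV : is_derive x (1 : R) (fun y : R => y^-1) (- x ^- 2).
    have := is_deriveV xn0 (is_derive_id x (1 : R)).
    by move=> /is_derive_eq; apply; exact: mulr1.
  have d1 : is_derive x (1 : R) (fun y : R => P.[y^-1]) (P^`().[x^-1] * (- x ^- 2)).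
    exact: (@is_derive1_comp R (horner P) (fun y => y^-1) x _ _ _ dV).
  have d2 : is_derive x (1 : R) (fun y : R => expR (- y^-1)) (expR (- x^-1) * (x ^- 2)).
    apply: (@is_derive1_comp R expR (fun y => - y^-1) x).
    by apply: is_derive_eq; rewrite opprK.
  have h : is_derive x (1 : R) (fun y : R => P.[y^-1] * expR (- y^-1))
      (exp_inv (exp_inv_deriv P) x).
    have := is_deriveM d1 d2; move=> /is_derive_eq; apply.
    rewrite /exp_inv x0 /exp_inv_deriv hornerM hornerXn hornerD hornerN /GRing.scale /=.
    by rewrite exprVn; ring.
  apply: near_eq_is_derive h; near=> y.
  have y0 : 0 < y by near: y; exact: lt_nbhsr.
  by rewrite /exp_inv y0.
- rewrite {2}/exp_inv ltxx.
  have [C C0 hC] := exp_inv_quadratic P.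
  have cvg0 : (fun h : R => h^-1 *: ((exp_inv P \o shift 0) (h *: 1) - exp_inv P 0))
      @ 0^' --> (0 : R).
    have C1 : 0 < C + 1 by rewrite ltr_wpDl.
    apply/cvgr0Pnorm_le => e e0.
    near=> h.
    have hn0 : h != 0 by near: h; exact: nbhs_dnbhs_neq.
    rewrite {2}/exp_inv ltxx subr0 /= addr0 /GRing.scale /= mulr1 normrM normfV.
    rewrite mulrC ler_pdivrMr ?normr_gt0// (le_trans (hC h))//.
    rewrite -real_normK ?num_real// expr2 mulrA ler_wpM2r//.
    rewrite (@le_trans _ _ ((C + 1) * `|h|))//; first by rewrite ler_wpM2r//; lra.
    rewrite mulrC -ler_pdivlMr//; near: h.
    by apply: dnbhs0_le; rewrite divr_gt0.
  by apply: DeriveDef; [apply/cvg_ex; exists 0|exact/cvg_lim].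
Unshelve. all: by end_near. Qed.

Lemma smooth_exp_inv P : smooth_line (exp_inv P).
Proof.
move=> n; elim: n P => // n IH P; split.
  by move=> x; exact: (ex_derive (is_derive := is_derive_exp_inv P x)).
rewrite (_ : (fun x => 'D_1 _ x) = exp_inv (exp_inv_deriv P)); first exact: IH.
by apply/funext => x; rewrite (derive_val (is_derive := is_derive_exp_inv P x)).
Qed.

(* exp(-1/(n(x-c))) exp(-1/(n(d-x))) on ]c, d[, increasing in n to the
   indicator of that interval. *)
Definition bump c d (n : nat) x : R :=
  exp_inv 1 (n.+1%:R * x - n.+1%:R * c) * exp_inv 1 (n.+1%:R * d - n.+1%:R * x).

Lemma smooth_bump c d n : smooth_line (bump c d n).
Proof.
move=> k; apply: derivable_nM; first exact/derivable_n_affine/smooth_exp_inv.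
rewrite (_ : (fun x => _) = (fun x => exp_inv 1 (- n.+1%:R * x + n.+1%:R * d))).
  exact/derivable_n_affine/smooth_exp_inv.
by apply/funext => x; rewrite mulNr addrC.
Qed.

Lemma exp_inv1_bound x : 0 <= exp_inv 1 x <= 1.
Proof.
rewrite /exp_inv; case: ifPn => x0; last by rewrite lexx ler01.
by rewrite hornerC mul1r expR_ge0 -expR0 ler_expR oppr_le0 invr_ge0 ltW.
Qed.

Lemma bump_bound c d n x : 0 <= bump c d n x <= 1.
Proof.
rewrite /bump; set u := exp_inv _ _; set v := exp_inv _ _.
have /andP[u0 u1] : 0 <= u <= 1 by exact: exp_inv1_bound.
have /andP[v0 v1] : 0 <= v <= 1 by exact: exp_inv1_bound.
by rewrite mulr_ge0// mulr_ile1.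
Qed.

Lemma bump_out c d n x : ~~ (c < x < d) -> bump c d n x = 0.
Proof.
rewrite negb_and -!leNgt /bump /exp_inv => /orP[h|h].
  rewrite ifF ?mul0r//; apply/negbTE.
  by rewrite -leNgt subr_le0 ler_wpM2l.
rewrite [X in _ * X]ifF ?mulr0//; apply/negbTE.
by rewrite -leNgt subr_le0 ler_wpM2l.
Qed.

Lemma bump_cvg c d x : c < x < d -> bump c d n x @[n --> \oo] --> (1 : R).
Proof.
move=> /andP[cx xd].
have aux (t : R) : 0 < t -> expR (- (n.+1%:R * t)^-1) @[n --> \oo] --> (1 : R).
  move=> t0; rewrite -[X in _ --> X]expR0; apply: continuous_cvg; first exact: continuous_expR.
  rewrite -[X in _ --> X]oppr0; apply: cvgN.
  rewrite (_ : (fun n : nat => _) = (fun n : nat => t^-1 * n.+1%:R^-1)); last first.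
    by apply/funext => n; rewrite invfM mulrC.
  rewrite -[X in _ --> X](mulr0 t^-1); apply: cvgMr; exact: cvg_harmonic.
rewrite -[X in _ --> X](mulr1 1).
have E : (fun n => bump c d n x) =
    (fun n => expR (- (n.+1%:R * (x - c))^-1) * expR (- (n.+1%:R * (d - x))^-1)).
  apply/funext => n; rewrite /bump /exp_inv -!mulrBr.
  by rewrite !pmulr_rgt0 ?ltr0n// !subr_gt0 cx xd !hornerC !mul1r.
by rewrite E; apply: cvgM; apply: aux; rewrite subr_gt0.
Qed.

End smooth_line.

(** * Borel sets of the plane and open rectangles *)

Section plane_measurability.
Context {R : realType}.

Definition open_rectangle (c d c' d' : R) : set (plane R) :=
  `]c, d[ `*` `]c', d'[.

Definition closed_rectangle (c d c' d' : R) : set (plane R) :=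
  `[c, d] `*` `[c', d'].

Lemma open_rectangle_measurable c d c' d' : measurable (open_rectangle c d c' d').
Proof. by apply: measurableX; exact: measurable_itv. Qed.

(** Squares with rational centre and half-side. The closed squares must lie in [Omega] too, since
    they are to contain the supports of the bump functions. *)
Lemma open_plane_bigcup (Omega : set (R * R)) : open Omega ->
  exists Q : nat -> set (plane R),
    (forall k, exists c d c' d', Q k = open_rectangle c d c' d' /\
       closed_rectangle c d c' d' `<=` Omega) /\
    Omega = \bigcup_k Q k.
Proof.
move=> oO.
pose op (q : R * R * (R * R)) := open_rectangle q.1.1 q.1.2 q.2.1 q.2.2.
pose cl (q : R * R * (R * R)) := closed_rectangle q.1.1 q.1.2 q.2.1 q.2.2.
have [Q0 hQ0] : exists Q : rat * rat * rat -> R * R * (R * R),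
    (forall k, cl (Q k) `<=` Omega) /\ Omega = \bigcup_k op (Q k).
  pose Q0 (q : rat * rat * rat) : R * R * (R * R) :=
    ((ratr q.1.1 - ratr q.2, ratr q.1.1 + ratr q.2),
     (ratr q.1.2 - ratr q.2, ratr q.1.2 + ratr q.2)).
  (* Triples whose closed square leaves [Omega] are sent to the bounds 1, 0 in both directions, for
     which the open and the closed rectangle are empty. *)
  exists (fun q => if `[< cl (Q0 q) `<=` Omega >] then Q0 q else (1, 0, (1, 0))).
  split.
    move=> q; case: ifPn => [/asboolP//|_] z [/=].
    by rewrite in_itv /= => /andP[h1 h2]; have := le_trans h1 h2; rewrite ler10.
  apply/seteqP; split=> [z Oz|z [q _]]; last first.
    case: ifPn => [/asboolP h /= [/= h1 h2]|_ [/=]]; last first.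
      by rewrite in_itv /= => /andP[h1 h2]; have := lt_trans h1 h2; rewrite ltr10.
    apply: h; split => /=; exact: subset_itv_oo_cc.
  have : nbhs (z : R * R) Omega by exact: open_nbhs_nbhs.
  move=> /nbhs_ballP[e /= e0 zA].
  have /rat_in_itvoo[r] : 0 < e / 2 by rewrite divr_gt0.
  rewrite in_itv /= => /andP[r0 re].
  have near_rat (t : R) : exists q : rat, `|t - ratr q| < (ratr r : R).
    have /rat_in_itvoo[q] : t - ratr r < t by rewrite ltrBlDr ltrDl.
    rewrite in_itv /= => /andP[h1 h2]; exists q.
    by rewrite ltr_norml; apply/andP; split; lra.
  have [q1 hq1] := near_rat z.1; have [q2 hq2] := near_rat z.2.
  move: hq1 hq2; rewrite !ltr_norml => /andP[h1 h1'] /andP[h2 h2'].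
  exists (q1, q2, r) => //; rewrite ifT; last first.
    apply/asboolP => y [] /=; rewrite !in_itv /= => /andP[h3 h3'] /andP[h4 h4'].
    by apply: zA; split => /=; rewrite /ball /= ltr_norml; apply/andP; split; lra.
  by split => /=; rewrite in_itv /=; apply/andP; split; lra.
have [f hf] : exists f : nat -> rat * rat * rat, forall q, exists n, f n = q.
  exists (fun n => odflt (0, 0, 0) (unpickle n)) => q.
  by exists (pickle q); rewrite pickleK.
exists (op \o Q0 \o f); split.
  move=> k; exists (Q0 (f k)).1.1, (Q0 (f k)).1.2, (Q0 (f k)).2.1, (Q0 (f k)).2.2.
  by split => //; exact: hQ0.1.
rewrite hQ0.2; apply/seteqP; split=> [z [q _]|z [k _] h]; last by exists (f k).
by have [n <-] := hf q; exists n.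
Qed.

Lemma open_plane_measurable (A : set (R * R)) : open A ->
  measurable (A : set (plane R)).
Proof.
move=> /open_plane_bigcup[Q [QO ->]]; apply: bigcupT_measurable => k.
by have [c [d [c' [d' [-> _]]]]] := QO k; exact: open_rectangle_measurable.
Qed.

Lemma continuous_plane_measurable (phi : R * R -> R) : continuous phi ->
  measurable_fun setT (phi : plane R -> R).
Proof.
move=> cphi; apply: (measurability _ (measurable_realfun.RGenOpens.measurableE R)) => //.
move=> _ [_ [a [b ->]] <-]; rewrite setTI; apply: open_plane_measurable.
exact: (open_comp (fun x _ => cphi x)).
Qed.

Definition open_rectangles : set (set (plane R)) :=
  [set A | exists c d c' d', A = open_rectangle c d c' d'].

Lemma open_rectangleI c d c' d' e h e' h' :
  open_rectangle c d c' d' `&` open_rectangle e h e' h' =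
  open_rectangle (Num.max c e) (Num.min d h) (Num.max c' e') (Num.min d' h').
Proof.
apply/seteqP; split=> [z [[/=]]|z [/=]]; rewrite /open_rectangle /= !in_itv /=.
  move=> /andP[h1 h2] /andP[h3 h4] [/andP[h5 h6] /andP[h7 h8]].
  by rewrite !gt_max !lt_min h1 h2 h3 h4 h5 h6 h7 h8.
rewrite !gt_max !lt_min => /andP[/andP[h1 h2] /andP[h3 h4]].
move=> /andP[/andP[h5 h6] /andP[h7 h8]].
by split; split; apply/andP; split.
Qed.

Lemma open_rectangles_setI_closed : setI_closed open_rectangles.
Proof.
move=> _ _ [c [d [c' [d' ->]]]] [e [h [e' [h' ->]]]].
by rewrite open_rectangleI; do 4 eexists.
Qed.

Lemma open_rectangles_cover :
  \bigcup_k open_rectangle (- k%:R) k%:R (- k%:R) k%:R = setT.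
Proof.
apply/seteqP; split => // z _.
pose M := Num.max `|z.1| `|z.2|.
exists (Num.truncn M).+1 => //.
have : M < (Num.truncn M).+1%:R by exact: truncnS_gt.
rewrite /M gt_max => /andP[h1 h2].
by split; rewrite /= in_itv /= -ltr_norml.
Qed.

(** A strip is a countable union of open rectangles, so both projections are measurable for the
    generated sigma-algebra. As the rectangles form a pi-system, finite measures can be compared on
    them. *)
Lemma plane_measurableE :
  (@measurable _ (plane R)) = <<s open_rectangles >>.
Proof.
apply/seteqP; split; last first.
  apply: smallest_sub; first exact: sigma_algebra_measurable.
  by move=> _ [c [d [c' [d' ->]]]]; exact: open_rectangle_measurable.
rewrite measurable_prod_measurableType.
apply: smallest_sub; first exact: smallest_sigma_algebra.
move=> _ [A mA [B mB <-]].
pose T := g_sigma_algebraType open_rectangles.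
have m1 : @measurable_fun _ _ T (measurableTypeR R) setT fst.
  apply: (measurability _ (measurable_realfun.RGenOpens.measurableE R)) => //.
  move=> _ [_ [a [b ->]] <-]; rewrite setTI.
  rewrite (_ : _ @^-1` _ = \bigcup_k open_rectangle a b (- k%:R) k%:R).
    apply: (@bigcupT_measurable _ T) => k; apply: sub_sigma_algebra.
    by exists a, b, (- k%:R), k%:R.
  apply/seteqP; split=> [z /= zab|z [k _ []//]].
  exists (Num.truncn `|z.2|).+1 => //; split => //=.
  by rewrite in_itv /= -ltr_norml truncnS_gt.
have m2 : @measurable_fun _ _ T (measurableTypeR R) setT snd.
  apply: (measurability _ (measurable_realfun.RGenOpens.measurableE R)) => //.
  move=> _ [_ [a [b ->]] <-]; rewrite setTI.
  rewrite (_ : _ @^-1` _ = \bigcup_k open_rectangle (- k%:R) k%:R a b).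
    apply: (@bigcupT_measurable _ T) => k; apply: sub_sigma_algebra.
    by exists (- k%:R), k%:R, a, b.
  apply/seteqP; split=> [z /= zab|z [k _ []//]].
  exists (Num.truncn `|z.1|).+1 => //; split => //=.
  by rewrite in_itv /= -ltr_norml truncnS_gt.
have := @measurableI _ T _ _ (m1 measurableT _ mA) (m2 measurableT _ mB).
by rewrite !setTI.
Qed.

End plane_measurability.

(** * Test functions and tensor products of bumps *)

Section test_functions.
Context {R : realType}.
Implicit Types (Omega : set (R * R)) (phi psi : R * R -> R).

Lemma compact_support_bounded psi (K : set (R * R)) : continuous psi -> compact K ->
  (forall x, psi x != 0 -> K x) -> exists C : R, forall x, `|psi x| <= C.
Proof.
move=> cpsi cK psiK.
have : compact (psi @` K).
  by apply: continuous_compact => //; exact: continuous_subspaceT.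
move=> /compact_bounded[M [_ HM]].
exists (Num.max 0 (M + 1)) => x; rewrite le_max.
have [->|/psiK Kx] := eqVneq (psi x) 0; first by rewrite normr0 lexx.
by apply/orP; right; apply: HM; [rewrite ltrDl|exists x].
Qed.

Lemma test_function_smooth Omega phi s : test_function Omega phi ->
  continuous (foldr partial phi s).
Proof. by move=> [sphi _ _] x; exact: differentiable_continuous. Qed.

Lemma test_function_bounded Omega phi : test_function Omega phi ->
  exists C : R, forall x, `|phi x| <= C.
Proof.
move=> tphi; have [_ cK _] := tphi; apply: (compact_support_bounded _ cK).
  exact: (@test_function_smooth Omega phi [::] tphi).
by move=> x phix; apply: subset_closure.
Qed.

(** Off its closed support [phi] vanishes on a neighbourhood, so its derivative inherits the compact
    support. *)
Lemma test_function_partial_bounded Omega phi i : test_function Omega phi ->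
  exists C : R, forall x, `|partial i phi x| <= C.
Proof.
move=> tphi; have [_ cK _] := tphi; apply: (compact_support_bounded _ cK).
  exact: (@test_function_smooth Omega phi [:: i] tphi).
move=> x dx; apply: contrapT; set K := closure _ => Kx; move/eqP: dx; apply.
have oK : open (~` K) by apply: closed_openC; exact: closed_closure.
have nK : nbhs x (~` K) by apply: open_nbhs_nbhs.
rewrite /partial (@near_eq_derive _ _ _ phi (cst 0)) ?derive_cst//.
near=> y; apply: contrapT => /eqP phiy.
have : (~` K) y by near: y.
by apply; apply: subset_closure.
Unshelve. all: by end_near. Qed.

Lemma test_function_measurable Omega phi : test_function Omega phi ->
  measurable_fun setT (phi : plane R -> R).
Proof.
by move=> tphi; apply: continuous_plane_measurable;
  exact: (@test_function_smooth Omega phi [::] tphi).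
Qed.

Lemma test_function_partial_measurable Omega phi i : test_function Omega phi ->
  measurable_fun setT (partial i phi : plane R -> R).
Proof.
by move=> tphi; apply: continuous_plane_measurable;
  exact: (@test_function_smooth Omega phi [:: i] tphi).
Qed.

Definition tensor (a b : R -> R) : R * R -> R := fun p => a p.1 * b p.2.

Lemma partial_tensor (i : 'I_2) (a b : R -> R) :
  (forall x, derivable a x 1) -> (forall x, derivable b x 1) ->
  partial i (tensor a b) =
  if i == 0 then tensor (fun x => 'D_1 a x) b else tensor a (fun x => 'D_1 b x).
Proof.
move=> da db; apply/funext => p; rewrite /partial.
have [->|] := eqVneq i 0.
  rewrite /tensor /= mulrC -(@deriveMl _ _ a (b p.2) p.1 1)//.
  rewrite /derive; apply: congr1; apply: (congr1 (fun F => F @ 0^')).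
  apply/funext => h /=.
  rewrite /basis_vec /= /GRing.scale /= !mulr1 mulr0 add0r.
  by rewrite !(mulrC (a _)).
move=> i0; have -> : i = 1 by apply/val_inj; move: i i0 => [[|[|//]]].
rewrite /tensor /= -(@deriveMl _ _ b (a p.1) p.2 1)//.
rewrite /derive; apply: congr1; apply: (congr1 (fun F => F @ 0^')).
  apply/funext => h /=.
  by rewrite /basis_vec /= /GRing.scale /= !mulr1 mulr0 add0r.
Qed.

Lemma differentiable_tensor (a b : R -> R) (p : R * R) : derivable a p.1 1 -> derivable b p.2 1 ->
  differentiable (tensor a b) p.
Proof.
move=> /derivable1_diffP da /derivable1_diffP db.
apply: (@differentiableM _ _ (a \o fst) (b \o snd)).
  apply: differentiable_comp => //; apply: linear_differentiable.
  by move=> x; exact: cvg_fst.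
apply: differentiable_comp => //; apply: linear_differentiable.
by move=> x; exact: cvg_snd.
Qed.

(** Iterated partial derivatives of a tensor product are again tensor products of smooth functions
    of one variable, so only differentiability of a tensor product is left to check. *)
Lemma smooth_tensor a b : smooth_line a -> smooth_line b -> smooth (tensor a b).
Proof.
move=> sa sb.
suff H s : exists a' b', [/\ smooth_line a', smooth_line b' &
    foldr partial (tensor a b) s = tensor a' b'].
  move=> s x; have [a' [b' [sa' sb' ->]]] := H s.
  by apply: differentiable_tensor; [case: (sa' 1)|case: (sb' 1)].
elim: s => [|i s [a' [b' [sa' sb' /= ->]]]]; first by exists a, b.
rewrite partial_tensor; [|by case: (sa' 1)|by case: (sb' 1)].
case: ifPn => _.
  by exists (fun x => 'D_1 a' x), b'; split => // n; case: (sa' n.+1).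
by exists a', (fun x => 'D_1 b' x); split => // n; case: (sb' n.+1).
Qed.

Lemma test_function_bump Omega c d c' d' n :
  closed_rectangle c d c' d' `<=` Omega ->
  test_function Omega (tensor (bump c d n) (bump c' d' n)).
Proof.
move=> QO.
have cQ : compact (closed_rectangle c d c' d' : set (R * R)).
  by apply: compact_setX; exact: segment_compact.
have clQ := compact_closed (@norm_hausdorff _ _) cQ.
have sub : closure [set x | tensor (bump c d n) (bump c' d' n) x != 0] `<=`
    (closed_rectangle c d c' d' : set (R * R)).
  rewrite [X in _ `<=` X]((closure_id _).1 clQ); apply: closureS => x /= x0.
  split => /=; apply: contrapT => /negP; rewrite in_itv /= => h;
    move/eqP: x0; apply; rewrite /tensor.
    rewrite bump_out ?mul0r//; apply: contra h => /andP[h1 h2].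
    by rewrite !ltW.
  rewrite [X in _ * X]bump_out ?mulr0//; apply: contra h => /andP[h1 h2].
  by rewrite !ltW.
split.
- by apply: smooth_tensor; exact: smooth_bump.
- apply: (subclosed_compact _ cQ) => //; exact: closed_closure.
- exact: subset_trans QO.
Qed.

End test_functions.

Section integrable_functions.
Context d (T : measurableType d) {R : realType} (mu : {measure set T -> \bar R}).
Implicit Types (D : set T) (phi sigma : T -> R).

Lemma integrable_bounded_mul D phi sigma C : measurable D ->
  measurable_fun D phi -> (forall x, D x -> `|phi x| <= C) ->
  mu.-integrable D (EFin \o sigma) ->
  mu.-integrable D (EFin \o (fun x => phi x * sigma x)).
Proof.
move=> mD mphi phiC isigma.
have msigma : measurable_fun D sigma by exact/measurable_EFinP/(measurable_int mu).
apply: (le_integrable mD _ _ (integrableZl mD C isigma)).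
  by apply/measurable_EFinP; exact: measurable_funM.
move=> x Dx /=; rewrite lee_fin !normrM ler_wpM2r// (le_trans (phiC _ Dx))//.
exact: ler_norm.
Qed.

Lemma Rintegral_EFin D phi : mu.-integrable D (EFin \o phi) -> measurable D ->
  (\int[mu]_(x in D) (phi x)%:E)%E = (\int[mu]_(x in D) phi x)%:E.
Proof. by move=> iphi mD; rewrite /Rintegral fineK// integrable_fin_num. Qed.

Lemma integral_indicM D A (f : T -> \bar R) : A `<=` D ->
  (\int[mu]_(x in D) ((\1_A x)%:E * f x) = \int[mu]_(x in A) f x)%E.
Proof.
move=> AD; rewrite integral_mkcond [RHS]integral_mkcond.
apply: eq_integral => x _; rewrite !patchE indicE.
have [xA|xA] := boolP (x \in A); last by case: ifPn => // _; rewrite mul0e.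
by rewrite ifT ?mul1e//; apply/mem_set/AD; exact: set_mem.
Qed.

Lemma integrable_fun_measurable D phi : mu.-integrable D (EFin \o phi) ->
  measurable_fun D phi.
Proof. by move=> iphi; apply/measurable_EFinP; exact: measurable_int iphi. Qed.

End integrable_functions.

(** * The fundamental lemma of the calculus of variations *)

Section fundamental_lemma.
Context {R : realType} (m : {measure set (plane R) -> \bar R}).
Variables (Omega : set (R * R)) (sigma : plane R -> R).
Hypotheses (oO : open Omega)
  (isigma : m.-integrable (Omega : set (plane R)) (EFin \o sigma)).
Hypothesis test0 : forall phi, test_function Omega phi ->
  \int[m]_(x in (Omega : set (plane R))) (phi x * sigma x) = 0.

Let mO : measurable (Omega : set (plane R)).
Proof. exact: open_plane_measurable. Qed.

(** The bumps tend to the indicator of the rectangle and stay below 1, so dominated convergence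
    applies with bound [|sigma|]. *)
Lemma test_integral_rectangle c d c' d' : closed_rectangle c d c' d' `<=` Omega ->
  (\int[m]_(x in open_rectangle c d c' d') (sigma x)%:E = 0)%E.
Proof.
move=> QO; set Q := open_rectangle c d c' d'.
have QO' : Q `<=` Omega.
  by apply: subset_trans QO => z [/= h1 h2]; split => /=; exact: subset_itv_oo_cc.
pose phi n : plane R -> R := tensor (bump c d n) (bump c' d' n).
have tphi n : test_function Omega (phi n) by exact: test_function_bump.
have phi1 n x : `|phi n x| <= 1.
  have /andP[h1 h2] := bump_bound c d n x.1.
  have /andP[h3 h4] := bump_bound c' d' n x.2.
  rewrite /phi /tensor ger0_norm; last exact: mulr_ge0.
  exact: mulr_ile1.
have iphi n : m.-integrable (Omega : set (plane R)) (EFin \o (fun x => phi n x * sigma x)).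
  apply: (@integrable_bounded_mul _ _ _ _ _ _ _ 1) => //.
  by apply: measurable_funTS; exact: test_function_measurable (tphi n).
have mlim : measurable_fun (Omega : set (plane R))
    (fun x => (\1_Q x)%:E * (sigma x)%:E)%E.
  apply: emeasurable_funM; last exact: measurable_int isigma.
  apply/measurable_EFinP; apply: measurable_funTS.
  by apply: measurable_indic; exact: open_rectangle_measurable.
have cvgphi : \forall x \ae m, (Omega : set (plane R)) x ->
    (phi n x * sigma x)%:E @[n --> \oo] --> ((\1_Q x)%:E * (sigma x)%:E)%E.
  apply: aeW => x Ox; rewrite -EFinM; apply: cvg_EFin; first exact: nearW.
  apply: cvgMl; rewrite indicE; have [xQ|xQ] := boolP (x \in Q).
    move: xQ => /set_mem[/=]; rewrite !in_itv /= => h1 h2.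
    rewrite -[X in _ --> X](mulr1 1); apply: cvgM; exact: bump_cvg.
  apply: cvg_near_cst; apply: nearW => n /=.
  move: xQ; rewrite notin_setE => /not_andP[]/negP; rewrite in_itv /= => h.
    by rewrite /phi /tensor bump_out ?mul0r.
  by rewrite /phi /tensor [X in _ * X]bump_out ?mulr0.
have dom : \forall x \ae m, forall n, (Omega : set (plane R)) x ->
    (`|(phi n x * sigma x)%:E| <= `|sigma x|%:E)%E.
  by apply: aeW => x n Ox; rewrite /= lee_fin normrM ler_piMl.
have [_ _] := dominated_convergence mO (fun n => measurable_int m (iphi n)) mlim
  cvgphi (integrable_norm isigma) dom.
rewrite (_ : (fun n => _) = (fun=> 0%E)); last first.
  apply/funext => n; have := Rintegral_EFin (iphi n) mO.
  by rewrite test0.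
rewrite integral_indicM// => /cvg_lim <- //.
by rewrite lim_cst.
Qed.

(** The positive and negative parts of [sigma] define two finite measures that agree on open
    rectangles, hence on all Borel sets. *)
Lemma test_integral_measurable c d c' d' : closed_rectangle c d c' d' `<=` Omega ->
  forall A, measurable A -> A `<=` open_rectangle c d c' d' ->
  (\int[m]_(x in A) (sigma x)%:E = 0)%E.
Proof.
move=> QO; set Q := open_rectangle c d c' d' => A mA AQ.
have QcQ : Q `<=` closed_rectangle c d c' d'.
  by move=> z [/= h1 h2]; split => /=; exact: subset_itv_oo_cc.
have mQ : measurable Q by exact: open_rectangle_measurable.
(* Cutting [sigma] off outside [Q] lets every rectangle of the plane be tested: its trace on [Q] is
   an open rectangle whose closed counterpart stays in [Omega]. *)
pose tau := (EFin \o sigma) \_ Q.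
have itau : m.-integrable setT tau.
  apply/(integrable_mkcond _ mQ); apply: integrableS isigma => //.
  exact: subset_trans QO.
have ip := integrable_funepos measurableT itau.
have iN := integrable_funeneg measurableT itau.
have pos1 E : (0 <= induced_charge ip E)%E by apply: integral_ge0 => x _; exact: funepos_ge0.
have pos2 E : (0 <= induced_charge iN E)%E by apply: integral_ge0 => x _; exact: funeneg_ge0.
pose m1 := measure_of_charge (induced_charge ip) pos1.
pose m2 := measure_of_charge (induced_charge iN) pos2.
have fin1 E : measurable E -> m1 E \is a fin_num by exact: (fin_num_measure (induced_charge ip)).
have fin2 E : measurable E -> m2 E \is a fin_num by exact: (fin_num_measure (induced_charge iN)).
have tauE E : (\int[m]_(x in E) tau x = m1 E - m2 E)%E by rewrite integralE.
have tauI E : (\int[m]_(x in E) tau x = \int[m]_(x in E `&` Q) (sigma x)%:E)%E.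
  by rewrite integral_mkcondr.
have agree E : open_rectangles E -> m1 E = m2 E.
  move=> [e [h [e' [h' EE]]]].
  have mE : measurable E by rewrite EE; exact: open_rectangle_measurable.
  have : (m1 E - m2 E = 0)%E.
    rewrite -tauE tauI EE open_rectangleI test_integral_rectangle//.
    apply: subset_trans QO => z [/=]; rewrite !in_itv /= !ge_max !le_min.
    move=> /andP[/andP[_ ?] /andP[_ ?]] /andP[/andP[_ ?] /andP[_ ?]].
    by split; rewrite /= in_itv /=; apply/andP.
  move=> /eqP; rewrite sube_eq ?add0e ?fin1 ?fin2//.
  by move=> /eqP.
have mm : m1 A = m2 A.
  apply: (@measure_unique _ R _ open_rectangles
    (fun k => open_rectangle (- k%:R) k%:R (- k%:R) k%:R)) => //.
  - exact: plane_measurableE.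
  - exact: open_rectangles_setI_closed.
  - by move=> k; exists (- k%:R), k%:R, (- k%:R), k%:R.
  - exact: open_rectangles_cover.
  - by move=> k; rewrite ltey_eq fin1//; exact: open_rectangle_measurable.
rewrite -(setIidl AQ) -tauI tauE mm subee// fin2//.
Qed.

(** The measure [m] is arbitrary because two cases are wanted: Lebesgue measure for uniqueness of
    weak gradients, and a measure dominating a charge for uniqueness of distributional ones. *)
Theorem test_integral_ae0 : ae_eq m (Omega : set (plane R)) sigma (fun=> 0).
Proof.
have [Q [QO OQ]] := open_plane_bigcup oO.
suff H k : ae_eq m (Q k) (EFin \o sigma) (cst 0%E).
  apply: filterS (ae_foralln H) => x hx; rewrite [X in X x]OQ => -[k _ Qkx].
  by have /= [] := hx k Qkx.
have [c [d [c' [d' [-> cQO]]]]] := QO k.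
have QO' : open_rectangle c d c' d' `<=` Omega.
  by apply: subset_trans cQO => z [/= h1 h2]; split => /=; exact: subset_itv_oo_cc.
have mQ := open_rectangle_measurable c d c' d'.
apply: integral_ae_eq => //; first exact: integrableS isigma.
move=> E EQ mE; rewrite integral0; exact: test_integral_measurable cQO _ mE EQ.
Qed.

End fundamental_lemma.

(** * Densities of charges *)

Section charge_densities.
Context d (T : measurableType d) {R : realType}.
Implicit Types (m : {measure set T -> \bar R}) (nu : {charge set T -> \bar R}).

Definition has_density (nu : set T -> \bar R) m (sigma : T -> R) : Prop :=
  m.-integrable setT (EFin \o sigma) /\
  forall A, measurable A -> nu A = (\int[m]_(x in A) (sigma x)%:E)%E.

(** The sum of the variations dominates. Densities against one measure turn identities between
    charges into pointwise identities between functions. *)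
Lemma charges_dominated (I : finType) (nu : I -> {charge set T -> \bar R}) :
  exists m : {finite_measure set T -> \bar R}, forall i, nu i `<< m.
Proof.
suff [m hm] : exists m : {finite_measure set T -> \bar R},
    forall i, i \in enum I -> nu i `<< m.
  by exists m => i; apply: hm; rewrite mem_enum.
elim: (enum I) => [|i s [m hm]].
  have zfin : (@mzero _ T R setT < +oo)%E by rewrite /mzero.
  by exists (mfrestr measurableT zfin).
have [P [N nuPN]] := Hahn_decomposition (nu i).
pose m1 := measure_add m (charge_variation nuPN).
have m1E A : m1 A = (m A + charge_variation nuPN A)%E by exact: measure_addE.
have fin1 : (m1 setT < +oo)%E.
  rewrite m1E lte_add_pinfty//; rewrite ltey_eq.
    by rewrite fin_num_measure.
  by rewrite (fin_num_measure (charge_variation nuPN)).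
exists (mfrestr measurableT fin1) => j; rewrite inE => ij.
apply/null_content_dominatesP => A mA.
move=> mA0; have : m1 A = 0%E by rewrite -mA0 -{1}(setIT A).
rewrite m1E => /eqP.
rewrite padde_eq0 ?measure_ge0// => /andP[/eqP mA00 /eqP vA0].
have [E|ji] := eqVneq j i; last first.
  move: ij; rewrite (negbTE ji) /= => /hm /null_content_dominatesP; exact.
subst j; apply/eqP; rewrite -abse_eq0 eq_le abse_ge0 andbT.
by rewrite -vA0; exact: abse_charge_variation.
Qed.

Lemma density_exists nu (m : {finite_measure set T -> \bar R}) : nu `<< m ->
  exists sigma, has_density nu m sigma.
Proof.
move=> num; exists (fine \o Radon_Nikodym nu m).
have E : EFin \o (fine \o Radon_Nikodym nu m) = Radon_Nikodym nu m.
  by apply/funext => x /=; rewrite fineK// Radon_Nikodym_fin_num.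
split; first by rewrite E; exact: Radon_Nikodym_integrable.
move=> A mA; rewrite (Radon_Nikodym_integral num mA).
by apply: eq_integral => x _; rewrite -[in LHS]E.
Qed.

Lemma has_densityD nu1 nu2 m sigma1 sigma2 (a : R) :
  has_density nu1 m sigma1 -> has_density nu2 m sigma2 ->
  has_density (cadd (cscale a nu1) nu2) m (fun x => a * sigma1 x + sigma2 x).
Proof.
move=> [i1 e1] [i2 e2]; split.
  rewrite (_ : _ \o _ = (fun x => a%:E * (sigma1 x)%:E) \+ (EFin \o sigma2))%E//.
  by apply: integrableD => //; exact: integrableZl.
move=> A mA; transitivity (a%:E * nu1 A + nu2 A)%E; first by [].
rewrite e1// e2//.
have j1 : m.-integrable A (EFin \o sigma1) by exact: integrableS i1.
have j2 : m.-integrable A (EFin \o sigma2) by exact: integrableS i2.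
rewrite -integralZl// -integralD//; first exact: integrableZl.
Qed.

Lemma has_density_dominates (nu : set T -> \bar R) m sigma :
  has_density nu m sigma -> forall A, measurable A -> m A = 0%E -> nu A = 0%E.
Proof.
move=> [i e] A mA mA0; rewrite e//; apply: null_set_integral => //.
  by apply/measurable_EFinP; apply: measurable_funTS; exact: integrable_fun_measurable i.
Qed.

Lemma integral_has_density (mu m : {finite_measure set T -> \bar R}) rho (f : T -> R) E :
  has_density mu m rho -> measurable E -> mu.-integrable E (EFin \o f) ->
  (\int[mu]_(x in E) (f x)%:E = \int[m]_(x in E) (f x * rho x)%:E)%E.
Proof.
move=> rhoP mE iF.
have mum : mu `<< m by apply/null_content_dominatesP; exact: has_density_dominates rhoP.
rewrite -(Radon_Nikodym_change_of_variables mum mE iF).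
have mumc : charge_of_finite_measure mu `<< m by exact: mum.
have mrho := integrable_fun_measurable rhoP.1.
have mf := integrable_fun_measurable iF.
apply: ae_eq_integral => //.
- apply: emeasurable_funM; first exact/measurable_EFinP.
  apply: measurable_funTS; exact: measurable_int (Radon_Nikodym_integrable mumc).
- apply/measurable_EFinP; apply: measurable_funM => //; exact: measurable_funTS.
suff H : ae_eq m E (Radon_Nikodym (charge_of_finite_measure mu) m) (EFin \o rho).
  by apply: filterS H => x h /h /= ->; rewrite EFinM.
apply: integral_ae_eq => //.
- apply: integrableS (Radon_Nikodym_integrable mumc) => //.
- by apply/measurable_EFinP; exact: measurable_funTS.
move=> F FE mF; rewrite -(Radon_Nikodym_integral mumc mF) -rhoP.2//.
Qed.

End charge_densities.

(** * Integration against charges *)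

Section charge_integral_theory.
Context {R : realType}.
Implicit Types (nu mu : {charge set (plane R) -> \bar R}) (phi : plane R -> R).

(** [charge_integral] depends on a chosen Hahn decomposition [P], [N]. Whichever it is, the Jordan
    parts have densities [\1_P * sigma] and [- \1_N * sigma], whose difference is [sigma]
    pointwise. *)
Lemma charge_integral_density nu (m : {finite_measure set (plane R) -> \bar R}) sigma phi C :
  has_density nu m sigma -> measurable_fun setT phi -> (forall x, `|phi x| <= C) ->
  charge_integral nu phi = \int[m]_x (phi x * sigma x).
Proof.
move=> [isigma nuE] mphi phiC; rewrite /charge_integral.
set hP := cid (Hahn_decomposition nu); set hN := svalP (cid (svalP hP)).
pose P := sval hP; pose N := sval (cid (svalP hP)).
have [[mP posP] [mN negN] PNT PN0] : hahn_decomposition nu P N := hN.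
have bphi (mu : {finite_measure set (plane R) -> \bar R}) :
    mu.-integrable setT (EFin \o phi).
  have := integrable_bounded_mul (mu := mu) (sigma := cst 1) measurableT mphi
    (fun x _ => phiC x).
  rewrite (_ : (fun x => phi x * _) = phi); last by apply/funext => x; rewrite mulr1.
  by apply; exact: finite_measure_integrable_cst.
have i1 : m.-integrable setT (EFin \o (fun x => \1_P x * sigma x)).
  apply: (@integrable_bounded_mul _ _ _ _ _ _ _ 1) => //.
  by move=> x _; rewrite indicE; case: (_ \in _); rewrite ?normr1 ?normr0.
have i2 : m.-integrable setT (EFin \o (fun x => - \1_N x * sigma x)).
  apply: (@integrable_bounded_mul _ _ _ _ _ _ _ 1) => //.
    by apply: measurableT_comp => //; exact: measurable_indic.
  by move=> x _; rewrite normrN indicE; case: (_ \in _); rewrite ?normr1 ?normr0.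
have d1 : has_density (jordan_pos hN) m (fun x => \1_P x * sigma x).
  split=> // A mA; rewrite jordan_posE cjordan_posE /crestr0 mem_set// /crestr nuE;
    last exact: measurableI.
  rewrite integral_mkcondr; apply: eq_integral => x _.
  by rewrite patchE indicE; case: ifPn => _; rewrite ?mul1r ?mul0r.
have d2 : has_density (jordan_neg hN) m (fun x => - \1_N x * sigma x).
  split=> // A mA; rewrite jordan_negE cjordan_negE /crestr0 mem_set// /crestr nuE;
    last exact: measurableI.
  have iN : m.-integrable (A `&` N) (EFin \o sigma).
    by apply: integrableS isigma => //; exact: measurableI.
  rewrite -integralN; last first.
    by apply: integrable_add_def => //; exact: measurableI.
  rewrite integral_mkcondr; apply: eq_integral => x _.
  by rewrite patchE indicE; case: ifPn => _; rewrite ?mulN1r ?oppr0 ?mul0r.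
have E1 := integral_has_density d1 measurableT (bphi (jordan_pos hN)).
have E2 := integral_has_density d2 measurableT (bphi (jordan_neg hN)).
transitivity (fine (\int[jordan_pos hN]_x (phi x)%:E) -
  fine (\int[jordan_neg hN]_x (phi x)%:E)); first by [].
rewrite E1 E2 -RintegralB//.
- apply: eq_Rintegral => x _.
  have : P x \/ N x by have : (P `|` N) x by rewrite PNT.
  have PN : P x -> N x -> False by move=> px nx; have : (P `&` N) x by []; rewrite PN0.
  rewrite !indicE; case: (boolP (x \in P)) => [/set_mem|];
    case: (boolP (x \in N)) => [/set_mem|] /=.
  + by move=> n p; case: (PN p n).
  + by rewrite mul1r oppr0 mul0r mulr0 subr0.
  + by rewrite mul0r mulr0 sub0r mulN1r mulrN opprK.
  + by rewrite !notin_setE => ? ? [].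
- exact: (integrable_bounded_mul measurableT mphi (fun x _ => phiC x) i1).
- exact: (integrable_bounded_mul measurableT mphi (fun x _ => phiC x) i2).
Qed.

(** The Jordan parts of a sum are in general not the sums of the Jordan parts, so linearity is read
    off from densities against a common dominating measure. *)
Lemma charge_integralD (a : R) nu mu phi C :
  measurable_fun setT phi -> (forall x, `|phi x| <= C) ->
  charge_integral (cadd (cscale a nu) mu) phi =
  a * charge_integral nu phi + charge_integral mu phi.
Proof.
move=> mphi phiC.
have [m hm] := charges_dominated (fun b : bool => if b then nu else mu).
have [sigma dsigma] := density_exists (hm true).
have [tau dtau] := density_exists (hm false).
rewrite (charge_integral_density (has_densityD a dsigma dtau) mphi phiC).
rewrite (charge_integral_density dsigma mphi phiC) (charge_integral_density dtau mphi phiC).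
have i1 := integrable_bounded_mul measurableT mphi (fun x _ => phiC x) dsigma.1.
have i2 := integrable_bounded_mul measurableT mphi (fun x _ => phiC x) dtau.1.
rewrite -RintegralZl// -RintegralD//; last first.
  rewrite (_ : _ \o _ = (fun x => a%:E * (phi x * sigma x)%:E)%E)//.
  exact: integrableZl.
by apply: eq_Rintegral => x _; ring.
Qed.

(** A density of [nu] is annihilated by all test functions, so it vanishes almost everywhere on
    [Omega]; as [nu] is carried by [Omega], nothing remains elsewhere. *)
Lemma test_charge0 (Omega : set (plane R)) nu : open (Omega : set (R * R)) ->
  (forall A, measurable A -> nu A = nu (A `&` Omega)) ->
  (forall phi, test_function Omega phi -> charge_integral nu phi = 0) ->
  forall A, measurable A -> nu A = 0%E.
Proof.
move=> oO nuO test0 A mA.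
have [m hm] := charges_dominated (fun _ : unit => nu).
have [sigma dsigma] := density_exists (hm tt).
have mO := open_plane_measurable oO.
have : ae_eq m Omega sigma (fun=> 0).
  apply: test_integral_ae0 => //.
    by apply: integrableS dsigma.1.
  move=> phi tphi; have [C phiC] := test_function_bounded tphi.
  rewrite -(test0 _ tphi) (charge_integral_density dsigma (test_function_measurable tphi) phiC).
  rewrite Rintegral_mkcond; apply: eq_Rintegral => x _.
  rewrite patchE; case: ifPn => //; rewrite notin_setE => Ox.
  have [->|phix] := eqVneq (phi x) 0; first by rewrite mul0r.
  by case: tphi => _ _ sub; exfalso; apply: Ox; apply: sub; apply: subset_closure.
move=> ae0; rewrite nuO// dsigma.2; last exact: measurableI.
rewrite -(integral0 m (A `&` Omega)); apply: ae_eq_integral => //.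
- exact: measurableI.
- apply/measurable_EFinP; apply: measurable_funTS; exact: integrable_fun_measurable dsigma.1.
- by apply: filterS ae0 => x h [_ /h ->].
Qed.

End charge_integral_theory.

(** * Euclidean norm and total variation *)

Section euclidean_norm.
Context {R : realType}.

Section any_size.
Variables p q : nat.
Implicit Types A B : 'M[R]_(p, q).

Lemma enorm_ge0 A : 0 <= enorm A.
Proof. exact: sqrtr_ge0. Qed.

Lemma sqr_enorm A : enorm A ^+ 2 = \sum_i \sum_j A i j ^+ 2.
Proof.
by rewrite sqr_sqrtr// sumr_ge0// => i _; rewrite sumr_ge0// => j _; exact: sqr_ge0.
Qed.

(* Cauchy-Schwarz, as the infimum over t of 2 a b <= t a^2 + b^2 / t. *)
Lemma enorm_inner A B : \sum_i \sum_j A i j * B i j <= enorm A * enorm B.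
Proof.
set S := \sum_i _; set N := enorm A; set M := enorm B.
have N0 : 0 <= N := enorm_ge0 A; have M0 : 0 <= M := enorm_ge0 B.
have young (t : R) : 0 < t -> 2 * S <= t * N ^+ 2 + t^-1 * M ^+ 2.
  move=> t0; rewrite !sqr_enorm !mulr_sumr -big_split /=; apply: ler_sum => i _.
  rewrite !mulr_sumr -big_split /=; apply: ler_sum => j _.
  set a := A i j; set b := B i j; rewrite -subr_ge0.
  rewrite (_ : _ - _ = t * (a - t^-1 * b) ^+ 2).
    by rewrite mulr_ge0 ?sqr_ge0// ltW.
  by field; rewrite gt_eqF.
suff H e : 0 < e -> 2 * S <= 2 * (N * M) + e * (N + M).
  rewrite -(@ler_pM2l _ 2)//; apply/ler_addgt0Pr => e e0.
  have k0 : 0 < N + M + 1 by rewrite ltr_wpDl// addr_ge0.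
  have := H (e / (N + M + 1)) (divr_gt0 e0 k0).
  move=> /le_trans; apply; rewrite lerD2l mulrAC ler_pdivrMr// ler_wpM2l ?ltW//; lra.
move=> e0; have Ne : 0 < N + e by rewrite ltr_wpDl.
have Me : 0 < M + e by rewrite ltr_wpDl.
have := young _ (divr_gt0 Me Ne); move=> /le_trans; apply.
have h1 : (M + e) / (N + e) * N ^+ 2 <= (M + e) * N.
  rewrite mulrAC ler_pdivrMr// expr2 -mulrA ler_wpM2l ?(ltW Me)//.
  by rewrite ler_wpM2l//; lra.
have h2 : ((M + e) / (N + e))^-1 * M ^+ 2 <= (N + e) * M.
  rewrite invf_div mulrAC ler_pdivrMr// expr2 -mulrA ler_wpM2l ?(ltW Ne)//.
  by rewrite ler_wpM2l//; lra.
lra.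
Qed.

Lemma enormZ a A : enorm (a *: A) = `|a| * enorm A.
Proof.
rewrite /enorm -sqrtr_sqr -sqrtrM ?sqr_ge0//; congr Num.sqrt.
rewrite mulr_sumr; apply: eq_bigr => i _; rewrite mulr_sumr.
by apply: eq_bigr => j _; rewrite mxE exprMn.
Qed.

Lemma enormN A : enorm (- A) = enorm A.
Proof. by rewrite -scaleN1r enormZ normrN1 mul1r. Qed.

Lemma enorm0 : enorm (0 : 'M[R]_(p, q)) = 0.
Proof. by rewrite -(scale0r (0 : 'M[R]_(p, q))) enormZ normr0 mul0r. Qed.

Lemma enormD A B : enorm (A + B) <= enorm A + enorm B.
Proof.
rewrite -(@ler_pXn2r _ 2)// ?nnegrE ?enorm_ge0 ?addr_ge0 ?enorm_ge0//.
have -> : enorm (A + B) ^+ 2 =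
    enorm A ^+ 2 + 2 * (\sum_i \sum_j A i j * B i j) + enorm B ^+ 2.
  rewrite !sqr_enorm mulr_sumr -!big_split /=; apply: eq_bigr => i _.
  rewrite mulr_sumr -!big_split /=; apply: eq_bigr => j _; rewrite mxE; ring.
have := enorm_inner A B; nra.
Qed.

Lemma enorm_entry A i j : `|A i j| <= enorm A.
Proof.
rewrite -sqrtr_sqr ler_sqrt; last first.
  by apply: sumr_ge0 => k _; apply: sumr_ge0 => l _; exact: sqr_ge0.
rewrite (bigD1 i)//= (bigD1 j)//= -addrA lerDl addr_ge0//.
  by apply: sumr_ge0 => l _; exact: sqr_ge0.
by apply: sumr_ge0 => k _; apply: sumr_ge0 => l _; exact: sqr_ge0.
Qed.

Lemma enorm_le_sum A : enorm A <= \sum_i \sum_j `|A i j|.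
Proof.
set S := \sum_i _.
have S0 : 0 <= S by apply: sumr_ge0 => k _; exact: sumr_ge0.
have entryS i j : `|A i j| <= S.
  rewrite /S (bigD1 i)//= (bigD1 j)//= -addrA lerDl addr_ge0//; first exact: sumr_ge0.
  by apply: sumr_ge0 => k _; exact: sumr_ge0.
rewrite -(@ler_pXn2r _ 2)// ?nnegrE ?enorm_ge0// sqr_enorm expr2 {2}/S mulr_sumr.
apply: ler_sum => i _; rewrite mulr_sumr; apply: ler_sum => j _.
by rewrite -real_normK ?num_real// expr2 ler_wpM2r.
Qed.

(** The countable dense set behind two constructions: the partition on which a density is nearly
    constant, and the sublevel sets of a Lipschitz function. *)
Lemma rat_matrix_dense (e : R) (B : 'M[R]_(p, q)) : 0 < e ->
  exists n, enorm (B - map_mx ratr (odflt 0 (unpickle n) : 'M[rat]_(p, q))) < e.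
Proof.
move=> e0; pose k : R := p%:R * q%:R.
have k0 : 0 <= k by rewrite mulr_ge0.
(* One such error per entry, [p * q] entries in all; the [+ 1] keeps the total strictly below [e]
   and covers an empty matrix. *)
have ek0 : 0 < e / (k + 1) by rewrite divr_gt0// ltr_wpDl.
have /choice[r hr] : forall ij : 'I_p * 'I_q, exists r : rat,
    `|B ij.1 ij.2 - ratr r| < e / (k + 1).
  move=> ij; have /rat_in_itvoo[r] : B ij.1 ij.2 - e / (k + 1) < B ij.1 ij.2.
    by rewrite ltrBlDr ltrDl.
  rewrite in_itv /= => /andP[h1 h2]; exists r.
  by rewrite ltr_norml; apply/andP; split; lra.
exists (pickle (\matrix_(i, j) r (i, j) : 'M[rat]_(p, q))); rewrite pickleK /=.
apply: le_lt_trans (enorm_le_sum _) _.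
apply: (@le_lt_trans _ _ (\sum_(i < p) \sum_(j < q) e / (k + 1))).
  apply: ler_sum => i _; apply: ler_sum => j _; rewrite !mxE.
  exact: ltW (hr (i, j)).
under eq_bigr do rewrite sumr_const card_ord.
rewrite sumr_const card_ord -mulrnA -mulr_natr natrM.
rewrite (mulrC q%:R) -/k mulrAC ltr_pdivrMr ?ltr_wpDl// ltr_pM2l//; lra.
Qed.

Context d (T : measurableType d).

Lemma measurable_enorm D (h : T -> 'M[R]_(p, q)) :
  (forall i j, measurable_fun D (fun x => h x i j)) ->
  measurable_fun D (fun x => enorm (h x)).
Proof.
move=> mh; apply: (measurableT_comp (continuous_measurable_fun (@sqrt_continuous R))).
apply: measurable_sum => i; apply: measurable_sum => j.
by apply: measurable_funX.
Qed.

Variable mu : {measure set T -> \bar R}.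

Lemma integrable_enorm D (h : T -> 'M[R]_(p, q)) : measurable D ->
  (forall i j, mu.-integrable D (EFin \o (fun x => h x i j))) ->
  mu.-integrable D (EFin \o (fun x => enorm (h x))).
Proof.
move=> mD ih.
have isum : mu.-integrable D (fun x => \sum_(ij : 'I_p * 'I_q) `|h x ij.1 ij.2|%:E)%E.
  by apply: integrable_sum => // ij _; exact: integrable_norm (ih _ _).
apply: le_integrable isum => //.
  apply/measurable_EFinP; apply: measurable_enorm => i j.
  exact: integrable_fun_measurable (ih i j).
move=> x Dx /=; rewrite sumEFin lee_fin (ger0_norm (enorm_ge0 _)).
rewrite (le_trans _ (ler_norm _))// (le_trans (enorm_le_sum _))//.
by rewrite pair_bigA.
Qed.

Lemma Rintegral_sum D (I : Type) (s : seq I) (F : I -> T -> R) : measurable D ->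
  (forall i, mu.-integrable D (EFin \o F i)) ->
  mu.-integrable D (EFin \o (fun x => \sum_(i <- s) F i x)) /\
  \int[mu]_(x in D) (\sum_(i <- s) F i x) = \sum_(i <- s) \int[mu]_(x in D) F i x.
Proof.
move=> mD iF; elim: s => [|i s [IH1 IH2]].
  under eq_fun do rewrite big_nil; split; first exact: integrable0.
  by rewrite big_nil Rintegral_cst// mul0r.
split.
  rewrite (_ : _ \o _ = (EFin \o F i) \+ (EFin \o (fun x => (\sum_(i <- s) F i x)%R)))%E.
    exact: integrableD.
  by apply/funext => x /=; rewrite big_cons.
under eq_Rintegral do rewrite big_cons.
by rewrite RintegralD// IH2 big_cons.
Qed.

(** Pairing with the matrix [V] of integrals gives |V|^2 = \int <V, h> <= |V| \int |h| by
    Cauchy-Schwarz, and |V| cancels unless it is 0. *)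
Lemma enorm_integral D (h : T -> 'M[R]_(p, q)) : measurable D ->
  (forall i j, mu.-integrable D (EFin \o (fun x => h x i j))) ->
  enorm (\matrix_(i, j) \int[mu]_(x in D) h x i j) <= \int[mu]_(x in D) enorm (h x).
Proof.
move=> mD ih; set V := \matrix_(i, j) _.
have ie := integrable_enorm mD ih.
have [V0|V0] := eqVneq (enorm V) 0.
  by rewrite V0 Rintegral_ge0// => x _; exact: enorm_ge0.
have Vp : 0 < enorm V by rewrite lt_neqAle eq_sym V0 enorm_ge0.
rewrite -(ler_pM2l Vp) -expr2 sqr_enorm -RintegralZl//.
have iZ i j : mu.-integrable D (EFin \o (fun x => V i j * h x i j)).
  rewrite (_ : _ \o _ = (fun x => (V i j)%:E * (h x i j)%:E)%E)//.
  exact: (integrableZl mD (V i j) (ih i j)).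
have iZ1 i := (Rintegral_sum (index_enum 'I_q) mD (iZ i)).1.
have -> : \sum_i \sum_j V i j ^+ 2 =
    \int[mu]_(x in D) \sum_i \sum_j V i j * h x i j.
  rewrite (Rintegral_sum _ mD iZ1).2; apply: eq_bigr => i _.
  rewrite (Rintegral_sum _ mD (iZ i)).2; apply: eq_bigr => j _.
  by rewrite RintegralZl// expr2; congr (_ * _); rewrite mxE.
apply: le_Rintegral => //.
- exact: (Rintegral_sum _ mD iZ1).1.
- rewrite (_ : _ \o _ = (fun x => (enorm V)%:E * (enorm (h x))%:E)%E)//.
  exact: (integrableZl mD (enorm V) ie).
- by move=> x Dx; exact: enorm_inner.
Qed.

End any_size.
End euclidean_norm.

(** * Total variation of a measure with a density *)

Section total_variation_integral.
Context {R : realType} (S : @vmeasure R) (m : {measure set (plane R) -> \bar R}).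
Variables (A : set (plane R)) (sigma : plane R -> 'M[R]_2).
Hypotheses (mA : measurable A) (mAoo : (m A < +oo)%E)
  (isigma : forall i j, m.-integrable A (EFin \o (fun x => sigma x i j)))
  (SE : forall F i j, measurable F -> F `<=` A ->
    S i j F = (\int[m]_(x in F) (sigma x i j)%:E)%E).

Let iF F i j : measurable F -> F `<=` A ->
  m.-integrable F (EFin \o (fun x => sigma x i j)).
Proof. by move=> mF FA; apply: integrableS (isigma i j). Qed.

Let V F : 'M[R]_2 := \matrix_(i, j) fine (S i j F).

Let VE F : measurable F -> F `<=` A ->
  V F = \matrix_(i, j) \int[m]_(x in F) sigma x i j.
Proof. by move=> mF FA; apply/matrixP => i j; rewrite !mxE SE. Qed.

Let menorm : measurable_fun A (fun x => enorm (sigma x)).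
Proof. by apply: measurable_enorm => i j; exact: integrable_fun_measurable (isigma i j). Qed.

Lemma total_variation_le :
  (Defs.total_variation S A <= \int[m]_(x in A) (enorm (sigma x))%:E)%E.
Proof.
apply: ge_ereal_sup => _ [F [mF tF UF ->]].
have FA k : F k `<=` A by rewrite -UF; exact: bigcup_sup.
rewrite -UF ge0_integral_bigcup//; last 2 first.
- by rewrite UF; apply/measurable_EFinP.
- by move=> x _; rewrite lee_fin enorm_ge0.
apply: lee_nneseries => k _; first by rewrite lee_fin enorm_ge0.
rewrite -/(V (F k)) VE// Rintegral_EFin//; last first.
  by apply: integrable_enorm => // i j; exact: iF.
by rewrite lee_fin; apply: enorm_integral => // i j; exact: iF.
Qed.

(** [A] is partitioned into countably many cells on which [sigma] is within [e] of a constant [q k].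
    There |S(F k)| is at least (|q k| - e) m(F k), and the integral of |sigma| is at most (|q k| +
    e) m(F k): a loss of 2 e m(F k). *)
Lemma total_variation_ge :
  (\int[m]_(x in A) (enorm (sigma x))%:E <= Defs.total_variation S A)%E.
Proof.
suff H e : 0 < e -> (\int[m]_(x in A) (enorm (sigma x))%:E <=
    Defs.total_variation S A + \int[m]_(x in A) (e + e)%:E)%E.
  apply/lee_addgt0Pr => e e0.
  have mAf : m A \is a fin_num by rewrite ge0_fin_numE.
  have k0 : 0 < 2 * (fine (m A) + 1) by rewrite mulr_gt0// ltr_wpDl// fine_ge0.
  (* The total loss is twice this number times [m A], hence at most [e]. *)
  have := H (e / (2 * (fine (m A) + 1))) (divr_gt0 e0 k0).
  move=> /le_trans; apply; rewrite leeD2l// integral_cst// -(fineK mAf) -EFinM lee_fin.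
  set M := fine (m A) in k0 *.
  have M1 : 0 < M + 1 by rewrite ltr_wpDl// /M fine_ge0.
  rewrite /= (_ : _ * M = e * (M / (M + 1))); last by field; rewrite gt_eqF.
  by rewrite ler_piMr ?(ltW e0)// ler_pdivrMr// mul1r lerDl.
move=> e0.
pose q n : 'M[R]_2 := map_mx ratr (odflt 0 (unpickle n) : 'M[rat]_2).
pose G n := A `&` [set x | enorm (sigma x - q n) < e].
have mG n : measurable (G n).
  rewrite /G (_ : [set x | _] = (fun x => enorm (sigma x - q n)) @^-1` `]-oo, e[); last first.
    by apply/seteqP; split => x /=; rewrite in_itv.
  apply: (@measurable_enorm _ _ _ _ _ A (fun x => sigma x - q n)) => // i j.
  rewrite (_ : (fun x => _) = (fun x => sigma x i j - q n i j)).
    by apply: measurable_funB => //; exact: integrable_fun_measurable (isigma i j).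
  by apply/funext => x; rewrite !mxE.
pose F := seqDU G.
have mF k : measurable (F k) by apply: seqDU_measurable.
have FG k : F k `<=` G k by apply: subset_seqDU.
have tF : trivIset setT F by exact: trivIset_seqDU.
have UF : \bigcup_k F k = A.
  rewrite -seqDU_bigcup_eq; apply/seteqP; split=> [x [k _ [//]]|x Ax].
  by have [n hn] := rat_matrix_dense (sigma x) e0; exists n.
have FA k : F k `<=` A by move=> x /FG[].
have VTV : (\sum_(0 <= k <oo) (enorm (V (F k)))%:E <= Defs.total_variation S A)%E.
  by apply: ereal_sup_ubound; exists F.
have FE (f : plane R -> R) : measurable_fun A f -> (forall x, 0 <= f x) ->
    (\int[m]_(x in A) (f x)%:E = \sum_(0 <= k <oo) \int[m]_(x in F k) (f x)%:E)%E.
  move=> mf f0; rewrite -{1}UF ge0_integral_bigcup//.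
  by rewrite UF; apply/measurable_EFinP.
  by move=> x _; rewrite lee_fin.
rewrite FE//; last by move=> x; exact: enorm_ge0.
apply: (@le_trans _ _ (\sum_(0 <= k <oo) (enorm (V (F k)))%:E +
    \int[m]_(x in A) (e + e)%:E)%E); last exact: leeD2r.
rewrite FE//; last by move=> x; lra.
rewrite -nneseriesD; last 2 first.
- by move=> k _; rewrite lee_fin enorm_ge0.
- by move=> k _ _; apply: integral_ge0 => x _; rewrite lee_fin; lra.
apply: lee_nneseries => [k _ _|k _].
  by apply: integral_ge0 => x _; rewrite lee_fin enorm_ge0.
have mFk : (m (F k) < +oo)%E.
  by apply: le_lt_trans mAoo; apply: le_measure; rewrite ?inE.
have icst c : m.-integrable (F k) (EFin \o (fun=> c)).
  apply: measurable_bounded_integrable => //.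
  by exists `|c|; split; [rewrite num_real|move=> M cM x _ /=; exact: ltW].
have iq i j : m.-integrable (F k) (EFin \o (fun x => (sigma x - q k) i j)).
  rewrite (_ : _ \o _ = (EFin \o (fun x => sigma x i j)) \- (EFin \o cst (q k i j)))%E.
    by apply: integrableB; [by []|exact: (@iF (F k) i j (mF k) (@FA k))|exact: icst].
  by apply/funext => x /=; rewrite !mxE EFinB.
have ie : m.-integrable (F k) (EFin \o (fun x => enorm (sigma x))).
  by apply: integrable_enorm => // i j; exact: iF.
rewrite !Rintegral_EFin// -EFinD lee_fin.
pose c := fine (m (F k)).
have c0 : 0 <= c by exact: fine_ge0.
have -> : \int[m]_(x in F k) (e + e) = (e + e) * c by exact: Rintegral_cst.
have h1 : \int[m]_(x in F k) enorm (sigma x) <= (enorm (q k) + e) * c.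
  rewrite /c -Rintegral_cst//; apply: le_Rintegral => // x /FG[_ /= h].
  rewrite -(subrK (q k) (sigma x)) (le_trans (enormD _ _))// addrC lerD2l//.
  exact: ltW.
have h2 : enorm (V (F k) - c *: q k) <= e * c.
  have -> : V (F k) - c *: q k = \matrix_(i, j) \int[m]_(x in F k) (sigma x - q k) i j.
    apply/matrixP => i j; rewrite VE// !mxE.
    under [RHS]eq_Rintegral do rewrite !mxE.
    rewrite RintegralB//; last exact: iF.
    by rewrite Rintegral_cst// mulrC.
  apply: le_trans (enorm_integral _ iq) _ => //.
  rewrite /c -Rintegral_cst//; apply: le_Rintegral => //.
    exact: integrable_enorm.
  by move=> x /FG[_ /= h]; exact: ltW.
have h3 : c * enorm (q k) <= enorm (V (F k)) + enorm (V (F k) - c *: q k).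
  rewrite -{1}(ger0_norm c0) -enormZ -[X in enorm X <= _](subrK (V (F k))) addrC.
  by rewrite (le_trans (enormD _ _))// -(enormN (_ - _)) opprB.
nra.
Qed.

Lemma total_variationE :
  Defs.total_variation S A = (\int[m]_(x in A) (enorm (sigma x))%:E)%E.
Proof. by apply/eqP; rewrite eq_le total_variation_le total_variation_ge. Qed.

End total_variation_integral.

(** * Convex functions of linear growth *)

Section linear_growth.
Context {R : realType}.

Lemma convex_functionE (E : lmodType R) (phi : E -> R) :
  convex_function (E := E) setT phi -> convex_on setT phi.
Proof.
move=> cphi t u v /andP[t0 t1] _ _.
have t01 : Itv.spec (Itv.num_sem (R := R)) (Itv.Real `[0%Z, 1%Z]) t.
  by apply/and3P; split; rewrite ?num_real// bnd_simp.
have := cphi (Itv.mk t01) u v (mem_setT _) (mem_setT _).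
by rewrite convRE.
Qed.

Section lipschitz.
Variables (p q : nat) (G : 'M[R]_(p, q) -> R) (K : R).
Hypotheses (K0 : 0 <= K) (GK : forall A B, G (A + B) <= G A + K * enorm B).

(** [G] is the infimum of the cones [G (Q n) + K * enorm (B - Q n)] in [B] over rational matrices
    [Q n], so its strict sublevel sets are countable unions of those of the cones. *)
Lemma measurable_lipschitz d (T : measurableType d) (D : set T) (h : T -> 'M[R]_(p, q)) :
  (forall i j, measurable_fun D (fun x => h x i j)) ->
  measurable_fun D (fun x => G (h x)).
Proof.
move=> mh mD; apply: (measurability _ (measurable_realfun.RGenInftyO.measurableE R)) => //.
move=> _ [_ [c ->] <-].
pose Q n : 'M[R]_(p, q) := map_mx ratr (odflt 0 (unpickle n) : 'M[rat]_(p, q)).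
have -> : D `&` (fun x => G (h x)) @^-1` `]-oo, c[ =
    \bigcup_n (D `&` (fun x => G (Q n) + K * enorm (h x - Q n)) @^-1` `]-oo, c[).
  apply/seteqP; split=> [x [Dx]|x [n _ [Dx]]]; rewrite /= !in_itv /= => hc.
    (* The distance to [Q n] is paid once in [G] and once in the cone, whence [2 * K]; the [+ 1]
       allows [K = 0]. *)
    have e0 : 0 < (c - G (h x)) / (2 * K + 1).
      by rewrite divr_gt0 ?subr_gt0// ltr_wpDl// mulr_ge0.
    have [n hn] := rat_matrix_dense (h x) e0; exists n => //; split => //.
    rewrite /= in_itv /=; have := GK (h x) (Q n - h x); rewrite subrKC.
    rewrite -(enormN (Q n - h x)) opprB.
    have K21 : 0 < 2 * K + 1 by rewrite ltr_wpDl// mulr_ge0.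
    move: hn; rewrite -/(Q n) ltr_pdivlMr//.
    have := enorm_ge0 (h x - Q n); nra.
  split => //; apply: le_lt_trans hc.
  by have := GK (Q n) (h x - Q n); rewrite subrKC.
apply: bigcupT_measurable => n.
apply: (_ : measurable_fun D (fun x => G (Q n) + K * enorm (h x - Q n))) => //.
apply: measurable_funD => //; apply: measurable_funM => //.
apply: measurable_enorm => i j.
rewrite (_ : (fun x => _) = (fun x => h x i j - Q n i j)).
  exact: measurable_funB.
by apply/funext => x; rewrite !mxE.
Qed.

End lipschitz.

Section growth.
Variables (n : nat) (g : 'rV[R]_n -> R) (K : R).
Hypotheses (cg : convex_on setT g) (g_ge0 : forall x, 0 <= g x) (K0 : 0 < K)
  (gK : forall x, g x <= K * (1 + enorm x)).

(** [x + y] is the convex combination of [x + N *: y] and [x] with weight 1/N on the first. As N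
    grows, K (1 + |x + N y|) / N tends to K |y|, so the growth constant is itself a Lipschitz
    constant. *)
Lemma growth_lipschitz x y : g (x + y) <= g x + K * enorm y.
Proof.
apply/ler_addgt0Pr => e e0.
pose c := K * (1 + enorm x).
have c0 : 0 < c by rewrite mulr_gt0// ltr_pwDl ?enorm_ge0.
pose N := 1 + c / e.
have N1 : 1 <= N by rewrite lerDl divr_ge0 ?ltW.
have N0 : 0 < N by apply: lt_le_trans N1.
have l01 : 0 <= N^-1 <= 1 by rewrite invr_ge0 (ltW N0)/= invf_le1.
have := cg l01 (I : setT (x + N *: y)) (I : setT x).
have -> : N^-1 *: (x + N *: y) + (1 - N^-1) *: x = x + y.
  rewrite scalerDr scalerA mulVf ?gt_eqF// scale1r addrAC -scalerDl subrKC.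
  by rewrite scale1r.
move=> /le_trans; apply.
have h1 : g (x + N *: y) <= c + N * (K * enorm y).
  apply: le_trans (gK _) _; rewrite /c.
  have := enormD x (N *: y); rewrite enormZ (gtr0_norm N0).
  by move=> /(ler_wpM2l (ltW K0)); lra.
have h2 : N^-1 * g (x + N *: y) <= N^-1 * c + K * enorm y.
  rewrite (le_trans (ler_wpM2l _ h1)) ?invr_ge0 ?(ltW N0)//.
  by rewrite mulrDr mulKf ?gt_eqF.
have h3 : N^-1 * c <= e.
  rewrite ler_pdivrMl// /N mulrDl mul1r mulfVK ?gt_eqF//; lra.
have h4 : (1 - N^-1) * g x <= g x by rewrite ler_piMl//; lra.
lra.
Qed.

End growth.

Section recession.
Variables (g : 'rV[R]_4 -> R) (K : R).
Hypotheses (cg : convex_on setT g) (g_ge0 : forall x, 0 <= g x) (K0 : 0 < K)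
  (gK : forall x, g x <= K * (1 + enorm x)) (gmin : forall x, g 0 <= g x).

(** Subtracting [g 0] gives a difference quotient at 0, nondecreasing in [t] by convexity; the limit
    is that of [g (t *: x) / t], since [g 0 / t] tends to 0. *)
Let ratio x (t : R) := (g (t *: x) - g 0) / t.

Let ratio_nd x (s t : R) : 0 < s -> s <= t -> ratio x s <= ratio x t.
Proof.
move=> s0 st; have t0 : 0 < t by apply: lt_le_trans st.
have l01 : 0 <= s / t <= 1 by rewrite divr_ge0 ?(ltW s0) ?(ltW t0)//= ler_pdivrMr// mul1r.
have := cg l01 (I : setT (t *: x)) (I : setT 0).
rewrite scaler0 addr0 scalerA mulfVK ?gt_eqF// => h.
rewrite /ratio ler_pdivrMr// mulrAC -mulrA mulrC.
rewrite (_ : _ * _ = s / t * (g (t *: x) - g 0)); last by ring.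
lra.
Qed.

Let ratio_ub x t : 0 < t -> ratio x t <= K * enorm x.
Proof.
move=> t0; rewrite /ratio ler_pdivrMr//.
by have := growth_lipschitz cg g_ge0 K0 gK 0 (t *: x); rewrite add0r enormZ (gtr0_norm t0); lra.
Qed.

Lemma recession_cvg x :
  g (t *: x) / t @[t --> +oo] --> sup [set ratio x t | t in [set t | 0 < t]].
Proof.
set A := [set _ | _ in _].
have hA : has_sup A.
  split; first by exists (ratio x 1), 1 => //=.
  by exists (K * enorm x) => _ [t /= t0 <-]; exact: ratio_ub.
apply/cvgrPdist_le => e e0.
have [_ [t0 /= t00 <-] ht0] := sup_adherent (divr_gt0 e0 (ltr0Sn R 1)) hA.
near=> t.
have tt0 : t0 <= t by near: t; apply: nbhs_pinfty_ge; rewrite num_real.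
have tp : 0 < t by apply: lt_le_trans tt0.
have tg : 2 * g 0 / e <= t by near: t; apply: nbhs_pinfty_ge; rewrite num_real.
have h1 : ratio x t <= sup A by apply: ub_le_sup; [case: hA|exists t].
have h2 := ratio_nd x t00 tt0.
have -> : g (t *: x) / t = ratio x t + g 0 / t by rewrite /ratio; field; rewrite gt_eqF.
have h3 : 0 <= g 0 / t by rewrite divr_ge0 ?(ltW tp).
have h4 : g 0 / t <= e / 2.
  by move: tg; rewrite !ler_pdivrMr//; lra.
by rewrite ler_norml; apply/andP; split; lra.
Unshelve. all: by end_near. Qed.

Let recessionE x :
  recession g x = sup [set ratio x t | t in [set t | 0 < t]].
Proof. apply: cvg_lim; [exact: Rhausdorff|exact: recession_cvg]. Qed.

Lemma recession_ge x t : 0 < t -> g (t *: x) <= g 0 + t * recession g x.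
Proof.
move=> t0; rewrite recessionE.
set A := [set _ | _ in _].
have : ratio x t <= sup A.
  apply: ub_le_sup; last by exists t.
  by exists (K * enorm x) => _ [s /= s0 <-]; exact: ratio_ub.
by rewrite /ratio ler_pdivrMr// mulrC; lra.
Qed.

Lemma recession_le x c : (forall t, 0 < t -> g (t *: x) <= g 0 + t * c) ->
  recession g x <= c.
Proof.
move=> h; rewrite recessionE.
apply: ge_sup; first by exists (ratio x 1), 1 => //=.
move=> _ [t /= t0 <-]; rewrite /ratio ler_pdivrMr// mulrC.
by have := h _ t0; lra.
Qed.

Lemma recession_ge0 x : 0 <= recession g x.
Proof.
have := @recession_ge x 1 ltr01; rewrite scale1r mul1r.
by have := gmin x; lra.
Qed.

Lemma recession_lipschitz x y :
  recession g (x + y) <= recession g x + K * enorm y.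
Proof.
apply: recession_le => t t0; rewrite scalerDr.
have := growth_lipschitz cg g_ge0 K0 gK (t *: x) (t *: y); rewrite enormZ (gtr0_norm t0).
by have := recession_ge x t0; lra.
Qed.

Lemma recession0 : recession g 0 = 0.
Proof.
apply/eqP; rewrite eq_le recession_ge0 andbT; apply: recession_le => t t0.
by rewrite scaler0 mulr0 addr0.
Qed.

Lemma recession_le_enorm x : recession g x <= K * enorm x.
Proof. by have := recession_lipschitz 0 x; rewrite add0r recession0 add0r. Qed.

Lemma recessionZ c x : 0 <= c -> recession g (c *: x) = c * recession g x.
Proof.
have aux b y : 0 < b -> recession g (b *: y) <= b * recession g y.
  move=> b0; apply: recession_le => t t0; rewrite scalerA mulrA.
  by apply: recession_ge; rewrite mulr_gt0.
rewrite le_eqVlt => /predU1P[<-|c0]; first by rewrite scale0r mul0r recession0.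
apply/eqP; rewrite eq_le aux//=.
have : recession g (c^-1 *: (c *: x)) <= c^-1 * recession g (c *: x).
  by apply: aux; rewrite invr_gt0.
by rewrite scalerA mulVf ?gt_eqF// scale1r ler_pdivlMl.
Qed.

Lemma convex_recession : convex_on setT (recession g).
Proof.
move=> s x y s01 _ _; apply: recession_le => t t0.
have /andP[s0 s1] := s01.
rewrite scalerDr !scalerA ![t * _]mulrC -!scalerA.
apply: le_trans (cg s01 I I) _.
have := ler_wpM2l s0 (recession_ge x t0).
have s1' : 0 <= 1 - s by rewrite subr_ge0.
have := ler_wpM2l s1' (recession_ge y t0).
lra.
Qed.

End recession.
End linear_growth.

(** * Lebesgue decomposition of the Hessian measure *)

Lemma fin_num_addeI {R : realType} (x y z : \bar R) : x \is a fin_num ->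
  (x + y = x + z)%E -> y = z.
Proof.
case: x => [r| |]// _; case: y => [a| |]; case: z => [b| |] //.
by move=> [] /addrI ->.
Qed.

Section decompositions.
Context {R : realType} (Omega : set (plane R)).
Hypotheses (oO : open (Omega : set (R * R))) (bO : bounded_set (Omega : set (R * R))).
Implicit Types (D S : @vmeasure R) (h sigma : plane R -> 'M[R]_2)
  (m : {finite_measure set (plane R) -> \bar R}).

Let mO : measurable Omega.
Proof. exact: open_plane_measurable. Qed.

Lemma leb2_bounded : (@leb2 R Omega < +oo)%E.
Proof.
have [M [_ HM]] := bO.
pose K := `|M| + 1.
have OK : Omega `<=` `[- K, K] `*` `[- K, K].
  move=> z Oz; have : `|z : R * R| <= K.
    by apply: HM Oz; rewrite /K ltr_pwDr// ler_norm.
  rewrite prod_normE ge_max => /andP[h1 h2].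
  by split; rewrite /= in_itv /= -ler_norml.
apply: (@le_lt_trans _ _ (leb2 (`[- K, K] `*` `[- K, K] : set (plane R)))).
  by apply: le_measure => //; rewrite inE//; apply: measurableX; exact: measurable_itv.
have -> : leb2 (`[- K, K] `*` `[- K, K] : set (plane R)) =
    (@lebesgue_measure R `[(- K)%R, K]%classic * @lebesgue_measure R `[(- K)%R, K]%classic)%E.
  by apply: product_measure1E; exact: measurable_itv.
by rewrite lebesgue_measure_itv /=; case: ifP => _; rewrite -?EFinB -?EFinM ?mule0 ltry.
Qed.

(** Densities are taken against finite measures, so Lebesgue measure is restricted to the bounded
    set [Omega]. *)
Let lebO : {finite_measure set (plane R) -> \bar R} := mfrestr mO leb2_bounded.

Let lebOE A : lebO A = leb2 (A `&` Omega).
Proof. by []. Qed.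

Let integral_lebO A (phi : plane R -> \bar R) : A `<=` Omega ->
  (\int[lebO]_(x in A) phi x = \int[leb2]_(x in A) phi x)%E.
Proof.
move=> AO; apply: eq_measure_integral => B mB BA.
by rewrite [LHS]lebOE setIidl//; exact: subset_trans AO.
Qed.

Definition carried D : Prop :=
  forall i j A, measurable A -> D i j A = D i j (A `&` Omega).

Lemma vmeasure_dominated D : exists m, forall i j, D i j `<< m.
Proof.
have [m hm] := charges_dominated (fun ij : 'I_2 * 'I_2 => D ij.1 ij.2).
by exists m => i j; exact: (hm (i, j)).
Qed.

Lemma vmeasure_density D m : (forall i j, D i j `<< m) ->
  exists sigma, forall i j, has_density (D i j) m (fun x => sigma x i j).
Proof.
move=> Dm; have /choice[s hs] : forall ij : 'I_2 * 'I_2, exists s, has_density (D ij.1 ij.2) m s.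
  by move=> ij; exact: density_exists.
exists (fun x => \matrix_(i, j) s (i, j) x) => i j.
by under eq_fun do rewrite mxE; exact: (hs (i, j)).
Qed.

(* A Lebesgue-null set of maximal m-measure carries the singular part. *)
Lemma maximal_null_set m : exists N, [/\ measurable N, leb2 N = 0%E &
  forall A, measurable A -> leb2 A = 0%E -> m (A `\` N) = 0%E].
Proof.
have mf A : measurable A -> m A \is a fin_num by exact: fin_num_measure.
pose V := [set fine (m N) | N in [set N | measurable N /\ @leb2 R N = 0%E]].
have hV : has_sup V.
  split; first by exists (fine (m set0)), set0.
  exists (fine (m setT)) => _ [N [mN _] <-]; rewrite fine_le ?mf//.
  by apply: le_measure; rewrite ?inE.
have /choice[N hN] : forall k : nat, exists N, [/\ measurable N, @leb2 R N = 0%E &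
    sup V - k.+1%:R^-1 < fine (m N)].
  move=> k; have [|_ [N [mN N0] <-] h] := @sup_adherent _ V k.+1%:R^-1 _ hV.
    by rewrite invr_gt0.
  by exists N.
(* The union of a maximising sequence is still null and attains [sup V]; a null set with mass
   outside [N0] would push the union beyond the supremum. *)
pose N0 := \bigcup_k N k.
have mN0 : measurable N0 by apply: bigcupT_measurable => k; have [] := hN k.
have nN0 : leb2 N0 = 0%E.
  apply/negligibleP => //; apply: negligible_bigcup => k.
  by have [mNk Nk0 _] := hN k; apply/negligibleP.
have supN0 : sup V <= fine (m N0).
  apply/ler_addgt0Pr => e e0.
  have [k ke] : exists k : nat, k.+1%:R^-1 < e.
    by have [k] := ltr_add_invr e0; rewrite add0r; exists k.
  have [mNk _ hk] := hN k.
  have : fine (m (N k)) <= fine (m N0).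
    rewrite fine_le ?mf//; apply: le_measure; rewrite ?inE//; exact: bigcup_sup.
  move: hk ke; set u := _^-1; set v := fine _; set w := fine _; set z := sup V.
  lra.
exists N0; split => // A mA A0.
have mAN : measurable (A `\` N0) by exact: measurableD.
have U0 : leb2 (N0 `|` A) = 0%E.
  apply/negligibleP; first exact: measurableU.
  by apply: negligibleU; apply/negligibleP.
have : fine (m (N0 `|` A)) <= sup V.
  by apply: ub_le_sup; [case: hV|exists (N0 `|` A) => //; split => //; exact: measurableU].
have -> : N0 `|` A = N0 `|` (A `\` N0).
  apply/seteqP; split=> x; last by move=> [|[]]; [left|right].
  by move=> [|Ax]; [left|have [|nx] := pselect (N0 x); [left|right]].
rewrite measureU//; last by rewrite setIDA setIC -setIDA setDv setI0.
rewrite fineD ?mf// => h.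
have : fine (m (A `\` N0)) <= 0 by lra.
have f0 : 0 <= fine (m (A `\` N0)) by exact: fine_ge0.
by rewrite le_eqVlt ltNge f0 orbF => /eqP f00; rewrite -(fineK (mf _ mAN)) f00.
Qed.

(** Off [N], Lebesgue-null sets are [m]-null, so [D] ignores them and has a density; what [D] has on
    [N] is singular. As [m] dominates every component, a single [N] serves all four. *)
Lemma lebesgue_decomposition_exists D : carried D ->
  exists h S, lebesgue_decomposition Omega D h S.
Proof.
move=> cD; have [m Dm] := vmeasure_dominated D.
have [N [mN N0 Nmax]] := maximal_null_set m.
have mNC : measurable (~` N) by exact: measurableC.
pose nu i j : {charge set (plane R) -> \bar R} := crestr0 (D i j) mNC.
pose S : @vmeasure R := fun i j => crestr0 (D i j) mN.
have nuE i j A : measurable A -> nu i j A = D i j (A `\` N).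
  by move=> mA; rewrite /nu /= /crestr0 mem_set.
have SE i j A : measurable A -> S i j A = D i j (A `&` N).
  by move=> mA; rewrite /S /= /crestr0 mem_set.
have nuleb i j : nu i j `<< lebO.
  apply/null_content_dominatesP => A mA A0.
  rewrite nuE// cD; last exact: measurableD.
  rewrite setIDAC setIDA; have /null_content_dominatesP := Dm i j; apply.
    by apply: measurableD => //; exact: measurableI.
  by apply: Nmax => //; exact: measurableI.
have /choice[s hs] : forall ij : 'I_2 * 'I_2, exists s, has_density (nu ij.1 ij.2) lebO s.
  by move=> ij; exact: density_exists.
exists (fun x => \matrix_(i, j) s (i, j) x), S; split.
- move=> i j; under eq_fun do rewrite mxE; have [/= isg _] := hs (i, j).
  have : lebO.-integrable Omega (EFin \o s (i, j)) by exact: integrableS isg.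
  move=> /integrableP[ms fs]; apply/integrableP; split; first exact: ms.
  rewrite -(integral_lebO (fun x => `|(s (i, j) x)%:E|%E) (@subset_refl _ Omega)).
  exact: fs.
- exists N => // A i j mA; rewrite SE; last exact: measurableD.
  by rewrite setDE -setIA setICl setI0 charge0.
- move=> A i j mA.
  have [/= _ e] := hs (i, j).
  have -> : D i j A = (nu i j A + S i j A)%E.
    by rewrite nuE// SE// -chargeDI.
  congr (_ + _)%E; under eq_integral do rewrite mxE.
  rewrite -integral_lebO; last exact: subIsetr.
  rewrite -e; last exact: measurableI.
  rewrite !nuE//; last exact: measurableI.
  by rewrite [LHS]cD ?setIDAC ?setIDA//; exact: measurableD.
Qed.

(** If [sigma] is the density of [S] against a dominating [m], take [tau] = |sigma| m and [th] =
    sigma / |sigma|. *)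
Lemma polar_decomposition_exists S : exists (tau : {finite_measure set (plane R) -> \bar R}) th,
  polar_decomposition S tau th.
Proof.
have [m Sm] := vmeasure_dominated S; have [sigma hsigma] := vmeasure_density Sm.
have ie : m.-integrable setT (EFin \o (fun x => enorm (sigma x))).
  by apply: integrable_enorm => // i j; case: (hsigma i j).
have pos E : (0 <= induced_charge ie E)%E.
  by apply: integral_ge0 => x _; rewrite lee_fin enorm_ge0.
pose tau0 := measure_of_charge (induced_charge ie) pos.
have fin0 : (tau0 setT < +oo)%E.
  by rewrite ltey_eq (fin_num_measure (induced_charge ie)).
pose tau : {finite_measure set (plane R) -> \bar R} := mfrestr measurableT fin0.
have tauE A : tau A = (\int[m]_(x in A) (enorm (sigma x))%:E)%E.
  by transitivity (tau0 (A `&` setT)); [|rewrite setIT].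
(* Where [sigma] vanishes the inverse is 0 and so is [th], and multiplying by |sigma| still gives
   back [sigma]. *)
pose th x := (enorm (sigma x))^-1 *: sigma x.
have me : measurable_fun setT (fun x => enorm (sigma x)) := integrable_fun_measurable ie.
have mth i j : measurable_fun setT (fun x => th x i j).
  rewrite (_ : (fun x => _) = (fun x => (enorm (sigma x))^-1 * sigma x i j)); last first.
    by apply/funext => x; rewrite mxE.
  apply: measurable_funM; last exact: integrable_fun_measurable (hsigma i j).1.
  under eq_fun do rewrite -powR_inv1 ?enorm_ge0//.
  exact: (measurableT_comp (measurable_powR (-1))).
have thE x i j : th x i j * enorm (sigma x) = sigma x i j.
  rewrite mxE; have [e0|e0] := eqVneq (enorm (sigma x)) 0.
    have := enorm_entry (sigma x) i j; rewrite e0 normr_le0 => /eqP ->.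
    by rewrite mulr0.
  by rewrite mulrC mulrA mulfV// mul1r.
have ith i j : tau.-integrable setT (EFin \o (fun x => th x i j)).
  apply: measurable_bounded_integrable => //.
    by rewrite ltey_eq fin_num_measure.
  exists 1; split; first exact: num_real.
  move=> M M1 x _ /=; apply: le_trans (ltW M1).
  rewrite (le_trans (enorm_entry _ i j))// enormZ ger0_norm ?invr_ge0 ?enorm_ge0//.
  by have [->|e0] := eqVneq (enorm (sigma x)) 0; [rewrite mulr0|rewrite mulVf].
exists tau, th; split.
  move=> A mA; rewrite tauE; apply/esym/total_variationE => //.
  - by rewrite ltey_eq fin_num_measure.
  - by move=> i j; apply: integrableS (hsigma i j).1.
  - by move=> F i j mF FA; rewrite (hsigma i j).2.
move=> i j; split => // A mA; rewrite (hsigma i j).2//.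
have dtau : has_density tau m (fun x => enorm (sigma x)) by split.
rewrite (integral_has_density dtau mA); last exact: integrableS (ith i j).
by apply: eq_integral => x _; rewrite thE.
Qed.

(** Off the union of the two null sets both singular parts vanish, so [h] and [h'] have equal
    integrals over measurable subsets of [Omega]. Cancelling these integrals leaves the singular
    parts. *)
Lemma lebesgue_decomposition_unique D D' h h' S S' :
  (forall i j A, measurable A -> D i j A = D' i j A) ->
  lebesgue_decomposition Omega D h S -> lebesgue_decomposition Omega D' h' S' ->
  ae_eq leb2 Omega h h' /\ forall i j A, measurable A -> S i j A = S' i j A.
Proof.
move=> DD' [ih [N [mN N0] SN] DE] [ih' [N' [mN' N'0] SN'] DE'].
have mM : measurable (N `|` N') by exact: measurableU.
have nM : leb2 (N `|` N') = 0%E.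
  by apply/negligibleP => //; apply: negligibleU; apply/negligibleP.
have key B i j : measurable B -> B `<=` Omega ->
    (\int[leb2]_(x in B) (h x i j)%:E = \int[leb2]_(x in B) (h' x i j)%:E)%E.
  move=> mB BO; set M := N `|` N' in mM nM.
  have mBM : measurable (B `\` M) by exact: measurableD.
  have BMO : (B `\` M) `&` Omega = B `\` M.
    by apply: setIidl; apply: subset_trans BO; exact: subDsetl.
  have dropM (k : plane R -> R) : leb2.-integrable Omega (EFin \o k) ->
      (\int[leb2]_(x in B) (k x)%:E = \int[leb2]_(x in B `\` M) (k x)%:E)%E.
    move=> ik; apply: negligible_integral => //; first exact: integrableS ik.
  rewrite (dropM _ (ih i j)) (dropM _ (ih' i j)).
  have S0 : S i j (B `\` M) = 0%E.
    rewrite -(SN (B `\` M) i j mBM); congr (S i j _).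
    by rewrite setDDl; congr setD; rewrite /M setUAC setUid.
  have S'0 : S' i j (B `\` M) = 0%E.
    rewrite -(SN' (B `\` M) i j mBM); congr (S' i j _).
    by rewrite setDDl; congr setD; rewrite /M -setUA setUid.
  have hD := DE _ i j mBM; rewrite BMO S0 adde0 in hD.
  have hD' := DE' _ i j mBM; rewrite BMO S'0 adde0 in hD'.
  by rewrite -hD -hD' DD'.
split; last first.
  move=> i j A mA; have mAO : measurable (A `&` Omega) by exact: measurableI.
  have E := key _ i j mAO (@subIsetr _ _ _).
  have := DE A i j mA; rewrite (DD' i j A mA) (DE' A i j mA) E.
  have f' : (\int[leb2]_(x in A `&` Omega) (h' x i j)%:E)%E \is a fin_num.
    apply: integrable_fin_num => //; apply: integrableS (ih' i j) => //; exact: subIsetr.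
  by move=> /esym; exact: fin_num_addeI.
have H i j : ae_eq leb2 Omega (EFin \o (fun x => h x i j)) (EFin \o (fun x => h' x i j)).
  apply: integral_ae_eq => //; first exact: measurable_int (ih' i j).
  by move=> B BO mB; exact: key.
have H2 i : \forall x \ae leb2, forall j, Omega x -> h x i j = h' x i j.
  apply: filterS2 (H i 0) (H i (lift ord0 ord0)) => x h0 h1 j Ox.
  have [-> {j}|[-> {j}]] : j = 0 \/ j = lift ord0 ord0.
    by case: j => -[|[|//]] ?; [left|right]; exact/val_inj.
    by have [] := h0 Ox.
  by have [] := h1 Ox.
apply: filterS2 (H2 0) (H2 (lift ord0 ord0)) => x h0 h1 Ox; apply/matrixP => i j.
have [-> {i}|-> {i}] : i = 0 \/ i = lift ord0 ord0; [|exact: h0|exact: h1].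
by case: i => -[|[|//]] ?; [left|right]; exact/val_inj.
Qed.

(** [sigma] and |sigma| th are both densities of [S] against [m], hence equal [m]-almost everywhere,
    and homogeneity gives G(th) |sigma| = G(sigma). The polar pair disappears, leaving an [m] that
    several measures can share. *)
Lemma polar_integral S tau th m sigma (G : 'M[R]_2 -> R) (K : R) E :
  polar_decomposition S tau th -> (forall i j, has_density (S i j) m (fun x => sigma x i j)) ->
  (forall A B, G (A + B) <= G A + K * enorm B) ->
  (forall c A, 0 <= c -> G (c *: A) = c * G A) ->
  (forall A, 0 <= G A <= K * enorm A) -> 0 <= K -> measurable E ->
  (\int[tau]_(x in E) (G (th x))%:E = \int[m]_(x in E) (G (sigma x))%:E)%E.
Proof.
move=> [tauE thP] dsigma GL Gh GK K0 mE.
have isigma i j : m.-integrable setT (EFin \o (fun x => sigma x i j)) := (dsigma i j).1.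
have ie : m.-integrable setT (EFin \o (fun x => enorm (sigma x))) by exact: integrable_enorm.
have dtau : has_density tau m (fun x => enorm (sigma x)).
  split=> // A mA; rewrite tauE//; apply: total_variationE => //.
  - by rewrite ltey_eq fin_num_measure.
  - by move=> i j; apply: integrableS (isigma i j).
  - by move=> F i j mF FA; rewrite (dsigma i j).2.
have ith i j : tau.-integrable setT (EFin \o (fun x => th x i j)) := (thP i j).1.
have mth i j : measurable_fun setT (fun x => th x i j) := integrable_fun_measurable (ith i j).
have msigma i j : measurable_fun setT (fun x => sigma x i j) :=
  integrable_fun_measurable (isigma i j).
have iG : tau.-integrable E (EFin \o (fun x => G (th x))).
  have iet : tau.-integrable E (EFin \o (fun x => enorm (th x))).
    apply: integrable_enorm => // i j; exact: integrableS (ith i j).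
  apply: le_integrable (integrableZl mE K iet) => //.
    apply/measurable_EFinP; apply: (measurable_lipschitz K0 GL) => i j; exact: measurable_funTS.
  move=> x Ex /=; have /andP[G0 GKx] := GK (th x).
  by rewrite lee_fin ger0_norm// ger0_norm// mulr_ge0// enorm_ge0.
rewrite (integral_has_density dtau mE iG).
have mEe : measurable_fun E (fun x => enorm (sigma x)).
  by apply: measurable_enorm => i j; exact: measurable_funTS.
apply: ae_eq_integral => //.
- apply/measurable_EFinP; apply: measurable_funM => //.
  by apply: (measurable_lipschitz K0 GL) => i j; exact: measurable_funTS.
- by apply/measurable_EFinP; apply: (measurable_lipschitz K0 GL) => i j; exact: measurable_funTS.
have H i j : ae_eq m setT (EFin \o (fun x => sigma x i j))
    (EFin \o (fun x => th x i j * enorm (sigma x))).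
  apply: integral_ae_eq => //.
    by apply/measurable_EFinP; apply: measurable_funM => //; exact: integrable_fun_measurable ie.
  move=> B _ mB; rewrite -(dsigma i j).2// (thP i j).2//.
  by rewrite (integral_has_density dtau mB)//; exact: integrableS (ith i j).
have H2 i : \forall x \ae m, forall j, sigma x i j = th x i j * enorm (sigma x).
  apply: filterS2 (H i 0) (H i (lift ord0 ord0)) => x h0 h1 j.
  have [-> {j}|-> {j}] : j = 0 \/ j = lift ord0 ord0.
    by case: j => -[|[|//]] ?; [left|right]; exact/val_inj.
    by have [] := h0 I.
  by have [] := h1 I.
apply: filterS2 (H2 0) (H2 (lift ord0 ord0)) => x h0 h1 _.
congr EFin; rewrite mulrC -Gh ?enorm_ge0//; congr G; apply/matrixP => i j.
rewrite mxE mulrC.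
have [-> {i}|-> {i}] : i = 0 \/ i = lift ord0 ord0; [|by rewrite h0|by rewrite h1].
by case: i => -[|[|//]] ?; [left|right]; exact/val_inj.
Qed.

(** Polar pairs do not add, but densities against a fixed [m] do: this presentation is stable under
    linear combinations. *)
Definition hessian_rep D m h sigma : Prop :=
  exists S, lebesgue_decomposition Omega D h S /\
    forall i j, has_density (S i j) m (fun x => sigma x i j).

Lemma hessian_rep_pair D1 D2 : carried D1 -> carried D2 ->
  exists m h1 sigma1 h2 sigma2, hessian_rep D1 m h1 sigma1 /\ hessian_rep D2 m h2 sigma2.
Proof.
move=> /lebesgue_decomposition_exists[h1 [S1 dec1]] /lebesgue_decomposition_exists[h2 [S2 dec2]].
have [m hm] := charges_dominated (fun k : bool * ('I_2 * 'I_2) =>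
  if k.1 then S1 k.2.1 k.2.2 else S2 k.2.1 k.2.2).
have [sigma1 ds1] := vmeasure_density (fun i j => hm (true, (i, j))).
have [sigma2 ds2] := vmeasure_density (fun i j => hm (false, (i, j))).
by exists m, h1, sigma1, h2, sigma2; split; [exists S1|exists S2].
Qed.

Lemma hessian_repD D1 D2 D3 m h1 sigma1 h2 sigma2 (a : R) :
  (forall i j A, measurable A -> D3 i j A = (a%:E * D1 i j A + D2 i j A)%E) ->
  hessian_rep D1 m h1 sigma1 -> hessian_rep D2 m h2 sigma2 ->
  hessian_rep D3 m (fun x => a *: h1 x + h2 x) (fun x => a *: sigma1 x + sigma2 x).
Proof.
move=> D3E [S1 [[ih1 [N1 [mN1 N10] S1N] D1E] ds1]] [S2 [[ih2 [N2 [mN2 N20] S2N] D2E] ds2]].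
exists (fun i j => cadd (cscale a (S1 i j)) (S2 i j)).
split; last first.
  move=> i j; rewrite (_ : (fun x => _) = (fun x => a * sigma1 x i j + sigma2 x i j)).
    exact: has_densityD.
  by apply/funext => x; rewrite !mxE.
split.
- move=> i j; rewrite (_ : _ \o _ = (fun x => a%:E * (h1 x i j)%:E) \+
    (EFin \o (fun x => h2 x i j)))%E; last by apply/funext => x /=; rewrite !mxE.
  apply: integrableD => //; exact: (integrableZl mO a (ih1 i j)).
- exists (N1 `|` N2).
    split; first exact: measurableU.
    apply/negligibleP; first exact: measurableU.
    by apply: negligibleU; apply/negligibleP.
  move=> A i j mA.
  change (a%:E * S1 i j (A `\` (N1 `|` N2)) + S2 i j (A `\` (N1 `|` N2)) = 0)%E.
  have -> : S1 i j (A `\` (N1 `|` N2)) = 0%E.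
    by rewrite setUC -setDDl; apply: S1N; exact: measurableD.
  have -> : S2 i j (A `\` (N1 `|` N2)) = 0%E.
    by rewrite -setDDl; apply: S2N; exact: measurableD.
  by rewrite mule0 adde0.
- move=> A i j mA.
  change (D3 i j A = (\int[leb2]_(x in A `&` Omega) ((a *: h1 x + h2 x) i j)%:E +
    (a%:E * S1 i j A + S2 i j A))%E).
  rewrite (D3E _ _ _ mA) (D1E _ _ _ mA) (D2E _ _ _ mA).
  have mAO : measurable (A `&` Omega) by exact: measurableI.
  have i1 : leb2.-integrable (A `&` Omega) (EFin \o (fun x => h1 x i j)).
    by apply: integrableS (ih1 i j) => //; exact: subIsetr.
  have i2 : leb2.-integrable (A `&` Omega) (EFin \o (fun x => h2 x i j)).
    by apply: integrableS (ih2 i j) => //; exact: subIsetr.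
  have -> : (\int[leb2]_(x in A `&` Omega) ((a *: h1 x + h2 x) i j)%:E =
      a%:E * \int[leb2]_(x in A `&` Omega) (h1 x i j)%:E +
      \int[leb2]_(x in A `&` Omega) (h2 x i j)%:E)%E.
    rewrite -integralZl// -integralD//; last exact: (integrableZl mAO a i1).
    by apply: eq_integral => x _; rewrite !mxE.
  rewrite muleDr//; last first.
    by rewrite fin_num_adde_defr// integrable_fin_num.
  by rewrite addeACA.
Qed.

Lemma total_variation_fin D : carried D -> (Defs.total_variation D Omega < +oo)%E.
Proof.
move=> cD; have [m Dm] := vmeasure_dominated D; have [sigma ds] := vmeasure_density Dm.
have isigma i j : m.-integrable Omega (EFin \o (fun x => sigma x i j)).
  by apply: integrableS (ds i j).1.
rewrite (@total_variationE _ D m Omega sigma)//.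
- by apply: integrable_lty => //; exact: integrable_enorm.
- by rewrite ltey_eq fin_num_measure.
- by move=> F i j mF FO; rewrite (ds i j).2.
Qed.

(** [Omega] is cut along the null set [N] carrying the singular part: [D] has density [h] off [N]
    and coincides with [S] on [N]. This bounds the increments of [J_g] by the Hessian term of the BH
    norm. *)
Lemma total_variation_hessian_rep D m h sigma : hessian_rep D m h sigma ->
  (\int[leb2]_(x in Omega) (enorm (h x))%:E + \int[m]_(x in Omega) (enorm (sigma x))%:E
   <= Defs.total_variation D Omega)%E.
Proof.
move=> [S [[ih [N [mN N0] SN] DE] ds]].
have [m0 Dm0] := vmeasure_dominated D; have [sg0 ds0] := vmeasure_density Dm0.
have TV A : measurable A -> Defs.total_variation D A = (\int[m0]_(x in A) (enorm (sg0 x))%:E)%E.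
  move=> mA; apply: total_variationE => //.
  - by rewrite ltey_eq fin_num_measure.
  - by move=> i j; apply: integrableS (ds0 i j).1.
  - by move=> F i j mF FA; rewrite (ds0 i j).2.
have mOD : measurable (Omega `\` N) by exact: measurableD.
have mOI : measurable (Omega `&` N) by exact: measurableI.
have me0 : measurable_fun setT (fun x => enorm (sg0 x)).
  by apply: measurable_enorm => i j; exact: integrable_fun_measurable (ds0 i j).1.
have -> : Defs.total_variation D Omega =
    (Defs.total_variation D (Omega `\` N) + Defs.total_variation D (Omega `&` N))%E.
  rewrite !TV// -ge0_integral_setU//; first by rewrite setUC setUIDK.
  - by apply/measurable_EFinP; exact: measurable_funTS.
  - by move=> x _; rewrite lee_fin enorm_ge0.
  - by rewrite disj_set2E; apply/eqP; rewrite setDE setIACA setICl setI0.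
have ihe : leb2.-integrable Omega (EFin \o (fun x => enorm (h x))) by exact: integrable_enorm.
apply: leeD.
  rewrite (negligible_integral mN mO ihe N0) (@total_variationE _ D leb2 _ h)//.
  - apply: le_lt_trans leb2_bounded; apply: le_measure; rewrite ?inE//.
  - move=> i j; apply: integrableS (ih i j) => //.
  - move=> F i j mF FO; rewrite DE// setIidl; last by apply: subset_trans FO _; exact: subDsetl.
    rewrite -[X in S i j X](_ : F `\` N = F) ?SN ?adde0//.
    by apply/seteqP; split=> [x []//|x Fx]; split => //; have [] := FO _ Fx.
have isig i j A : measurable A -> m.-integrable A (EFin \o (fun x => sigma x i j)).
  by move=> mA; apply: integrableS (ds i j).1.
have TVS A : measurable A -> (forall F i j, measurable F -> F `<=` A -> D i j F = S i j F) ->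
    Defs.total_variation D A = (\int[m]_(x in A) (enorm (sigma x))%:E)%E.
  move=> mA DS; apply: total_variationE => //.
  - by rewrite ltey_eq fin_num_measure.
  - by move=> i j; exact: isig.
  - by move=> F i j mF FA; rewrite DS// (ds i j).2.
rewrite TVS//; last first.
  move=> F i j mF FO; rewrite DE//.
  have mFO : measurable (F `&` Omega) by exact: measurableI.
  rewrite null_set_integral ?add0e//.
    apply: measurable_funS (measurable_int _ (ih i j)) => //; exact: subIsetr.
  apply/negligibleP => //; apply: (@negligibleS _ _ _ leb2 N); last exact/negligibleP.
  by move=> x [Fx _]; have [] := FO _ Fx.
(* [S] is zero on subsets of this set, so both [sigma] and 0 are densities of it there; computing
   its total variation with each gives the claim. *)
have z : (\int[m]_(x in Omega `\` N) (enorm (sigma x))%:E = 0)%E.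
  have mfin : (m (Omega `\` N) < +oo)%E by rewrite ltey_eq fin_num_measure.
  rewrite -(@total_variationE _ S m _ sigma)//; last 2 first.
  - by move=> i j; exact: isig.
  - by move=> F i j mF FO; rewrite (ds i j).2.
  rewrite (@total_variationE _ S m _ (fun=> 0))//; last 2 first.
  - by move=> i j; under eq_fun do rewrite mxE; exact: integrable0.
  - move=> F i j mF FO; under eq_integral do rewrite mxE.
    rewrite integral0 -[X in S i j X](_ : F `\` N = F) ?SN//.
    by apply/seteqP; split=> [x []//|x Fx]; split => //; have [] := FO _ Fx.
  by under eq_integral do rewrite enorm0; rewrite integral0.
have -> : Omega = (Omega `\` N) `|` (Omega `&` N) by rewrite setUC setUIDK.
rewrite ge0_integral_setU//; last 3 first.
- apply/measurable_EFinP; apply: measurable_enorm => i j.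
  by apply: measurable_funTS; exact: integrable_fun_measurable (ds i j).1.
- by move=> x _; rewrite lee_fin enorm_ge0.
- by rewrite disj_set2E; apply/eqP; rewrite setDE setIACA setICl setI0.
by rewrite z add0e;
    have -> : (Omega `\` N `|` Omega `&` N) `&` N = Omega `&` N; rewrite // setUC setUIDK.
Qed.

End decompositions.

(** * Uniqueness and linearity of weak derivatives *)

Section BH_linearity.
Context {R : realType} (Omega : set (plane R)).
Hypotheses (oO : open (Omega : set (R * R))).
Implicit Types (u v : plane R -> R).

Let mO : measurable Omega.
Proof. exact: open_plane_measurable. Qed.

Local Notation lin a u v := (fun x => a * u x + v x).

Lemma integrable_lin (mu : {measure set (plane R) -> \bar R}) A a u v : measurable A ->
  mu.-integrable A (EFin \o u) -> mu.-integrable A (EFin \o v) ->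
  mu.-integrable A (EFin \o lin a u v) /\
  \int[mu]_(x in A) (a * u x + v x) =
  a * \int[mu]_(x in A) u x + \int[mu]_(x in A) v x.
Proof.
move=> mA iu iv.
have iau : mu.-integrable A (EFin \o (fun x => a * u x)).
  rewrite (_ : _ \o _ = (fun x => a%:E * (u x)%:E)%E)//.
  exact: (integrableZl mA a iu).
split; last by rewrite RintegralD// RintegralZl.
exact: (integrableD mA iau iv).
Qed.

Lemma integrable_partial u i phi : leb2.-integrable Omega (EFin \o u) ->
  test_function Omega phi ->
  leb2.-integrable Omega (EFin \o (fun x => u x * partial i phi x)).
Proof.
move=> iu tphi; have [C hC] := test_function_partial_bounded i tphi.
rewrite (_ : (fun x => _) = (fun x => partial i phi x * u x)); last first.
  by apply/funext => x; rewrite mulrC.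
apply: (@integrable_bounded_mul _ _ _ _ _ _ _ C) => //.
by apply: measurable_funTS; exact: test_function_partial_measurable tphi.
Qed.

Lemma integrable_test w phi : leb2.-integrable Omega (EFin \o w) ->
  test_function Omega phi ->
  leb2.-integrable Omega (EFin \o (fun x => w x * phi x)).
Proof.
move=> iw tphi; have [C hC] := test_function_bounded tphi.
rewrite (_ : (fun x => _) = (fun x => phi x * w x)); last first.
  by apply/funext => x; rewrite mulrC.
apply: (@integrable_bounded_mul _ _ _ _ _ _ _ C) => //.
by apply: measurable_funTS; exact: test_function_measurable tphi.
Qed.

Lemma weak_gradient_lin a u v w1 w2 :
  leb2.-integrable Omega (EFin \o u) -> leb2.-integrable Omega (EFin \o v) ->
  weak_gradient Omega u w1 -> weak_gradient Omega v w2 ->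
  weak_gradient Omega (lin a u v) (fun x => a *: w1 x + w2 x).
Proof.
move=> iu iv g1 g2 i; have [i1 e1] := g1 i; have [i2 e2] := g2 i.
have E : (fun x => (a *: w1 x + w2 x) 0 i) = lin a (fun x => w1 x 0 i) (fun x => w2 x 0 i).
  by apply/funext => x; rewrite !mxE.
split; first by rewrite E; exact: (integrable_lin a mO i1 i2).1.
move=> phi tphi.
transitivity (\int[leb2]_(x in Omega)
    (a * (u x * partial i phi x) + v x * partial i phi x)).
  by apply: eq_Rintegral => x _; rewrite mulrDl mulrA.
rewrite (integrable_lin a mO (integrable_partial i iu tphi) (integrable_partial i iv tphi)).2.
rewrite e1// e2//.
rewrite mulrN -opprD; congr (- _).
rewrite -(integrable_lin a mO (integrable_test i1 tphi) (integrable_test i2 tphi)).2.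
by apply: eq_Rintegral => x _; rewrite !mxE mulrDl mulrA.
Qed.

Lemma weak_gradient_unique u w1 w2 : weak_gradient Omega u w1 ->
  weak_gradient Omega u w2 -> ae_eq leb2 Omega w1 w2.
Proof.
move=> g1 g2.
have H i : ae_eq leb2 Omega (fun x => -1 * w2 x 0 i + w1 x 0 i) (fun=> 0).
  have [i1 e1] := g1 i; have [i2 e2] := g2 i.
  apply: test_integral_ae0 => //; first exact: (integrable_lin (-1) mO i2 i1).1.
  move=> phi tphi.
  transitivity (\int[leb2]_(x in Omega)
      (-1 * (w2 x 0 i * phi x) + w1 x 0 i * phi x)).
    by apply: eq_Rintegral => x _; ring.
  rewrite (integrable_lin (-1) mO (integrable_test i2 tphi) (integrable_test i1 tphi)).2.
  have := e1 _ tphi; rewrite e2// => /oppr_inj ->.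
  by rewrite mulN1r addNr.
apply: filterS2 (H 0) (H (lift ord0 ord0)) => x h0 h1 Ox; apply/rowP => i.
have [-> {i}|-> {i}] : i = 0 \/ i = lift ord0 ord0.
  by case: i => -[|[|//]] ?; [left|right]; exact/val_inj.
  by have := h0 Ox; lra.
by have := h1 Ox; lra.
Qed.

Lemma gradP u : W11 Omega u -> weak_gradient Omega u (grad Omega u).
Proof.
by move=> [_ ex]; rewrite /grad; case: pselect => // h; exact: (svalP (cid h)).
Qed.

Lemma W11_lin a u v : W11 Omega u -> W11 Omega v -> W11 Omega (lin a u v).
Proof.
move=> wu wv; have [iu _] := wu; have [iv _] := wv.
split; first exact: (integrable_lin a mO iu iv).1.
by eexists; apply: weak_gradient_lin; [exact: iu|exact: iv|exact: gradP|exact: gradP].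
Qed.

(** [grad] chooses a representative for each function separately, so linearity comes from uniqueness
    of weak gradients and holds only almost everywhere. *)
Lemma grad_lin a u v : W11 Omega u -> W11 Omega v ->
  ae_eq leb2 Omega (grad Omega (lin a u v)) (fun x => a *: grad Omega u x + grad Omega v x).
Proof.
move=> wu wv; have [iu _] := wu; have [iv _] := wv.
apply: weak_gradient_unique (gradP (W11_lin a wu wv)) _.
by apply: weak_gradient_lin => //; exact: gradP.
Qed.

Lemma distr_gradient_lin a u v nu mu :
  leb2.-integrable Omega (EFin \o u) -> leb2.-integrable Omega (EFin \o v) ->
  distr_gradient Omega u nu -> distr_gradient Omega v mu ->
  distr_gradient Omega (lin a u v) (fun j => cadd (cscale a (nu j)) (mu j)).
Proof.
move=> iu iv gu gv j; have [cu eu] := gu j; have [cv ev] := gv j.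
split.
  move=> A mA.
  change ((a%:E * nu j A + mu j A)%E = (a%:E * nu j (A `&` Omega) + mu j (A `&` Omega))%E).
  by rewrite -cu// -cv.
move=> phi tphi; have [C hC] := test_function_bounded tphi.
rewrite (charge_integralD _ _ _ (test_function_measurable tphi) hC).
transitivity (\int[leb2]_(x in Omega)
    (a * (u x * partial j phi x) + v x * partial j phi x)).
  by apply: eq_Rintegral => x _; rewrite mulrDl mulrA.
rewrite (integrable_lin a mO (integrable_partial j iu tphi) (integrable_partial j iv tphi)).2.
by rewrite (eu _ tphi) (ev _ tphi); ring.
Qed.

Lemma distr_gradient_ae u v nu :
  leb2.-integrable Omega (EFin \o u) -> leb2.-integrable Omega (EFin \o v) ->
  ae_eq leb2 Omega u v -> distr_gradient Omega u nu -> distr_gradient Omega v nu.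
Proof.
move=> iu iv uv gu j; have [cu eu] := gu j; split=> // phi tphi.
rewrite -eu//; congr fine; apply: ae_eq_integral => //.
- exact: measurable_int (integrable_partial j iv tphi).
- exact: measurable_int (integrable_partial j iu tphi).
- by apply: filterS uv => x + Ox => /(_ Ox) ->.
Qed.

Lemma distr_gradient_unique u nu mu : distr_gradient Omega u nu ->
  distr_gradient Omega u mu -> forall j A, measurable A -> nu j A = mu j A.
Proof.
move=> gu gv j A mA; have [cu eu] := gu j; have [cv ev] := gv j.
pose k : {charge set (plane R) -> \bar R} := cadd (cscale (-1) (mu j)) (nu j).
have kE B : k B = ((-1)%:E * mu j B + nu j B)%E by [].
have : k A = 0%E.
  apply: (test_charge0 oO) => //.
    by move=> B mB; rewrite !kE -cu// -cv.
  move=> phi tphi; have [C hC] := test_function_bounded tphi.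
  rewrite (charge_integralD _ _ _ (test_function_measurable tphi) hC).
  have := eu _ tphi; rewrite ev// => /oppr_inj ->.
  by rewrite mulN1r addNr.
rewrite kE EFinN mulN1e => h.
have mf : mu j A \is a fin_num by exact: (@fin_num_measure _ _ _ (mu j)).
apply: (@fin_num_addeI R (- mu j A)%E); first by rewrite fin_numN.
by rewrite h addeC subee.
Qed.

Lemma hessianP u : BH Omega u ->
  forall i, distr_gradient Omega (fun x => grad Omega u x 0 i) (hessian Omega u i).
Proof.
move=> [_ bv]; rewrite /hessian; case: pselect => [h|nh]; first exact: (svalP (cid h)).
exfalso; apply: nh.
have /choice[D hD] : forall i, exists nu, distr_gradient Omega (fun x => grad Omega u x 0 i) nu.
  by move=> i; have [_] := bv i.
by exists D.
Qed.

Lemma hessian_carried u : BH Omega u -> carried Omega (hessian Omega u).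
Proof. by move=> bu i j A mA; have [+ _] := hessianP bu i j; exact. Qed.

Lemma BH_gradient_integrable u i : BH Omega u ->
  leb2.-integrable Omega (EFin \o (fun x => grad Omega u x 0 i)).
Proof. by move=> [_ bv]; have [] := bv i. Qed.

(** The combination of the two gradients is differentiated first; the result passes to the gradient
    of the combination, which differs from it on a null set only. *)
Lemma BH_lin_distr a u v : BH Omega u -> BH Omega v -> forall i,
  distr_gradient Omega (fun x => grad Omega (lin a u v) x 0 i)
    (fun j => cadd (cscale a (hessian Omega u i j)) (hessian Omega v i j)).
Proof.
move=> bu bv i; have iu := BH_gradient_integrable i bu; have iv := BH_gradient_integrable i bv.
apply: (@distr_gradient_ae (lin a (fun x => grad Omega u x 0 i) (fun x => grad Omega v x 0 i))).
- exact: (integrable_lin a mO iu iv).1.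
- by have [] := gradP (W11_lin a bu.1 bv.1) i.
- by apply: filterS (grad_lin a bu.1 bv.1) => x + Ox => /(_ Ox) ->; rewrite !mxE.
- by apply: distr_gradient_lin => //; exact: hessianP.
Qed.

Lemma BH_lin a u v : BH Omega u -> BH Omega v -> BH Omega (lin a u v).
Proof.
move=> bu bv; split; first exact: W11_lin bu.1 bv.1.
move=> i; split; first by have [] := gradP (W11_lin a bu.1 bv.1) i.
by eexists; exact: BH_lin_distr.
Qed.

Lemma hessian_lin a u v : BH Omega u -> BH Omega v -> forall i j A, measurable A ->
  hessian Omega (lin a u v) i j A =
  (a%:E * hessian Omega u i j A + hessian Omega v i j A)%E.
Proof.
move=> bu bv i j A mA.
exact: (distr_gradient_unique (hessianP (BH_lin a bu bv) i) (BH_lin_distr a bu bv i) j mA).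
Qed.

Lemma L2_lin a u v : L2 Omega u -> L2 Omega v -> L2 Omega (lin a u v).
Proof.
rewrite /L2 => hu hv.
have -> : (lin a u v) \_ Omega = (a *: (u \_ Omega) + v \_ Omega).
  apply/funext => x.
  change (((lin a u v) \_ Omega) x = a * (u \_ Omega) x + (v \_ Omega) x).
  rewrite !patchE; case: ifPn => // _.
  by change (0 = a * 0 + 0 :> R); rewrite mulr0 addr0.
have p1 : (1 <= 2%:E :> \bar R)%E by rewrite lee_fin ler1n.
exact: (rpredD (rpredZ a hu) hv).
Qed.

Lemma BH_L2_lin a u v : BH_L2 Omega u -> BH_L2 Omega v -> BH_L2 Omega (lin a u v).
Proof. by move=> [bu lu] [bv lv]; split; [exact: BH_lin|exact: L2_lin]. Qed.

End BH_linearity.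

(** * Finiteness, convexity and Lipschitz bounds of the functionals *)

Section functionals.
Context {R : realType} (Omega : set (plane R)).
Hypotheses (oO : open (Omega : set (R * R))) (bO : bounded_set (Omega : set (R * R))).
Implicit Types (u v : plane R -> R).

Let mO : measurable Omega.
Proof. exact: open_plane_measurable. Qed.

Local Notation lin a u v := (fun x => a * u x + v x).

(** Linearity is available for the shape [a * u + v], so convex combinations are assembled by
    nesting it; this undoes the nesting on numbers. *)
Lemma affine_eq (t x y : R) : t * x + (- t * y + y) = t * x + (1 - t) * y.
Proof. by ring. Qed.

Lemma integrable_linear_growth p q (G : 'M[R]_(p, q) -> R) (K : R)
    (mu : {measure set (plane R) -> \bar R}) (A : set (plane R)) (h : plane R -> 'M[R]_(p, q)) :
  measurable A -> (mu A < +oo)%E -> 0 <= K ->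
  (forall B C, G (B + C) <= G B + K * enorm C) ->
  (forall i j, mu.-integrable A (EFin \o (fun x => h x i j))) ->
  mu.-integrable A (EFin \o (fun x => G (h x))).
Proof.
move=> mA mAoo K0 GL ih.
have icst : mu.-integrable A (EFin \o (fun=> `|G 0|)).
  apply: measurable_bounded_integrable => //.
  by exists `|G 0|; split; [exact: num_real|move=> M hM x _ /=; rewrite normr_id ltW].
have [ig _] := integrable_lin K mA (integrable_enorm mA ih) icst.
apply: le_integrable ig => //.
  apply/measurable_EFinP; apply: (measurable_lipschitz K0 GL) => i j.
  exact: integrable_fun_measurable (ih i j).
move=> x Ax; rewrite /= lee_fin [leRHS]ger0_norm ?addr_ge0 ?mulr_ge0 ?enorm_ge0//.
(* The one-sided Lipschitz bound, used from 0 to [h x] and back, controls [G (h x)] on both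
   sides. *)
have h1 := GL 0 (h x); have h2 := GL (h x) (- h x).
rewrite add0r in h1; rewrite subrr enormN in h2.
have h3 := ler_norm (G 0); have h4 := ler_norm (- G 0); rewrite normrN in h4.
by rewrite ler_norml; apply/andP; split; lra.
Qed.

Section first_order.
Variables (f : 'rV[R]_2 -> R) (K : R).
Hypotheses (cf : convex_on setT f) (f_ge0 : forall x, 0 <= f x) (K0 : 0 < K)
  (fK : forall x, f x <= K * (1 + enorm x)).

Let fL := growth_lipschitz cf f_ge0 K0 fK.

Let igrad u i j : BH Omega u ->
  leb2.-integrable Omega (EFin \o (fun x => grad Omega u x i j)).
Proof. by move=> bu; rewrite (ord1 i); exact: BH_gradient_integrable. Qed.

Let ifgrad u : BH Omega u -> leb2.-integrable Omega (EFin \o (fun x => f (grad Omega u x))).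
Proof.
move=> bu; apply: (integrable_linear_growth mO (leb2_bounded oO bO) (ltW K0) fL) => i j.
exact: igrad.
Qed.

Lemma J_fE u : BH Omega u ->
  J_f Omega f u = (\int[leb2]_(x in Omega) f (grad Omega u x))%:E.
Proof. by move=> bu; exact: Rintegral_EFin (ifgrad bu) mO. Qed.

Lemma J_f_convex t u v : 0 <= t <= 1 -> BH Omega u -> BH Omega v ->
  fine (J_f Omega f (fun x => t * u x + (1 - t) * v x)) <=
  t * fine (J_f Omega f u) + (1 - t) * fine (J_f Omega f v).
Proof.
move=> t01 bu bv; have /andP[t0 t1] := t01.
have -> : (fun x => t * u x + (1 - t) * v x) = lin t (lin (-1) v u) v.
  by apply/funext => x; ring.
have bd : BH Omega (lin (-1) v u) := BH_lin oO (-1) bv bu.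
have bw : BH Omega (lin t (lin (-1) v u) v) := BH_lin oO t bd bv.
have [i1 e1] := integrable_lin t mO (ifgrad bu) (integrable_lin (- t) mO (ifgrad bv) (ifgrad bv)).1.
have E : \int[leb2]_(x in Omega) (t * f (grad Omega u x) +
      (- t * f (grad Omega v x) + f (grad Omega v x))) =
  t * fine (J_f Omega f u) + (1 - t) * fine (J_f Omega f v).
  rewrite e1 (integrable_lin (- t) mO (ifgrad bv) (ifgrad bv)).2.
  by rewrite (J_fE bu) (J_fE bv); exact: affine_eq.
rewrite -E (J_fE bw) /= -lee_fin -(Rintegral_EFin (ifgrad bw) mO) -(Rintegral_EFin i1 mO).
apply: ae_ge0_le_integral => //.
- by move=> x _; rewrite lee_fin.
- exact: measurable_int (ifgrad bw).
- move=> x _; rewrite lee_fin.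
  by rewrite affine_eq addr_ge0// mulr_ge0// subr_ge0.
- exact: measurable_int i1.
apply: filterS2 (grad_lin oO (-1) bv.1 bu.1) (grad_lin oO t bd.1 bv.1) => x h1 h2 Ox.
rewrite lee_fin (h2 Ox) (h1 Ox).
have := cf t01 (I : setT (grad Omega u x)) (I : setT (grad Omega v x)).
set a := grad Omega u x; set b := grad Omega v x.
have -> : t *: (-1 *: b + a) + b = t *: a + (1 - t) *: b.
  by apply/matrixP => i j; rewrite !mxE; ring.
by rewrite affine_eq.
Qed.

Lemma J_f_lipschitz c u h : BH Omega u -> BH Omega h ->
  fine (J_f Omega f (lin c h u)) <=
  fine (J_f Omega f u) + K * `|c| * \int[leb2]_(x in Omega) enorm (grad Omega h x).
Proof.
move=> bu bh.
have bw : BH Omega (lin c h u) := BH_lin oO c bh bu.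
have ie : leb2.-integrable Omega (EFin \o (fun x => enorm (grad Omega h x))).
  by apply: integrable_enorm => // i j; exact: igrad.
have [i1 e1] := integrable_lin (K * `|c|) mO ie (ifgrad bu).
rewrite (J_fE bu) addrC -e1 (J_fE bw) -lee_fin /=.
rewrite -(Rintegral_EFin (ifgrad bw) mO) -(Rintegral_EFin i1 mO).
apply: ae_ge0_le_integral => //.
- by move=> x _; rewrite lee_fin.
- exact: measurable_int (ifgrad bw).
- by move=> x _; rewrite lee_fin addr_ge0// mulr_ge0 ?enorm_ge0// mulr_ge0// ltW.
- exact: measurable_int i1.
apply: filterS (grad_lin oO c bh.1 bu.1) => x h1 Ox.
by rewrite lee_fin (h1 Ox) addrC [leRHS]addrC -mulrA -enormZ; exact: fL.
Qed.

End first_order.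

Lemma enorm_mxvec p q (A : 'M[R]_(p, q)) : enorm (mxvec A) = enorm A.
Proof.
rewrite /enorm; congr Num.sqrt; rewrite big_ord1 pair_bigA /=.
rewrite (reindex _ (curry_mxvec_bij p q)) /=.
by apply: eq_bigr => -[i j] _ /=; rewrite mxvecE.
Qed.

Lemma mxvec_affine p q t (A B : 'M[R]_(p, q)) :
  t *: mxvec A + (1 - t) *: mxvec B = mxvec (t *: (-1 *: B + A) + B).
Proof.
by rewrite -!linearZ -linearD; congr mxvec; apply/matrixP => i j; rewrite !mxE; ring.
Qed.

Section second_order.
Variables (g : 'rV[R]_4 -> R) (K : R).
Hypotheses (cg : convex_on setT g) (g_ge0 : forall x, 0 <= g x) (K0 : 0 < K)
  (gK : forall x, g x <= K * (1 + enorm x)) (gmin : forall x, g 0 <= g x).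

Let G (A : 'M[R]_2) : R := g (mxvec A).
Let Ginf (A : 'M[R]_2) : R := recession g (mxvec A).

Let GL A B : G (A + B) <= G A + K * enorm B.
Proof.
rewrite /G linearD -enorm_mxvec.
exact: (growth_lipschitz cg g_ge0 K0 gK (mxvec A) (mxvec B)).
Qed.

Let GinfL A B : Ginf (A + B) <= Ginf A + K * enorm B.
Proof.
rewrite /Ginf linearD -enorm_mxvec.
exact: (recession_lipschitz cg g_ge0 K0 gK (mxvec A) (mxvec B)).
Qed.

Let GinfZ c A : 0 <= c -> Ginf (c *: A) = c * Ginf A.
Proof.
move=> c0; rewrite /Ginf linearZ; exact: (recessionZ cg g_ge0 K0 gK gmin (mxvec A) c0).
Qed.

Let Ginf_bound A : 0 <= Ginf A <= K * enorm A.
Proof.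
rewrite -enorm_mxvec (recession_ge0 cg g_ge0 K0 gK gmin)/=.
exact: (recession_le_enorm cg g_ge0 K0 gK gmin (mxvec A)).
Qed.

Let convG t A B : 0 <= t <= 1 -> G (t *: (-1 *: B + A) + B) <= t * G A + (1 - t) * G B.
Proof.
by move=> t01; rewrite /G -mxvec_affine; exact: (cg t01 I I).
Qed.

Let convGinf t A B : 0 <= t <= 1 ->
  Ginf (t *: (-1 *: B + A) + B) <= t * Ginf A + (1 - t) * Ginf B.
Proof.
by move=> t01; rewrite /Ginf -mxvec_affine; exact: (convex_recession cg g_ge0 K0 gK t01 I I).
Qed.

Let irep D m h sigma : hessian_rep Omega D m h sigma ->
  leb2.-integrable Omega (EFin \o (fun x => G (h x))) /\
  m.-integrable Omega (EFin \o (fun x => Ginf (sigma x))).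
Proof.
move=> [S [[ih _ _] ds]]; split.
  exact: (integrable_linear_growth mO (leb2_bounded oO bO) (ltW K0) GL ih).
apply: (integrable_linear_growth mO _ (ltW K0) GinfL).
  by rewrite ltey_eq fin_num_measure.
by move=> i j; apply: integrableS (ds i j).1.
Qed.

(** Whatever decomposition [J_g] picks, its absolutely continuous part agrees with [h] almost
    everywhere and its singular part with [S] on measurable sets. So [sigma] is a density of the
    picked part too, and [polar_integral] eliminates the polar pair. *)
Lemma J_gE u m h sigma : BH Omega u -> hessian_rep Omega (hessian Omega u) m h sigma ->
  J_g Omega g u = (\int[leb2]_(x in Omega) G (h x) + \int[m]_(x in Omega) Ginf (sigma x))%:E.
Proof.
move=> bu rep; have [iG iGinf] := irep rep; have [S [dec ds]] := rep.
rewrite EFinD -(Rintegral_EFin iG mO) -(Rintegral_EFin iGinf mO).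
have [tau [th pol]] := polar_decomposition_exists S.
rewrite /J_g; set P := [set c | _].
have [_ [h' [S' [tau' [th' [dec' pol' ->]]]]]] : P (xget +oo%E P).
  (* The set is inhabited, so the default [+oo] is not taken. *)
  by apply: xgetPex; eexists; split=> //; exists h, S, tau, th; split.
have [hh' SS'] := lebesgue_decomposition_unique oO (fun i j A _ => erefl) dec dec'.
have ds' i j : has_density (S' i j) m (fun x => sigma x i j).
  by split; [exact: (ds i j).1|move=> A mA; rewrite -SS'// (ds i j).2].
congr (_ + _)%E.
  have [ih' _ _] := dec'.
  apply: ae_eq_integral => //.
  - exact: measurable_int (integrable_linear_growth mO (leb2_bounded oO bO) (ltW K0) GL ih').
  - exact: measurable_int iG.
  - by apply: filterS hh' => x hx Ox; rewrite /G -hx.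
exact: (polar_integral pol' ds' GinfL GinfZ Ginf_bound (ltW K0) mO).
Qed.

Lemma J_g_fin u : BH Omega u -> J_g Omega g u \is a fin_num.
Proof.
move=> bu; have cu := hessian_carried bu.
have [m [h [sigma [_ [_ [rep _]]]]]] := hessian_rep_pair oO bO cu cu.
by rewrite (J_gE bu rep).
Qed.

(** Both Hessian measures are represented against one [m]; pointwise convexity of [g] is then
    integrated against Lebesgue measure, and that of its recession function against [m]. *)
Lemma J_g_convex t u v : 0 <= t <= 1 -> BH Omega u -> BH Omega v ->
  fine (J_g Omega g (fun x => t * u x + (1 - t) * v x)) <=
  t * fine (J_g Omega g u) + (1 - t) * fine (J_g Omega g v).
Proof.
move=> t01 bu bv; have /andP[t0 t1] := t01.
have -> : (fun x => t * u x + (1 - t) * v x) = lin t (lin (-1) v u) v.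
  by apply/funext => x; ring.
have bd : BH Omega (lin (-1) v u) := BH_lin oO (-1) bv bu.
have bw : BH Omega (lin t (lin (-1) v u) v) := BH_lin oO t bd bv.
have [m [h1 [s1 [h2 [s2 [rep1 rep2]]]]]] :=
  hessian_rep_pair oO bO (hessian_carried bu) (hessian_carried bv).
have repd := hessian_repD oO (hessian_lin oO (-1) bv bu) rep2 rep1.
have repw := hessian_repD oO (hessian_lin oO t bd bv) repd rep2.
rewrite (J_gE bu rep1) (J_gE bv rep2) (J_gE bw repw) /=.
have [iG1 iI1] := irep rep1; have [iG2 iI2] := irep rep2; have [iGw iIw] := irep repw.
have lincomb (mu : {measure set (plane R) -> \bar R}) (a b c : plane R -> R) :
    mu.-integrable Omega (EFin \o a) -> mu.-integrable Omega (EFin \o b) ->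
    mu.-integrable Omega (EFin \o c) -> (forall x, c x <= t * a x + (1 - t) * b x) ->
    \int[mu]_(x in Omega) c x <=
    t * \int[mu]_(x in Omega) a x + (1 - t) * \int[mu]_(x in Omega) b x.
  move=> ia ib ic cab.
  have [i1 e1] := integrable_lin t mO ia (integrable_lin (- t) mO ib ib).1.
  have -> : t * \int[mu]_(x in Omega) a x + (1 - t) * \int[mu]_(x in Omega) b x =
     \int[mu]_(x in Omega) (t * a x + (- t * b x + b x)).
    by rewrite e1 (integrable_lin (- t) mO ib ib).2 affine_eq.
  apply: le_Rintegral => // x _; apply: le_trans (cab x) _; lra.
have l1 := lincomb _ _ _ _ iG1 iG2 iGw (fun x => convG (h1 x) (h2 x) t01).
have l2 := lincomb _ _ _ _ iI1 iI2 iIw (fun x => convGinf (s1 x) (s2 x) t01).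
by apply: le_trans (lerD l1 l2) _; rewrite addrACA -!mulrDr.
Qed.

(** [g] and its recession function share the Lipschitz constant [K], so the increments of the two
    integrals combine into one multiple of the total variation. *)
Lemma J_g_lipschitz c u k : BH Omega u -> BH Omega k ->
  fine (J_g Omega g (lin c k u)) <=
  fine (J_g Omega g u) + K * `|c| * fine (Defs.total_variation (hessian Omega k) Omega).
Proof.
move=> bu bk.
have bw : BH Omega (lin c k u) := BH_lin oO c bk bu.
have [m [h1 [s1 [h2 [s2 [rep1 rep2]]]]]] :=
  hessian_rep_pair oO bO (hessian_carried bu) (hessian_carried bk).
have repw := hessian_repD oO (hessian_lin oO c bk bu) rep2 rep1.
rewrite (J_gE bu rep1) (J_gE bw repw) /=.
have [iG1 iI1] := irep rep1; have [iGw iIw] := irep repw.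
have [S2 [[ih2 _ _] ds2]] := rep2.
have ie : leb2.-integrable Omega (EFin \o (fun x => enorm (h2 x))) by exact: integrable_enorm.
have ies : m.-integrable Omega (EFin \o (fun x => enorm (s2 x))).
  by apply: integrable_enorm => // i j; apply: integrableS (ds2 i j).1.
have TVfin := total_variation_fin oO (hessian_carried bk).
have TV0 : (0 <= Defs.total_variation (hessian Omega k) Omega)%E.
  apply: le_trans (total_variation_hessian_rep oO bO rep2).
  by apply: adde_ge0; apply: integral_ge0 => x _; rewrite lee_fin enorm_ge0.
have := total_variation_hessian_rep oO bO rep2.
rewrite (Rintegral_EFin ie mO) (Rintegral_EFin ies mO) -EFinD
  -(@fineK _ (Defs.total_variation _ _)) ?ge0_fin_numE// lee_fin.
set TV := fine _ => hTV.
have step (mu : {measure set (plane R) -> \bar R}) (a b e : plane R -> R) :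
    mu.-integrable Omega (EFin \o a) -> mu.-integrable Omega (EFin \o b) ->
    mu.-integrable Omega (EFin \o e) -> (forall x, e x <= a x + K * `|c| * b x) ->
    \int[mu]_(x in Omega) e x <=
    \int[mu]_(x in Omega) a x + K * `|c| * \int[mu]_(x in Omega) b x.
  move=> ia ib ic cab.
  have [i1 e1] := integrable_lin (K * `|c|) mO ib ia.
  rewrite addrC -e1; apply: le_Rintegral => // x _.
  by apply: le_trans (cab x) _; rewrite addrC.
have l1 : \int[leb2]_(x in Omega) G (c *: h2 x + h1 x) <=
    \int[leb2]_(x in Omega) G (h1 x) + K * `|c| * \int[leb2]_(x in Omega) enorm (h2 x).
  by apply: step => // x; rewrite addrC -mulrA -enormZ.
have l2 : \int[m]_(x in Omega) Ginf (c *: s2 x + s1 x) <=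
    \int[m]_(x in Omega) Ginf (s1 x) + K * `|c| * \int[m]_(x in Omega) enorm (s2 x).
  by apply: step => // x; rewrite addrC -mulrA -enormZ.
apply: le_trans (lerD l1 l2) _; rewrite addrACA -mulrDr lerD2l.
by apply: ler_wpM2l hTV; rewrite mulr_ge0// ltW.
Qed.

End second_order.

Lemma BH_norm_gradient u : BH Omega u ->
  \int[leb2]_(x in Omega) enorm (grad Omega u x) <= BH_norm Omega u.
Proof.
move=> bu; rewrite /BH_norm.
have h1 : 0 <= \int[leb2]_(x in Omega) `|u x| by exact: Rintegral_ge0.
have h2 : 0 <= fine (Defs.total_variation (hessian Omega u) Omega).
  have cu := hessian_carried bu.
  have [m [h [s [_ [_ [rep _]]]]]] := hessian_rep_pair oO bO cu cu.
  apply: fine_ge0; apply: le_trans (total_variation_hessian_rep oO bO rep).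
  by apply: adde_ge0; apply: integral_ge0 => x _; rewrite lee_fin enorm_ge0.
lra.
Qed.

Lemma BH_norm_hessian u :
  fine (Defs.total_variation (hessian Omega u) Omega) <= BH_norm Omega u.
Proof.
rewrite /BH_norm lerDr addr_ge0//; first exact: Rintegral_ge0.
by apply: Rintegral_ge0 => x _; exact: enorm_ge0.
Qed.

End functionals.

(** * Optimality conditions and estimates *)

Section L2_theory.
Context {R : realType} (Omega : set (plane R)).
Hypotheses (oO : open (Omega : set (R * R))).
Implicit Types (u v w : plane R -> R).

Let mO : measurable Omega.
Proof. exact: open_plane_measurable. Qed.

Local Notation lin a u v := (fun x => a * u x + v x).
Local Notation ip := (L2_inner Omega).

Lemma L2_mul_integrable u v : L2 Omega u -> L2 Omega v ->
  leb2.-integrable Omega (EFin \o (fun x => u x * v x)).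
Proof.
move=> hu hv; apply/(integrable_mkcond _ mO).
have /Lfun1_integrable := Lfun2_mul_Lfun1 hu hv.
congr (leb2.-integrable setT _); apply/funext => x; rewrite /= !patchE.
by case: ifPn => // _; rewrite mul0r.
Qed.

Lemma L2_norm_sqr u : L2 Omega u -> L2_norm Omega u ^+ 2 = ip u u.
Proof.
move=> hu; apply: EFin_inj.
have Nfin : Lnorm leb2 2%:E (EFin \o (u \_ Omega)) \is a fin_num.
  rewrite ge0_fin_numE ?Lnorm_ge0//.
  by move: hu; rewrite /L2 inE => /andP[_]; rewrite inE.
have := @powR_Lnorm _ _ _ (@leb2 R) (EFin \o (u \_ Omega)) 2 (lt0r_neq0 (ltr0Sn R 1)).
rewrite -(fineK Nfin) poweR_EFin powR_mulrn; last by rewrite fine_ge0// Lnorm_ge0.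
rewrite /L2_norm => ->.
rewrite -(Rintegral_EFin (L2_mul_integrable hu hu) mO) [RHS]integral_mkcond.
apply: eq_integral => x _.
change ((`|(u \_ Omega) x|%:E `^ 2)%E = ((EFin \o (fun y => u y * u y)) \_ Omega) x).
rewrite poweR_EFin powR_mulrn ?normr_ge0// real_normK ?num_real// !patchE.
by case: ifPn => // _; congr EFin; rewrite expr2 mul0r.
Qed.

Lemma L2_inner_sym u v : ip u v = ip v u.
Proof. by apply: eq_Rintegral => x _; rewrite mulrC. Qed.

Lemma L2_inner_linr a w u v : L2 Omega w -> L2 Omega u -> L2 Omega v ->
  ip w (lin a u v) = a * ip w u + ip w v.
Proof.
move=> hw hu hv.
have [_ <-] := integrable_lin a mO (L2_mul_integrable hw hu) (L2_mul_integrable hw hv).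
by apply: eq_Rintegral => x _; rewrite mulrDr mulrCA.
Qed.

Lemma L2_inner_linl a w u v : L2 Omega w -> L2 Omega u -> L2 Omega v ->
  ip (lin a u v) w = a * ip u w + ip v w.
Proof.
by move=> hw hu hv; rewrite L2_inner_sym L2_inner_linr// ![ip w _]L2_inner_sym.
Qed.

(** The means of exploiting the linearity of [T], which holds only up to null sets. *)
Lemma L2_inner_aer w u v : L2 Omega w -> L2 Omega u -> L2 Omega v ->
  ae_eq leb2 Omega u v -> ip w u = ip w v.
Proof.
move=> hw hu hv uv; congr fine; apply: ae_eq_integral => //.
- exact: measurable_int (L2_mul_integrable hw hu).
- exact: measurable_int (L2_mul_integrable hw hv).
- by apply: filterS uv => x h Ox; rewrite (h Ox).
Qed.

Lemma L2_inner_ge0 u : 0 <= ip u u.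
Proof. by apply: Rintegral_ge0 => x _; rewrite -expr2 sqr_ge0. Qed.

Lemma L2_sub u v : L2 Omega u -> L2 Omega v -> L2 Omega (u \- v).
Proof.
move=> hu hv; rewrite (_ : u \- v = lin (-1) v u); first exact: L2_lin.
by apply/funext => x /=; rewrite mulN1r addrC.
Qed.

End L2_theory.

Section real_inequalities.
Context {R : realType}.
Implicit Types a b x y z : R.

Lemma affine_increment al be a1 b1 a2 b2 x :
  al * a1 + be * b1 + x <= al * a2 + be * b2 :> R ->
  x <= al * (a2 - a1) + be * (b2 - b1).
Proof. lra. Qed.

(** The comparison of u with u + t d, d = v - u, after division by [t]: [x], [y], [z] stand for
    |r|^2, <r, T d> and |T d|^2, where r is the residual at u. *)
Lemma quadratic_increment t al be x y z a b a1 b1 a2 b2 :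
  0 < t -> 0 <= al -> 0 <= be ->
  a <= t * a2 + (1 - t) * a1 -> b <= t * b2 + (1 - t) * b1 ->
  2^-1 * x + al * a1 + be * b1 <=
    2^-1 * (x - 2 * t * y + t ^+ 2 * z) + al * a + be * b ->
  y <= al * (a2 - a1) + be * (b2 - b1) + t * (2^-1 * z).
Proof.
move=> t0 al0 be0 /(ler_wpM2l al0) h1 /(ler_wpM2l be0) h2 h3.
rewrite -(ler_pM2l t0); lra.
Qed.

End real_inequalities.

Section optimality.
Context {R : realType} (Omega : set (plane R)) (T : (plane R -> R) -> (plane R -> R)).
Variables (alpha beta : R) (f : 'rV[R]_2 -> R) (g : 'rV[R]_4 -> R) (K1 K2 : R).
Hypotheses (oO : open (Omega : set (R * R))) (bO : bounded_set (Omega : set (R * R)))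
  (TL : bounded_linear_L2 Omega T) (alpha_ge0 : 0 <= alpha) (beta_ge0 : 0 <= beta)
  (cf : convex_on setT f) (f_ge0 : forall x, 0 <= f x) (K1_gt0 : 0 < K1)
  (fK : forall x, f x <= K1 * (1 + enorm x))
  (cg : convex_on setT g) (g_ge0 : forall x, 0 <= g x) (K2_gt0 : 0 < K2)
  (gK : forall x, g x <= K2 * (1 + enorm x)) (gmin : forall x, g 0 <= g x).
Implicit Types (u v w : plane R -> R) (xi p s : (plane R -> R) -> R).

Local Notation lin a u v := (fun x => a * u x + v x).
Local Notation ip := (L2_inner Omega).
Local Notation V := (plane R -> R^o).
Local Notation W := (BH_L2 Omega : set V).
Local Notation J1 := (fun u => fine (J_f Omega f u)).
Local Notation J2 := (fun u => fine (J_g Omega g u)).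

Let J1E u : BH Omega u -> J_f Omega f u = (J1 u)%:E.
Proof. by move=> bu; rewrite (J_fE oO bO cf f_ge0 K1_gt0 fK bu). Qed.

Let J2E u : BH Omega u -> J_g Omega g u = (J2 u)%:E.
Proof. by move=> bu; rewrite fineK// (J_g_fin oO bO cg g_ge0 K2_gt0 gK gmin bu). Qed.

Lemma BH_L2_subspace u : BH_L2 Omega u -> subspace W.
Proof.
move=> wu; have lW a v w : W v -> W w -> W (a *: v + w).
  by move=> wv ww; exact: (BH_L2_lin oO a wv ww).
split=> //; have := lW (-1) _ _ wu wu; congr (BH_L2 Omega _).
by rewrite scaleN1r addNr.
Qed.

Lemma J_f_convex_on : convex_on W J1.
Proof.
move=> t u v t01 [bu _] [bv _].
exact: (J_f_convex oO bO cf f_ge0 K1_gt0 fK t01 bu bv).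
Qed.

Lemma J_g_convex_on : convex_on W J2.
Proof.
move=> t u v t01 [bu _] [bv _].
exact: (J_g_convex oO bO cg g_ge0 K2_gt0 gK gmin t01 bu bv).
Qed.

(* J grows at most linearly along u + c h, hence so does a linear minorant of
   h |-> J (u + h) - J u. *)
Lemma subgradient_BH_dual (J : V -> R) (K : R) u p : 0 <= K -> W u ->
  (forall c h, W h -> J (lin c h u) <= J u + K * `|c| * BH_norm Omega h) ->
  linear_on W p -> (forall v, W v -> J u + p (v - u) <= J v) -> BH_dual Omega p.
Proof.
move=> K0 wu JL lp pJ; split; first by move=> a v w wv ww; exact: (lp a v w wv ww).
exists K => h wh; have sW := BH_L2_subspace wu.
have bound c : c * p h <= K * `|c| * BH_norm Omega h.
  have wc : W (c *: h + u) by apply: sW.2.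
  have := le_trans (pJ _ wc) (JL c h wh).
  by rewrite addrK (linear_onZ _ sW lp wh); lra.
have := bound 1; have := bound (-1); rewrite normrN normr1 mulN1r mul1r mulr1 => h1 h2.
by rewrite ler_norml lerNl h1 h2.
Qed.

(** Shared by the minimiser and the original image: of [xi] it asks only linearity and the
    variational inequality for the regulariser. *)
Lemma splits_exist u xi : BH_L2 Omega u -> linear_on W xi ->
  (forall v, BH_L2 Omega v ->
    xi (v \- u) <= alpha * (J1 v - J1 u) + beta * (J2 v - J2 u)) ->
  exists p s, splits Omega alpha beta f g u xi p s.
Proof.
move=> wu lxi xiJ; have [bu _] := wu.
have [p [s [lp ls pJ sJ xiE]]] := subgradient_split (BH_L2_subspace wu) J_f_convex_on
  J_g_convex_on alpha_ge0 beta_ge0 wu lxi xiJ.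
exists p, s; split=> //.
- split=> //.
    apply: (subgradient_BH_dual (ltW K1_gt0) wu _ lp pJ) => c h [bh _].
    apply: le_trans (J_f_lipschitz oO bO cf f_ge0 K1_gt0 fK c bu bh) _.
    rewrite lerD2l ler_wpM2l ?mulr_ge0 ?(ltW K1_gt0)//.
    exact: (BH_norm_gradient oO bO bh).
  by move=> v wv; rewrite (J1E bu) (J1E wv.1) -EFinD lee_fin; exact: (pJ v wv).
- split=> //.
    apply: (subgradient_BH_dual (ltW K2_gt0) wu _ ls sJ) => c h [bh _].
    apply: le_trans (J_g_lipschitz oO bO cg g_ge0 K2_gt0 gK gmin c bu bh) _.
    rewrite lerD2l ler_wpM2l ?mulr_ge0 ?(ltW K2_gt0)//.
    exact: BH_norm_hessian.
  by move=> v wv; rewrite (J2E bu) (J2E wv.1) -EFinD lee_fin; exact: (sJ v wv).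
Qed.

Lemma T_L2 u : L2 Omega u -> L2 Omega (T u).
Proof. by case: TL => + _ _; exact. Qed.

Lemma inner_T_lin a q u v : L2 Omega q -> L2 Omega u -> L2 Omega v ->
  ip q (T (lin a u v)) = a * ip q (T u) + ip q (T v).
Proof.
move=> hq hu hv; have [_ Tlin _] := TL.
rewrite -(L2_inner_linr oO a hq (T_L2 hu) (T_L2 hv)).
apply: (L2_inner_aer oO hq) (Tlin a u v hu hv); first exact/T_L2/L2_lin.
by apply: L2_lin; exact: T_L2.
Qed.

Lemma adjoint_linear_on q : L2 Omega q -> linear_on W (adjoint Omega T q).
Proof. by move=> hq a u v [_ hu] [_ hv]; exact: (inner_T_lin a hq hu hv). Qed.

Lemma regulariserE u : BH Omega u ->
  regulariser Omega alpha beta f g u = (alpha * J1 u + beta * J2 u)%:E.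
Proof. by move=> bu; rewrite EFinD !EFinM -(J1E bu) -(J2E bu). Qed.

Lemma regulariser_variational u xi : BH_L2 Omega u ->
  subdifferential Omega (regulariser Omega alpha beta f g) u xi ->
  forall v, BH_L2 Omega v ->
    xi (v \- u) <= alpha * (J1 v - J1 u) + beta * (J2 v - J2 u).
Proof.
move=> wu [_ _ xiR] v wv; have := xiR v wv.
rewrite (regulariserE wu.1) (regulariserE wv.1) -EFinD lee_fin.
exact: affine_increment.
Qed.

Lemma objectiveE u0 u : L2 Omega u0 -> BH_L2 Omega u ->
  objective Omega T alpha beta f g u0 u =
  (2^-1 * ip (u0 \- T u) (u0 \- T u) + alpha * J1 u + beta * J2 u)%:E.
Proof.
move=> h0 [bu hu]; rewrite !EFinD [(alpha * _)%:E]EFinM [(beta * _)%:E]EFinM.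
rewrite -(J1E bu) -(J2E bu) /objective.
by rewrite (L2_norm_sqr oO (L2_sub h0 (T_L2 hu))).
Qed.

Lemma minimiser_variational u0 u : L2 Omega u0 ->
  minimiser Omega (objective Omega T alpha beta f g u0) u ->
  forall v, BH_L2 Omega v ->
    adjoint Omega T (u0 \- T u) (v \- u) <=
    alpha * (J1 v - J1 u) + beta * (J2 v - J2 u).
Proof.
move=> h0 [wu umin] v wv; have [bu hu] := wu; have [bv hv] := wv.
set r := u0 \- T u; have hr : L2 Omega r := L2_sub h0 (T_L2 hu).
have -> : v \- u = lin (-1) u v by apply/funext => x /=; rewrite mulN1r addrC.
set d := lin (-1) u v.
have wd : BH_L2 Omega d := BH_L2_lin oO (-1) wu wv.
have hTd : L2 Omega (T d) := T_L2 wd.2.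
set X := _ + _; rewrite /adjoint.
have key t : 0 < t -> t <= 1 -> ip r (T d) <= X + t * (2^-1 * ip (T d) (T d)).
  move=> t0 t1; have t01 : 0 <= t <= 1 by rewrite (ltW t0).
  have ww : BH_L2 Omega (lin t d u) := BH_L2_lin oO t wd wu.
  have wE : lin t d u = (fun x => t * v x + (1 - t) * u x).
    by apply/funext => x; rewrite /d; ring.
  have c1 : J1 (lin t d u) <= t * J1 v + (1 - t) * J1 u.
    by rewrite wE; exact: (J_f_convex oO bO cf f_ge0 K1_gt0 fK t01 bv bu).
  have c2 : J2 (lin t d u) <= t * J2 v + (1 - t) * J2 u.
    by rewrite wE; exact: (J_g_convex oO bO cg g_ge0 K2_gt0 gK gmin t01 bv bu).
  have hw : L2 Omega (u0 \- T (lin t d u)) := L2_sub h0 (T_L2 ww.2).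
  have hw' : L2 Omega (lin (- t) (T d) r) by exact: L2_lin.
  have aew : ae_eq leb2 Omega (u0 \- T (lin t d u)) (lin (- t) (T d) r).
    have [_ Tlin _] := TL.
    apply: filterS (Tlin t d u wd.2 hu) => x h Ox.
    by rewrite /r /= (h Ox); ring.
  have E : ip (u0 \- T (lin t d u)) (u0 \- T (lin t d u)) =
      ip r r - 2 * t * ip r (T d) + t ^+ 2 * ip (T d) (T d).
    rewrite (L2_inner_aer oO hw hw hw' aew) L2_inner_sym (L2_inner_aer oO hw' hw hw' aew).
    rewrite (L2_inner_linr oO _ hw' hTd hr) !(L2_inner_linl oO _ _ hTd hr)//.
    rewrite (L2_inner_sym _ (T d) r).
    move: (ip r r) (ip r (T d)) (ip (T d) (T d)) => x y z; ring.
  have := umin _ ww; rewrite (objectiveE h0 wu) (objectiveE h0 ww) E lee_fin.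
  exact: (quadratic_increment t0 alpha_ge0 beta_ge0 c1 c2).
apply/ler_addgt0Pr => e e0.
have M0 : 0 <= 2^-1 * ip (T d) (T d) by rewrite mulr_ge0 ?invr_ge0// L2_inner_ge0.
set M := 2^-1 * _ in key M0.
(* At this step size the remainder [t * M] is at most [e]; the cap at 1 keeps the competitor a
   convex combination. *)
have t0 : 0 < Num.min 1 (e / (M + 1)) by rewrite lt_min ltr01 divr_gt0// ltr_wpDl.
apply: le_trans (key _ t0 _) _; first by rewrite ge_min lexx.
rewrite lerD2l; apply: (@le_trans _ _ (e / (M + 1) * M)).
  by rewrite ler_wpM2r// ge_min lexx orbT.
by rewrite mulrAC ler_pdivrMr ?ltr_wpDl// ler_wpM2l ?ltW//; lra.
Qed.

Lemma minimiser_splits u0 u : L2 Omega u0 ->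
  minimiser Omega (objective Omega T alpha beta f g u0) u ->
  exists p s, splits Omega alpha beta f g u (adjoint Omega T (u0 \- T u)) p s.
Proof.
move=> h0 umin; have [wu _] := umin.
apply: splits_exist => //; last exact: minimiser_variational umin.
apply: adjoint_linear_on; exact: (L2_sub h0 (T_L2 wu.2)).
Qed.

Lemma splits_bregman u1 u2 xi1 xi2 p1 s1 p2 s2 :
  splits Omega alpha beta f g u1 xi1 p1 s1 -> splits Omega alpha beta f g u2 xi2 p2 s2 ->
  alpha * bregman_symm p1 p2 u1 u2 + beta * bregman_symm s1 s2 u1 u2 =
  xi1 (u1 \- u2) - xi2 (u1 \- u2).
Proof.
move=> [[wu1 _ _] _ e1] [[wu2 _ _] _ e2].
have wd : BH_L2 Omega (u1 \- u2).
  rewrite (_ : u1 \- u2 = lin (-1) u2 u1); first exact: BH_L2_lin.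
  by apply/funext => x /=; rewrite mulN1r addrC.
rewrite (e1 _ wd) (e2 _ wd) /bregman_symm.
move: (p1 _) (p2 _) (s1 _) (s2 _) => x y z w; ring.
Qed.

End optimality.

(** * Completing squares in L2 *)

Section quadratic_estimates.
Context {R : realType} (Omega : set (plane R)).
Hypothesis oO : open (Omega : set (R * R)).

Local Notation lin a u v := (fun x => a * u x + v x).
Local Notation ip := (L2_inner Omega).

Lemma L2_inner_sqr_lin a (u v : plane R -> R) : L2 Omega u -> L2 Omega v ->
  ip (lin a u v) (lin a u v) = a ^+ 2 * ip u u + 2 * a * ip u v + ip v v.
Proof.
move=> hu hv; have hl : L2 Omega (lin a u v) by exact: L2_lin.
rewrite (L2_inner_linr oO a hl hu hv) (L2_inner_linl oO a hu hu hv).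
rewrite (L2_inner_linl oO a hv hu hv) (L2_inner_sym _ v u).
move: (ip u u) (ip u v) (ip v v) => x y z; ring.
Qed.

(** Names encode inner products, [q1e] for <q1, e>. The hypotheses are the expanded squares of a q1
    + b q2 + n + e, n - a q1 - b q2 and a q1 - b q2, to be added with weights 1/2, 1/2, 1. To fit
    the shape [a * u + v], multiples such as b q2 and - e are written (b - 1) q2 + q2 and -2 e +
    e. *)
Lemma sum_of_squares (a b ee nn q11 q22 ne q1e q2e q1n q2n q12 : R) :
  0 <= a ^+ 2 * q11 + 2 * a * (b * q12 + (1 * q1n + q1e)) +
       (b ^+ 2 * q22 + 2 * b * (1 * q2n + q2e) + (1 ^+ 2 * nn + 2 * 1 * ne + ee)) ->
  0 <= (- a) ^+ 2 * q11 + 2 * (- a) * (- b * q12 + q1n) +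
       ((- b) ^+ 2 * q22 + 2 * (- b) * q2n + nn) ->
  0 <= a ^+ 2 * q11 + 2 * a * ((- b - 1) * q12 + q12) +
       ((- b - 1) ^+ 2 * q22 + 2 * (- b - 1) * q22 + q22) ->
  -1 * ne + (-2 * ee + ee) - (a * q1e + ((b - 1) * q2e + q2e)) + 2^-1 * ee <=
  2 * a ^+ 2 * q11 + 2 * b ^+ 2 * q22 + nn.
Proof. lra. Qed.

(* Twice the right-hand side minus the left-hand side is
   |e + n + a q1 + b q2|^2 + |n - a q1 - b q2|^2 + 2 |a q1 - b q2|^2. *)
Lemma source_condition_estimate a b (e n q1 q2 : plane R -> R) :
  L2 Omega e -> L2 Omega n -> L2 Omega q1 -> L2 Omega q2 ->
  ip (lin (-1) n (lin (-2) e e)) e - ip (lin a q1 (lin (b - 1) q2 q2)) e + 2^-1 * ip e e <=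
  2 * a ^+ 2 * ip q1 q1 + 2 * b ^+ 2 * ip q2 q2 + ip n n.
Proof.
move=> he hn hq1 hq2.
have hee : L2 Omega (lin (-2) e e) := L2_lin (-2) he he.
have hqq : L2 Omega (lin (b - 1) q2 q2) := L2_lin (b - 1) hq2 hq2.
rewrite (L2_inner_linl oO (-1) he hn hee) (L2_inner_linl oO (-2) he he he).
rewrite (L2_inner_linl oO a he hq1 hqq) (L2_inner_linl oO (b - 1) he hq2 hq2).
have h1 : L2 Omega (lin 1 n e) := L2_lin 1 hn he.
have h2 : L2 Omega (lin b q2 (lin 1 n e)) := L2_lin b hq2 h1.
have h3 : L2 Omega (lin (- b) q2 n) := L2_lin (- b) hq2 hn.
have h4 : L2 Omega (lin (- b - 1) q2 q2) := L2_lin (- b - 1) hq2 hq2.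
have z1 := L2_inner_ge0 Omega (lin a q1 (lin b q2 (lin 1 n e))).
rewrite (L2_inner_sqr_lin a hq1 h2) (L2_inner_sqr_lin b hq2 h1) (L2_inner_sqr_lin 1 hn he)
  (L2_inner_linr oO b hq1 hq2 h1) (L2_inner_linr oO 1 hq1 hn he)
  (L2_inner_linr oO 1 hq2 hn he) in z1.
have z2 := L2_inner_ge0 Omega (lin (- a) q1 (lin (- b) q2 n)).
rewrite (L2_inner_sqr_lin (- a) hq1 h3) (L2_inner_sqr_lin (- b) hq2 hn)
  (L2_inner_linr oO (- b) hq1 hq2 hn) in z2.
have z3 := L2_inner_ge0 Omega (lin a q1 (lin (- b - 1) q2 q2)).
rewrite (L2_inner_sqr_lin a hq1 h4) (L2_inner_sqr_lin (- b - 1) hq2 hq2)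
  (L2_inner_linr oO (- b - 1) hq1 hq2 hq2) in z3.
exact: (sum_of_squares z1 z2 z3).
Qed.

(** The terms in [r] cancel and <n, e> - |e|^2 / 2 is left; the bound is |n - e|^2 >= 0. *)
Lemma stability_estimate (e n r : plane R -> R) :
  L2 Omega e -> L2 Omega n -> L2 Omega r ->
  ip (lin 1 (lin (-1) e n) r) e - ip r e + 2^-1 * ip e e <= 2^-1 * ip n n.
Proof.
move=> he hn hr; have h1 : L2 Omega (lin (-1) e n) := L2_lin (-1) he hn.
rewrite (L2_inner_linl oO 1 he h1 hr) (L2_inner_linl oO (-1) he he hn).
have := L2_inner_ge0 Omega (lin (-1) e n); rewrite (L2_inner_sqr_lin (-1) he hn).
rewrite (L2_inner_sym _ n e).
move: (ip e e) (ip e n) (ip n n) (ip r e) => x y z w; clear; lra.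
Qed.

End quadratic_estimates.

(* The symmetric Bregman distances are evaluated at the subgradients that
   make up the optimality condition T^*(u_0 - T u) = alpha p + beta s of a
   minimiser u, and the source condition xi = alpha p + beta s of u~. Such
   subgradients exist, and the estimates hold for every choice of them. *)
Theorem theorem3p10 (R : realType) (Omega : set (plane R))
    (T : (plane R -> R) -> (plane R -> R)) (alpha beta : R)
    (f : 'rV[R]_2 -> R) (g : 'rV[R]_4 -> R) (K1 K2 K3 K4 : R)
    (Omega_bounded : bounded_set (Omega : set (R * R)))
    (Omega_connected : connected (Omega : set (R * R)))
    (Omega_open : open (Omega : set (R * R)))
    (Omega_lipschitz : lipschitz_boundary Omega)
    (T_bounded : bounded_linear_L2 Omega T)
    (alpha_ge0 : 0 <= alpha) (beta_ge0 : 0 <= beta)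
    (f_ge0 : forall x, 0 <= f x) (g_ge0 : forall x, 0 <= g x)
    (f_convex : convex_function (E := 'rV[R]_2) setT f)
    (g_convex : convex_function (E := 'rV[R]_4) setT g)
    (f_min0 : forall x, f 0 <= f x) (g_min0 : forall x, g 0 <= g x)
    (K1_gt0 : 0 < K1) (K2_gt0 : 0 < K2) (K3_gt0 : 0 < K3) (K4_gt0 : 0 < K4)
    (f_growth : forall x, K3 * enorm x <= f x <= K1 * (1 + enorm x))
    (g_growth : forall x, K4 * enorm x <= g x <= K2 * (1 + enorm x))
    (f_diff : forall x, differentiable f x) :
  (forall (ut ut0 u0 u q : plane R -> R) (xi : (plane R -> R) -> R) (delta : R),
    BH_L2 Omega ut -> L2 Omega ut0 -> ae_eq leb2 Omega (T ut) ut0 ->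
    subdifferential Omega (regulariser Omega alpha beta f g) ut xi ->
    adjoint_dom Omega T q ->
    (forall v, BH_L2 Omega v -> xi v = adjoint Omega T q v) ->
    L2 Omega u0 -> 0 < delta -> L2_norm Omega (ut0 \- u0) <= delta ->
    minimiser Omega (objective Omega T alpha beta f g u0) u ->
    [/\ exists p s, splits Omega alpha beta f g u
                      (adjoint Omega T (u0 \- T u)) p s,
        exists pt st, splits Omega alpha beta f g ut xi pt st &
        forall p s pt st,
          splits Omega alpha beta f g u (adjoint Omega T (u0 \- T u)) p s ->
          splits Omega alpha beta f g ut xi pt st ->
        forall q1 q2 : plane R -> R, L2 Omega q1 -> L2 Omega q2 ->
          ae_eq leb2 Omega q (fun x => alpha * q1 x + beta * q2 x) ->
          alpha * bregman_symm p pt u ut + beta * bregman_symm s st u ut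
          + 2^-1 * L2_norm Omega (T u \- ut0) ^+ 2
          <= 2 * alpha ^+ 2 * L2_norm Omega q1 ^+ 2
             + 2 * beta ^+ 2 * L2_norm Omega q2 ^+ 2 + delta ^+ 2])
  /\
  (forall u01 u02 u1 u2 : plane R -> R,
    L2 Omega u01 -> L2 Omega u02 ->
    minimiser Omega (objective Omega T alpha beta f g u01) u1 ->
    minimiser Omega (objective Omega T alpha beta f g u02) u2 ->
    [/\ exists p1 s1, splits Omega alpha beta f g u1
                        (adjoint Omega T (u01 \- T u1)) p1 s1,
        exists p2 s2, splits Omega alpha beta f g u2
                        (adjoint Omega T (u02 \- T u2)) p2 s2 &
        forall p1 s1 p2 s2,
          splits Omega alpha beta f g u1 (adjoint Omega T (u01 \- T u1)) p1 s1 ->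
          splits Omega alpha beta f g u2 (adjoint Omega T (u02 \- T u2)) p2 s2 ->
          alpha * bregman_symm p1 p2 u1 u2 + beta * bregman_symm s1 s2 u1 u2
          + 2^-1 * L2_norm Omega (T (u1 \- u2)) ^+ 2
          <= 2^-1 * L2_norm Omega (u01 \- u02) ^+ 2]).
Proof.
have cf := convex_functionE f_convex; have cg := convex_functionE g_convex.
have fK x : f x <= K1 * (1 + enorm x) by have /andP[] := f_growth x.
have gK x : g x <= K2 * (1 + enorm x) by have /andP[] := g_growth x.
have splitsP := minimiser_splits Omega_open Omega_bounded T_bounded alpha_ge0 beta_ge0
  cf f_ge0 K1_gt0 fK cg g_ge0 K2_gt0 gK g_min0.
have TL2 u : L2 Omega u -> L2 Omega (T u) := @T_L2 _ _ _ T_bounded u.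
have subL (u v : plane R -> R) : u \- v = (fun x => -1 * v x + u x).
  by apply/funext => x /=; rewrite mulN1r addrC.
split.
- move=> ut ut0 u0 u q xi delta wut hut0 Tut xiR [hq _] xiE hu0 delta_gt0 ndelta umin.
  have [wu _] := umin; have [[_ hut] [_ hu]] := (wut, wu).
  split.
  + exact: splitsP umin.
  + apply: (splits_exist Omega_open Omega_bounded alpha_ge0 beta_ge0 cf f_ge0 K1_gt0 fK
      cg g_ge0 K2_gt0 gK g_min0 wut).
      by case: xiR => _ [].
    exact: (regulariser_variational Omega_open Omega_bounded cf f_ge0 K1_gt0 fK
      cg g_ge0 K2_gt0 gK g_min0 wut xiR).
  move=> p s pt st sp spt q1 q2 hq1 hq2 qE.
  rewrite (splits_bregman Omega_open sp spt).
  have wd : BH_L2 Omega (u \- ut) by rewrite subL; exact: BH_L2_lin.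
  rewrite (xiE _ wd) /adjoint.
  pose e : plane R -> R := T u \- ut0; pose n : plane R -> R := ut0 \- u0.
  have he : L2 Omega e := L2_sub (TL2 _ hu) hut0.
  have hn : L2 Omega n := L2_sub hut0 hu0.
  have hr : L2 Omega (u0 \- T u) := L2_sub hu0 (TL2 _ hu).
  have hTd : L2 Omega (T (u \- ut)) := TL2 _ wd.2.
  (* The relation between [ut] and the exact datum [ut0] enters here, together with the almost
     everywhere linearity of [T]. *)
  have Td : ae_eq leb2 Omega (T (u \- ut)) e.
    have [_ Tlin _] := T_bounded; rewrite subL.
    apply: filterS2 (Tlin (-1) ut u hut hu) Tut => x h1 h2 Ox.
    by rewrite (h1 Ox) (h2 Ox) mulN1r addrC.
  rewrite (L2_inner_aer Omega_open hr hTd he Td) (L2_inner_aer Omega_open hq hTd he Td).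
  have -> : u0 \- T u = (fun x => -1 * n x + (-2 * e x + e x)).
    by apply/funext => x; rewrite /n /e /=; ring.
  have hq12 : L2 Omega (fun x => alpha * q1 x + ((beta - 1) * q2 x + q2 x)).
    exact: (L2_lin alpha hq1 (L2_lin (beta - 1) hq2 hq2)).
  rewrite (L2_inner_sym _ q e) (L2_inner_aer Omega_open he hq hq12); last first.
    apply: filterS qE => x h Ox; rewrite (h Ox).
    by rewrite mulrBl mul1r subrK.
  rewrite (L2_inner_sym _ e) (L2_norm_sqr Omega_open he) (L2_norm_sqr Omega_open hq1)
    (L2_norm_sqr Omega_open hq2).
  apply: le_trans (source_condition_estimate Omega_open alpha beta he hn hq1 hq2) _.
  rewrite lerD2l -(L2_norm_sqr Omega_open hn) lerXn2r// nnegrE.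
    by apply: fine_ge0; exact: Lnorm_ge0.
  exact: ltW.
move=> u01 u02 u1 u2 h01 h02 umin1 umin2.
split; [exact: splitsP umin1|exact: splitsP umin2|].
move=> p1 s1 p2 s2 sp1 sp2.
have [[wu1 _] [wu2 _]] := (umin1, umin2).
have [[_ hu1] [_ hu2]] := (wu1, wu2).
rewrite (splits_bregman Omega_open sp1 sp2) /adjoint.
have wd : BH_L2 Omega (u1 \- u2) by rewrite subL; exact: BH_L2_lin.
pose e : plane R -> R := T u1 \- T u2; pose n : plane R -> R := u01 \- u02.
have he : L2 Omega e := L2_sub (TL2 _ hu1) (TL2 _ hu2).
have hn : L2 Omega n := L2_sub h01 h02.
have hr1 : L2 Omega (u01 \- T u1) := L2_sub h01 (TL2 _ hu1).
have hr2 : L2 Omega (u02 \- T u2) := L2_sub h02 (TL2 _ hu2).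
have hTd : L2 Omega (T (u1 \- u2)) := TL2 _ wd.2.
have Td : ae_eq leb2 Omega (T (u1 \- u2)) e.
  have [_ Tlin _] := T_bounded; rewrite subL.
  by apply: filterS (Tlin (-1) u2 u1 hu2 hu1) => x h Ox; rewrite (h Ox) mulN1r addrC.
rewrite (L2_norm_sqr Omega_open hTd) (L2_norm_sqr Omega_open hn).
rewrite (L2_inner_aer Omega_open hTd hTd he Td) (L2_inner_sym _ _ e)
  (L2_inner_aer Omega_open he hTd he Td).
rewrite (L2_inner_aer Omega_open hr1 hTd he Td) (L2_inner_aer Omega_open hr2 hTd he Td).
(* The two residuals differ by n - e; writing the first through the second makes the second
   cancel. *)
have -> : u01 \- T u1 = (fun x => 1 * (-1 * e x + n x) + (u02 \- T u2) x).
  by apply/funext => x; rewrite /n /e /=; ring.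
exact: stability_estimate.
Qed.
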